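(* Let $w\in I_2(m)$ and let $B_w\in\mathbb S\mathrm{Bim}(\mathfrak h,I_2(m))$ be the corresponding indecomposable Soergel bimodule. Then, as graded $R$-bimodules: (a) $\pi_s^{+}(R)\cong R$ and $\pi_s^-(R)\cong R$. (b) $\pi_s^{+}(B_s)\cong R(1)$ and $\pi_s^-(B_s)\cong R(-1)$. (c) If (a reduced expression of) $w$ contains at least one $t$, then $\pi_s^-(B_w)\cong B_t(-\ell(w)+1)$ and $\pi_s^+(B_w)\cong B_t(\ell(w)-1)$.
   Context: Setting. Let $m\ge 2$ be an integer, $I_2(m)=\langle s,t\mid s^2=t^2=(st)^m=e\rangle$ the dihedral group, with length function $\ell$. Let $\mathbf k$ be a commutative ring of characteristic $0$ and $\mathfrak h=(V,\{\alpha_s,\alpha_t\}\subset V^*,\{\alpha_s^\vee,\alpha_t^\vee\}\subset V)$ a symmetric realization: $V$ is a free $\mathbf k$-module of finite rank, $\langle\alpha_u^\vee,\alpha_u\rangle=2$ for $u\in\{s,t\}$, $a_{st}:=\langle\alpha_s^\vee,\alpha_t\rangle=a_{ts}$, the formulas $u(v)=v-\langle v,\alpha_u\rangle\alpha_u^\vee$ define a representation of $I_2(m)$ on $V$, and $a_{st}=-(q+q^{-1})$ for some $q\in\mathbf k$ with $[m]_q=0$, where $[k]_q=q^{k-1}+q^{k-3}+\dots+q^{1-k}$. Standing assumptions: $\alpha_s,\alpha_t$ are linearly independent; there exist fundamental weights $\rho_s,\rho_t\in V^*$ with $\langle\rho_u,\alpha_v^\vee\rangle=\delta_{uv}$ (fixed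 once and for all); $[k]_q$ is invertible in $\mathbf k$ for $1\le k<m$; and $q$ is a primitive $2m$-th root of unity. $R=\mathrm{Sym}^\bullet(V^* )$, graded with $V^*$ in degree $2$; $R^e=R\otimes_{\mathbf k}R$; graded $R^e$-modules are graded $R$-bimodules. Grading shift: $M(1)_d=M_{d+1}$. For $u\in\{s,t\}$, $B_u=R\otimes_{R^u}R(1)$. $\mathbb S\mathrm{Bim}(\mathfrak h,I_2(m))$ is the full, additive, graded, monoidal (under $\otimes_R$), idempotent complete subcategory of graded $R$-bimodules generated by $B_s,B_t$. $B_w$ is the indecomposable Soergel bimodule attached to $w$: the unique indecomposable summand of $B_{s_1}\otimes_R\cdots\otimes_R B_{s_k}$, for a reduced expression $w=s_1\cdots s_k$, that does not occur (up to shift) for shorter expressions. For $M\in\mathbb S\mathrm{Bim}(\mathfrak h,I_2(m))$, $\pi_s^-(M)$ and $\pi_s^+(M)$ are respectively the kernel and the cokernel of the action of $\rho_s\otimes1-1\otimes\rho_s\in R^e$ on $M$, $\pi_s^-(M)$ being a graded sub-bimodule of $M$ and $\pi_s^+(M)$ a graded quotient bimodule of $M$ (with no additional shift). *)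

(* Defs.v *)
From HB Require Import structures.
From mathcomp Require Import all_boot all_order all_algebra all_fingroup.
From mathcomp Require Import ring_quotient.
From mathcomp Require Import boolp.
From mathcomp Require Import freeg mpoly.
From Stdlib Require List.

Set Implicit Arguments.
Unset Strict Implicit.
Unset Printing Implicit Defensive.

Import GRing.Theory.
Local Open Scope ring_scope.
Local Open Scope quotient_scope.

Section Decompositions.
Variables (V : zmodType) (p : int -> V -> V).
Hypothesis pB : forall d, zmod_morphism (p d).
Hypothesis pp : forall d e x, p d (p e x) = if d == e then p e x else 0.
HB.instance Definition _ d := GRing.isZmodMorphism.Build V V (p d) (pB d).

Definition decomposes (x : V) : Prop :=
  exists2 s : seq int, uniq s & x = \sum_(d <- s) p d x.

Lemma dec_out (s : seq int) x : uniq s -> x = \sum_(d <- s) p d x ->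
  forall e, e \notin s -> p e x = 0.
Proof.
move=> us xs e es; rewrite xs raddf_sum big_seq big1 //= => d ds.
by rewrite pp; case: eqP => // ed; rewrite ed ds in es.
Qed.

Lemma sum_sup (W : zmodType) (F : int -> W) (s t : seq int) :
  uniq s -> uniq t -> (forall e, e \notin s -> F e = 0) -> {subset s <= t} ->
  \sum_(d <- s) F d = \sum_(d <- t) F d.
Proof.
move=> us ut F0 st.
rewrite [RHS](bigID (mem s)) /= [X in _ + X]big1 ?addr0 => [|i /F0 //].
rewrite -[in RHS]big_filter; apply: perm_big; apply: uniq_perm => //.
  exact: filter_uniq.
move=> d; rewrite mem_filter /=; case ds: (d \in s) => //=.
by rewrite (st _ ds).
Qed.

Lemma dec_sup (s t : seq int) x : uniq s -> uniq t ->
  x = \sum_(d <- s) p d x -> {subset s <= t} -> x = \sum_(d <- t) p d x.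
Proof.
move=> us ut xs st; rewrite {1}xs; apply: sum_sup => //.
exact: dec_out us xs.
Qed.

Lemma dec_sub x y : decomposes x -> decomposes y -> decomposes (x - y).
Proof.
move=> [s us xs] [t ut yt]; exists (undup (s ++ t)); first exact: undup_uniq.
rewrite (eq_bigr _ (fun i _ => raddfB (p i) x y)) sumrB; congr (_ - _).
  apply: (dec_sup us) => //; first exact: undup_uniq.
  by move=> d ds; rewrite mem_undup mem_cat ds.
apply: (dec_sup ut) => //; first exact: undup_uniq.
by move=> d ds; rewrite mem_undup mem_cat ds orbT.
Qed.

Lemma dec0 : decomposes 0.
Proof. by exists [::]; rewrite ?big_nil. Qed.

Lemma dec_add x y : decomposes x -> decomposes y -> decomposes (x + y).
Proof.
move=> dx dy; rewrite -[y]opprK; apply: dec_sub => //.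
by rewrite -[- y]add0r; apply: dec_sub => //; exact: dec0.
Qed.

Lemma dec_sum (I : Type) (r : seq I) (F : I -> V) :
  (forall i, decomposes (F i)) -> decomposes (\sum_(i <- r) F i).
Proof. by move=> dF; apply: (big_ind decomposes dec0 dec_add) => i _. Qed.

Lemma dec_hom d x : p d x = x -> decomposes x.
Proof. by move=> dx; exists [:: d]; rewrite ?big_seq1. Qed.

End Decompositions.

Section GradedBimodules.
Variables (k : comUnitRingType) (n : nat).
Local Notation R := {mpoly k[n]}.

(* The left action is the one of [lmodType R], [ra] is the right action and   *)
(* [pr d x] is the homogeneous component of degree d of x: the d-th graded    *)
(* piece is {x | pr d x = x}.  As V^* sits in degree 2, polynomials that are  *)
(* homogeneous of degree j in the variables act with degree 2 * j.  ax_raC    *)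
(* says that k acts in the same way on both sides (R^e = R (x)_k R).          *)
Record grbimod_axioms (M : lmodType R) (ra : M -> R -> M) (pr : int -> M -> M)
    : Prop := GrBimodAxioms {
  ax_raDl : forall x y a, ra (x + y) a = ra x a + ra y a;
  ax_raDr : forall x a b, ra x (a + b) = ra x a + ra x b;
  ax_ra1 : forall x, ra x 1 = x;
  ax_raM : forall x a b, ra x (a * b) = ra (ra x a) b;
  ax_lra : forall a x b, a *: ra x b = ra (a *: x) b;
  ax_raC : forall x (c : k), ra x c%:MP = c%:MP *: x;
  ax_prB : forall d x y, pr d (x - y) = pr d x - pr d y;
  ax_pr_pr : forall d e x, pr d (pr e x) = if d == e then pr e x else 0;
  ax_pr_sum : forall x, exists2 s : seq int, uniq s & x = \sum_(d <- s) pr d x;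
  ax_pr_l : forall d j (f : R) x,
    f \is j.-homog -> pr (d + (2 * j)%:Z) (f *: x) = f *: pr d x;
  ax_pr_r : forall d j (f : R) x,
    f \is j.-homog -> pr (d + (2 * j)%:Z) (ra x f) = ra (pr d x) f
}.

Record grbimod := GrBimod {
  gb_car :> lmodType R;
  ract : gb_car -> R -> gb_car;
  pr : int -> gb_car -> gb_car;
  gb_ax : grbimod_axioms ract pr
}.

Definition bimod_iso (M N : grbimod) : Prop :=
  exists f : {linear M -> N},
    [/\ bijective f,
        forall (x : M) a, f (ract x a) = ract (f x) a
      & forall d (x : M), f (pr d x) = pr d (f x)].

Section Theory.
Variable M : grbimod.
Implicit Types x y : M.

Lemma raDl x y a : ract (x + y) a = ract x a + ract y a.
Proof. exact: (ax_raDl (gb_ax M)). Qed.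
Lemma raDr x a b : ract x (a + b) = ract x a + ract x b.
Proof. exact: (ax_raDr (gb_ax M)). Qed.
Lemma ra1 x : ract x 1 = x.
Proof. exact: (ax_ra1 (gb_ax M)). Qed.
Lemma raM x a b : ract x (a * b) = ract (ract x a) b.
Proof. exact: (ax_raM (gb_ax M)). Qed.
Lemma lra a x b : a *: ract x b = ract (a *: x) b.
Proof. exact: (ax_lra (gb_ax M)). Qed.
Lemma raC x (c : k) : ract x c%:MP = c%:MP *: x.
Proof. exact: (ax_raC (gb_ax M)). Qed.
Lemma prB d x y : pr d (x - y) = pr d x - pr d y.
Proof. exact: (ax_prB (gb_ax M)). Qed.
Lemma pr_pr d e x : pr d (pr e x) = if d == e then pr e x else 0.
Proof. exact: (ax_pr_pr (gb_ax M)). Qed.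
Lemma pr_sum x : decomposes (@pr M) x.
Proof. exact: (ax_pr_sum (gb_ax M)). Qed.
Lemma pr_l d j (f : R) x :
  f \is j.-homog -> pr (d + (2 * j)%:Z) (f *: x) = f *: pr d x.
Proof. exact: (ax_pr_l (gb_ax M)). Qed.
Lemma pr_r d j (f : R) x :
  f \is j.-homog -> pr (d + (2 * j)%:Z) (ract x f) = ract (pr d x) f.
Proof. exact: (ax_pr_r (gb_ax M)). Qed.

Lemma ra0l a : ract (0 : M) a = 0.
Proof. by apply: (addrI (ract (0 : M) a)); rewrite -raDl !addr0. Qed.
Lemma raN x a : ract (- x) a = - ract x a.
Proof. by apply/eqP; rewrite -addr_eq0 -raDl addNr ra0l. Qed.
Lemma raB x y a : ract (x - y) a = ract x a - ract y a.
Proof. by rewrite raDl raN. Qed.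
Lemma ra0r x : ract x 0 = 0.
Proof. by apply: (addrI (ract x 0)); rewrite -raDr !addr0. Qed.
Lemma raNr x a : ract x (- a) = - ract x a.
Proof. by apply/eqP; rewrite -addr_eq0 -raDr addNr ra0r. Qed.

Definition ractr (a : R) (x : M) : M := ract x a.
Lemma ract_zmod a : zmod_morphism (ractr a).
Proof. by move=> x y; exact: raB. Qed.
Lemma pr_zmod d : zmod_morphism (@pr M d).
Proof. by move=> x y; exact: prB. Qed.
HB.instance Definition _ a :=
  GRing.isZmodMorphism.Build M M (ractr a) (ract_zmod a).
HB.instance Definition _ d :=
  GRing.isZmodMorphism.Build M M (@pr M d) (pr_zmod d).

Lemma pr0 d : pr d (0 : M) = 0.
Proof. exact: (raddf0 (@pr M d)). Qed.
Lemma prD d x y : pr d (x + y) = pr d x + pr d y.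
Proof. exact: (raddfD (@pr M d)). Qed.
Lemma pr_sumE (I : Type) (r : seq I) (F : I -> M) d :
  pr d (\sum_(i <- r) F i) = \sum_(i <- r) pr d (F i).
Proof. exact: (raddf_sum (@pr M d)). Qed.
Lemma ra_sumr (I : Type) (r : seq I) x (F : I -> R) :
  ract x (\sum_(i <- r) F i) = \sum_(i <- r) ract x (F i).
Proof.
apply: (big_morph (fun a => ract x a)); [exact: raDr|exact: ra0r].
Qed.
Lemma ra_suml (I : Type) (r : seq I) a (F : I -> M) :
  ract (\sum_(i <- r) F i) a = \sum_(i <- r) ract (F i) a.
Proof. exact: (raddf_sum (ractr a)). Qed.

End Theory.

(* 'X_i has degree 2, so the odd and the negative components vanish. *)
Definition regpr (d : int) (f : R) : R :=
  if d is Posz e then if odd e then 0 else pihomog mdeg e./2 f else 0.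

Lemma pihomog_mul i j (f x : R) : f \is j.-homog ->
  pihomog mdeg i (f * x) =
  if (j <= i)%N then f * pihomog mdeg (i - j) x else 0.
Proof.
move=> hf; have e := pihomog_partitionE (leqnn (@mmeasure _ _ mdeg x)).
rewrite {1}e mulr_sumr raddf_sum /=.
have E (d : nat) : pihomog mdeg i (f * pihomog mdeg d x)
    = if (d + j)%N == i then f * pihomog mdeg d x else 0.
  have h : f * pihomog mdeg d x \is (d + j).-homog.
    by rewrite addnC; apply: dhomogM => //; exact: pihomogP.
  case: eqP => [<-|/eqP ne]; first exact: pihomog_dE.
  exact: pihomog_ne0 ne h.
under eq_bigr do rewrite E.
case: leqP => [ji|ij]; last first.
  rewrite big1 // => d _; case: eqP => // di.
  by move: ij; rewrite -di ltnNge leq_addl.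
have [lt|ge] := ltnP (i - j) (@mmeasure _ _ mdeg x).
  rewrite (bigD1 (Ordinal lt)) //= subnK // eqxx big1 ?addr0 // => d nd.
  case: eqP => // di; case/eqP: nd; apply: val_inj => /=.
  by rewrite -di addnK.
have -> : pihomog mdeg (i - j) x = 0.
  rewrite e raddf_sum big1 //= => d _.
  apply: (@pihomog_ne0 _ _ _ d); last exact: pihomogP.
  by apply/negP => /eqP dd; move: (ltn_ord d); rewrite dd ltnNge ge.
rewrite mulr0 big1 // => d _; case: eqP => // di.
by move: (ltn_ord d); rewrite ltnNge -(addnK j d) di ge.
Qed.

Lemma regpr_mul d j (f x : R) : f \is j.-homog ->
  regpr (d + (2 * j)%:Z) (f * x) = f * regpr d x.
Proof.
move=> hf; case: d => [e|e] /=.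
  rewrite oddD mul2n odd_double addbF; case: ifP => [|_]; first by rewrite mulr0.
  by rewrite halfD odd_double andbF add0n doubleK (pihomog_mul _ _ hf) leq_addl addnK.
rewrite mulr0 NegzE; case: (leqP e.+1 (2 * j)) => [le|lt].
  rewrite addrC subzn //=; case: ifP => // od; rewrite (pihomog_mul _ _ hf).
  rewrite leqNgt; suff -> : (((2 * j) - e.+1)./2 < j)%N by [].
  rewrite ltn_half_double -mul2n.
  by rewrite ltn_subrL /= (leq_trans _ le).
rewrite addrC -opprB subzn 1?ltnW //.
by case E: (e.+1 - 2 * j)%N => [|a] //=; move: lt; rewrite -subn_gt0 E.
Qed.

Lemma reg_axioms : @grbimod_axioms R^o *%R regpr.
Proof.
split=> //=.
- by move=> x y a; rewrite mulrDl.
- by move=> x y a; rewrite mulrDr.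
- by move=> x; rewrite mulr1.
- by move=> x a b; rewrite mulrA.
- by move=> a x b; rewrite /GRing.scale /= mulrA.
- by move=> x c; rewrite /GRing.scale /= mulrC.
- move=> [e|e] x y /=; last by rewrite subr0.
  by case: ifP; rewrite ?subr0 // raddfB.
- move=> d e x; case: eqP => [->|ne].
    by case: e => //= e; case: ifP => // od; rewrite od pihomog_id.
  case: d e ne => [d|d] [e|e] //= ne; case: ifP => // od; last by rewrite raddf0.
  case: ifP => oe; first by rewrite raddf0.
  apply: (@pihomog_ne0 _ _ _ e./2); last exact: pihomogP.
  apply/negP => /eqP h; apply: ne; congr Posz.
  by rewrite -[d]odd_double_half -[e]odd_double_half od oe h.
- move=> x; exists [seq (2 * j)%:Z | j <- iota 0 (@mmeasure _ _ mdeg x)].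
    by rewrite map_inj_uniq ?iota_uniq // => i j [] /eqP; rewrite eqn_mul2l => /eqP.
  rewrite big_map.
  rewrite {1}(pihomog_partitionE (leqnn (@mmeasure _ _ mdeg x))).
  rewrite -(big_mkord xpredT (fun d => pihomog mdeg d x)) /index_iota subn0.
  by apply: eq_bigr => j _; rewrite /= mul2n odd_double doubleK.
- by move=> d j f x hf; exact: regpr_mul.
- by move=> d j f x hf; rewrite mulrC (regpr_mul _ _ hf) mulrC.
Qed.

Definition Rbim : grbimod := GrBimod reg_axioms.

Definition shift_pr (M : grbimod) (a d : int) : M -> M := pr (d + a).

Lemma shift_axioms (M : grbimod) (a : int) :
  grbimod_axioms (@ract M) (@shift_pr M a).
Proof.
split.
- exact: raDl.
- exact: raDr.
- exact: ra1.
- exact: raM.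
- exact: lra.
- exact: raC.
- by move=> *; exact: prB.
- by move=> d e x; rewrite /shift_pr pr_pr (inj_eq (addIr a)).
- move=> x; have [s us xs] := pr_sum x; exists [seq d - a | d <- s].
    by rewrite map_inj_uniq //; exact: addIr.
  by rewrite big_map {1}xs; apply: eq_bigr => d _; rewrite /shift_pr subrK.
- by move=> d j f x hf; rewrite /shift_pr addrAC (pr_l _ _ hf).
- by move=> d j f x hf; rewrite /shift_pr addrAC (pr_r _ _ hf).
Qed.

(* M(a)_d = M_(d+a) *)
Definition shift (M : grbimod) (a : int) : grbimod := GrBimod (shift_axioms M a).

Section DirectSum.
Variables M N : grbimod.
Definition dsum_ra (x : (M * N)%type) (a : R) : (M * N)%type :=
  (ract x.1 a, ract x.2 a).
Definition dsum_pr (d : int) (x : (M * N)%type) : (M * N)%type :=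
  (pr d x.1, pr d x.2).

Lemma dsum_axioms : grbimod_axioms dsum_ra dsum_pr.
Proof.
have prBd d : zmod_morphism (dsum_pr d).
  by move=> x y; congr pair; exact: prB.
have ppd d e x : dsum_pr d (dsum_pr e x) = if d == e then dsum_pr e x else 0.
  by rewrite /dsum_pr /= !pr_pr; case: ifP.
split=> //.
- by move=> x y a; congr pair; exact: raDl.
- by move=> x a b; congr pair; exact: raDr.
- by move=> [x y]; rewrite /dsum_ra !ra1.
- by move=> x a b; rewrite /dsum_ra !raM.
- by move=> a x b; congr pair; exact: lra.
- by move=> x c; congr pair; exact: raC.
- move=> [x y]; have -> : (x, y) = (x, 0) + (0, y).
    by congr pair; rewrite /= ?addr0 ?add0r.
  have [s us xs] := pr_sum x; have [t ut yt] := pr_sum y.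
  apply: (dec_add prBd ppd).
    exists s => //; transitivity (\sum_(d <- s) (pr d x, (0 : N))).
      rewrite {1}xs; elim: (s) => [|d r IH]; first by rewrite !big_nil.
      by rewrite !big_cons -IH; congr pair; rewrite /= addr0.
    by apply: eq_bigr => d _; rewrite /dsum_pr /= pr0.
  exists t => //; transitivity (\sum_(d <- t) ((0 : M), pr d y)).
    rewrite {1}yt; elim: (t) => [|d r IH]; first by rewrite !big_nil.
    by rewrite !big_cons -IH; congr pair; rewrite /= addr0.
  by apply: eq_bigr => d _; rewrite /dsum_pr /= pr0.
- by move=> d j f x hf; congr pair; exact: pr_l.
- by move=> d j f x hf; congr pair; exact: pr_r.
Qed.

Definition dsum : grbimod := GrBimod dsum_axioms.
End DirectSum.

(* V^* = 'cV[k]_n and V = 'rV[k]_n, dual to each other under [pairing]; the   *)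
(* variable 'X_i of R = Sym(V^* ) is the i-th coordinate function on V.       *)
Definition pairing (v : 'rV[k]_n) (l : 'cV[k]_n) : k := (v *m l) 0 0.
Definition linform (l : 'cV[k]_n) : R := \sum_(i < n) l i 0 *: 'X_i.

Lemma linform_homog l : linform l \is 1.-homog.
Proof.
apply: rpred_sum => i _; apply: dhomogZ; rewrite dhomogX /=.
by rewrite mdeg1.
Qed.

(* pi_minus and pi_plus below are the kernel and the cokernel of the action   *)
(* zact of l (x) 1 - 1 (x) l, for l in V^*, with no shift: for the cokernel,  *)
(* x and y are identified when x - y is in the image of zact.                 *)

Section KerCoker.
Variables (l : 'cV[k]_n) (M : grbimod).

Definition zact (x : M) : M := linform l *: x - ract x (linform l).

Lemma zact_linear : linear zact.
Proof.
move=> a x y; rewrite /zact raDl -lra scalerDr scalerA mulrC -scalerA.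
by rewrite scalerBr opprD addrACA.
Qed.
HB.instance Definition _ := GRing.isLinear.Build R M M _ zact zact_linear.

Lemma zact_ract x a : zact (ract x a) = ract (zact x) a.
Proof. by rewrite /zact raB lra -!raM mulrC. Qed.

Lemma zact_pr d x : zact (pr d x) = pr (d + 2) (zact x).
Proof.
have -> : d + 2 = d + (2 * 1)%N%:Z by [].
by rewrite /zact prB (pr_l _ _ (linform_homog l)) (pr_r _ _ (linform_homog l)).
Qed.

Definition kerpred : {pred M} := fun x => zact x == 0.

Lemma kerpred_submod : submod_closed kerpred.
Proof.
split; first by rewrite unfold_in raddf0.
move=> a x y; rewrite !unfold_in zact_linear => /eqP -> /eqP ->.
by rewrite scaler0 addr0.
Qed.
HB.instance Definition _ := GRing.isSubmodClosed.Build R M kerpred kerpred_submod.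

Record kerT := KerT { kval : M; kvalP : kval \in kerpred }.
HB.instance Definition _ := [isSub for kval].
HB.instance Definition _ := [Choice of kerT by <:].
HB.instance Definition _ := [SubChoice_isSubLmodule of kerT by <:].

Lemma ker_raP (x : kerT) a : ract (val x) a \in kerpred.
Proof. by rewrite unfold_in zact_ract (eqP (kvalP x)) ra0l. Qed.
Lemma ker_prP d (x : kerT) : pr d (val x) \in kerpred.
Proof. by rewrite unfold_in zact_pr (eqP (kvalP x)) pr0. Qed.

Definition ker_ra (x : kerT) a : kerT := KerT (ker_raP x a).
Definition ker_pr d (x : kerT) : kerT := KerT (ker_prP d x).

Lemma ker_axioms : grbimod_axioms ker_ra ker_pr.
Proof.
split.
- by move=> x y a; apply: val_inj; rewrite /= raDl.
- by move=> x a b; apply: val_inj; rewrite /= raDr.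
- by move=> x; apply: val_inj; rewrite /= ra1.
- by move=> x a b; apply: val_inj; rewrite /= raM.
- by move=> x a b; apply: val_inj; rewrite /= lra.
- by move=> x a; apply: val_inj; rewrite /= raC.
- by move=> d x y; apply: val_inj; rewrite /= prB.
- by move=> d e x; apply: val_inj; rewrite /= pr_pr; case: ifP.
- move=> x; have [s us xs] := pr_sum (val x); exists s => //.
  by apply: val_inj; rewrite raddf_sum.
- by move=> d j f x hf; apply: val_inj; rewrite /= (pr_l _ _ hf).
- by move=> d j f x hf; apply: val_inj; rewrite /= (pr_r _ _ hf).
Qed.

Definition pi_minus : grbimod := GrBimod ker_axioms.

Definition impred : {pred M} := fun x => `[< exists y, x = zact y >].

Lemma impredP x : reflect (exists y, x = zact y) (x \in impred).
Proof. exact: asboolP. Qed.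

Lemma impred_zmod : zmod_closed impred.
Proof.
split; first by apply/impredP; exists 0; rewrite raddf0.
move=> x y /impredP[x' ->] /impredP[y' ->]; apply/impredP.
by exists (x' - y'); rewrite (raddfB zact).
Qed.
HB.instance Definition _ := GRing.isZmodClosed.Build M impred impred_zmod.

Definition cokT : Type := Quotient.quot impred.
HB.instance Definition _ := GRing.Zmodule.on cokT.
Definition cok_pi (x : M) : cokT := \pi_(Quotient.quot impred) x.

Lemma cok_piB : zmod_morphism cok_pi.
Proof. exact: (@pi_is_zmod_morphism _ _ _ (Quotient.quot impred)). Qed.
HB.instance Definition _ := GRing.isZmodMorphism.Build M cokT cok_pi cok_piB.

Lemma cok_piP (x y : M) : cok_pi x = cok_pi y <-> exists z, x - y = zact z.
Proof.
split=> [/eqP|]; first by rewrite -Quotient.idealrBE => /impredP.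
by move/impredP; rewrite Quotient.idealrBE => /eqP.
Qed.

Definition cok_repr (q : cokT) : M :=
  generic_quotient.repr (q : Quotient.quot impred).
Lemma cok_reprK q : cok_pi (cok_repr q) = q.
Proof. exact: reprK. Qed.

Lemma cok_ind (P : cokT -> Prop) : (forall x, P (cok_pi x)) -> forall q, P q.
Proof. by move=> H q; rewrite -[q]cok_reprK. Qed.

Definition cok_map (f : M -> M) (q : cokT) : cokT :=
  cok_pi (f (cok_repr q)).

Lemma cok_mapE (f : M -> M) x : zmod_morphism f ->
  (forall y, exists z, f (zact y) = zact z) ->
  cok_map f (cok_pi x) = cok_pi (f x).
Proof.
move=> fB fz; apply/cok_piP; rewrite -fB.
have /cok_piP[z ->] := cok_reprK (cok_pi x); exact: fz.
Qed.

Definition cok_scale (a : R) : cokT -> cokT := cok_map (fun x => a *: x).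
Definition cok_ra (q : cokT) (a : R) : cokT := cok_map (fun x => ract x a) q.
Definition cok_pr (d : int) : cokT -> cokT := cok_map (pr d).

Lemma cok_scaleE a x : cok_scale a (cok_pi x) = cok_pi (a *: x).
Proof.
apply: cok_mapE => [y z|y]; first exact: scalerBr.
by exists (a *: y); rewrite linearZ.
Qed.
Lemma cok_raE x a : cok_ra (cok_pi x) a = cok_pi (ract x a).
Proof.
apply: (cok_mapE (f := fun x => ract x a)) => [y z|y]; first exact: raB.
by exists (ract y a); rewrite zact_ract.
Qed.
Lemma cok_prE d x : cok_pr d (cok_pi x) = cok_pi (pr d x).
Proof.
apply: cok_mapE => [y z|y]; first exact: prB.
by exists (pr (d - 2) y); rewrite zact_pr subrK.
Qed.

Fact cok_scaleA a b q : cok_scale a (cok_scale b q) = cok_scale (a * b) q.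
Proof. by elim/cok_ind: q => x; rewrite !cok_scaleE scalerA. Qed.
Fact cok_scale1 : left_id 1 cok_scale.
Proof. by elim/cok_ind => x; rewrite cok_scaleE scale1r. Qed.
Fact cok_scaleDr : right_distributive cok_scale +%R.
Proof.
move=> a; elim/cok_ind => x; elim/cok_ind => y.
by rewrite -raddfD !cok_scaleE -raddfD scalerDr.
Qed.
Fact cok_scaleDl q : {morph cok_scale^~ q : a b / a + b}.
Proof. by elim/cok_ind: q => x a b; rewrite !cok_scaleE -raddfD scalerDl. Qed.
HB.instance Definition _ := GRing.Zmodule_isLmodule.Build R cokT
  cok_scaleA cok_scale1 cok_scaleDr cok_scaleDl.

Lemma cok_piZ a x : cok_pi (a *: x) = a *: cok_pi x.
Proof. by rewrite -cok_scaleE. Qed.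

Lemma cok_axioms : grbimod_axioms cok_ra cok_pr.
Proof.
split.
- move=> x y a; elim/cok_ind: x => x; elim/cok_ind: y => y.
  by rewrite -raddfD !cok_raE raDl raddfD.
- by move=> x a b; elim/cok_ind: x => x; rewrite !cok_raE raDr raddfD.
- by move=> x; elim/cok_ind: x => x; rewrite cok_raE ra1.
- by move=> x a b; elim/cok_ind: x => x; rewrite !cok_raE raM.
- move=> a x b; elim/cok_ind: x => x.
  by rewrite cok_raE -!cok_piZ cok_raE lra.
- by move=> x c; elim/cok_ind: x => x; rewrite cok_raE -cok_piZ raC.
- move=> d x y; elim/cok_ind: x => x; elim/cok_ind: y => y.
  by rewrite -raddfB !cok_prE prB raddfB.
- move=> d e x; elim/cok_ind: x => x; rewrite !cok_prE pr_pr.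
  by case: ifP => // _; rewrite raddf0.
- move=> x; elim/cok_ind: x => x; have [s us xs] := pr_sum x; exists s => //.
  rewrite {1}xs raddf_sum; apply: eq_bigr => d _; exact/esym/cok_prE.
- move=> d j f x hf; elim/cok_ind: x => x.
  by rewrite cok_prE -!cok_piZ cok_prE (pr_l _ _ hf).
- move=> d j f x hf; elim/cok_ind: x => x.
  by rewrite cok_raE !cok_prE cok_raE (pr_r _ _ hf).
Qed.

Definition pi_plus : grbimod := GrBimod cok_axioms.

End KerCoker.

Record grsubalg := GrSubalg {
  gs_pred :> {pred R};
  gsC : forall c : k, c%:MP \in gs_pred;
  gsB : forall f g : R, f \in gs_pred -> g \in gs_pred -> f - g \in gs_pred;
  gsM : forall f g : R, f \in gs_pred -> g \in gs_pred -> f * g \in gs_pred;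
  gs_homog : forall j (f : R), f \in gs_pred -> pihomog mdeg j f \in gs_pred
}.

Definition gs_full : grsubalg :=
  @GrSubalg predT (fun _ => isT) (fun _ _ _ _ => isT) (fun _ _ _ _ => isT)
    (fun _ _ _ => isT).

Section Tensor.
Variables (A : grsubalg) (M N : grbimod).

(* Subgroup of the free abelian group on M x N whose quotient is M (x)_A N.   *)
Inductive tensor_rel : {freeg (M * N)%type / int} -> Prop :=
| TRel0 : tensor_rel 0
| TRelB x y : tensor_rel x -> tensor_rel y -> tensor_rel (x - y)
| TRelDl (m m' : M) (p : N) :
    tensor_rel (<< (m + m', p) >> - << (m, p) >> - << (m', p) >>)
| TRelDr (m : M) (p p' : N) :
    tensor_rel (<< (m, p + p') >> - << (m, p) >> - << (m, p') >>)
| TRelA (m : M) (a : R) (p : N) : a \in A ->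
    tensor_rel (<< (ract m a, p) >> - << (m, a *: p) >>).

Definition tensor_pred : {pred {freeg (M * N)%type / int}} :=
  fun x => `[< tensor_rel x >].

Lemma tensor_predP x : reflect (tensor_rel x) (x \in tensor_pred).
Proof. exact: asboolP. Qed.

Lemma tensor_zmod : zmod_closed tensor_pred.
Proof.
split; first by apply/tensor_predP; exact: TRel0.
by move=> x y /tensor_predP hx /tensor_predP hy; apply/tensor_predP; exact: TRelB.
Qed.
HB.instance Definition _ :=
  GRing.isZmodClosed.Build {freeg (M * N)%type / int} tensor_pred tensor_zmod.

Definition tensT : Type := Quotient.quot tensor_pred.
HB.instance Definition _ := GRing.Zmodule.on tensT.
Definition tens_pi (x : {freeg (M * N)%type / int}) : tensT :=
  \pi_(Quotient.quot tensor_pred) x.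
Definition pure (m : M) (p : N) : tensT := tens_pi << (m, p) >>.

Lemma tens_piB : zmod_morphism tens_pi.
Proof. exact: (@pi_is_zmod_morphism _ _ _ (Quotient.quot tensor_pred)). Qed.
HB.instance Definition _ :=
  GRing.isZmodMorphism.Build {freeg (M * N)%type / int} tensT tens_pi tens_piB.

Lemma tens_piP x y : tens_pi x = tens_pi y <-> tensor_rel (x - y).
Proof.
split=> [/eqP|]; first by rewrite -Quotient.idealrBE => /tensor_predP.
by move/tensor_predP; rewrite Quotient.idealrBE => /eqP.
Qed.

Lemma pureDl m m' p : pure (m + m') p = pure m p + pure m' p.
Proof.
rewrite /pure -raddfD; apply/tens_piP; rewrite opprD addrA; exact: TRelDl.
Qed.
Lemma pureDr m p p' : pure m (p + p') = pure m p + pure m p'.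
Proof.
rewrite /pure -raddfD; apply/tens_piP; rewrite opprD addrA; exact: TRelDr.
Qed.
Lemma pureA m a p : a \in A -> pure (ract m a) p = pure m (a *: p).
Proof. by move=> aA; apply/tens_piP; exact: TRelA. Qed.

Definition tens_repr (x : tensT) : {freeg (M * N)%type / int} :=
  generic_quotient.repr (x : Quotient.quot tensor_pred).
Lemma tens_reprK x : tens_pi (tens_repr x) = x.
Proof. exact: reprK. Qed.

Lemma tens_ind (P : tensT -> Prop) :
  P 0 -> (forall x y, P x -> P y -> P (x - y)) -> (forall m p, P (pure m p)) ->
  forall x, P x.
Proof.
move=> P0 PB Pp x.
have PN y : P y -> P (- y) by move=> Py; rewrite -[- y]add0r; exact: PB.
have PD y z : P y -> P z -> P (y + z).
  by move=> Py Pz; rewrite -[z]opprK; apply: PB => //; exact: PN.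
have PMn y i : P y -> P (y *+ i).
  by move=> Py; elim: i => // i IH; rewrite mulrS; exact: PD.
rewrite -[x]tens_reprK -(freeg_sumE (tens_repr x)) raddf_sum.
apply: (big_ind P P0 PD) => -[m p] _.
have -> (c : int) : << c *g (m, p) >> = << (m, p) >> *~ c
    :> {freeg (M * N)%type / int} by rewrite freegU_mulz intz.
rewrite raddfMz; case: (coeff _ _) => i; first exact: (PMn _ i (Pp m p)).
by rewrite NegzE mulrNz; apply: PN; exact: (PMn _ i.+1 (Pp m p)).
Qed.

Section Lift.
Variables (G : zmodType) (b : M -> N -> G).
Hypothesis bDl : forall m m' p, b (m + m') p = b m p + b m' p.
Hypothesis bDr : forall m p p', b m (p + p') = b m p + b m p'.
Hypothesis bA : forall m a p, a \in A -> b (ract m a) p = b m (a *: p).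

Definition tens_lift0 (x : {freeg (M * N)%type / int}) : G :=
  fglift (fun z : M * N => (b z.1 z.2 : zmodule G)) x.

Lemma tens_lift0B : zmod_morphism tens_lift0.
Proof. by move=> x y; exact: (lift_is_additive (fun z : M * N => (b z.1 z.2 : zmodule G))). Qed.

Lemma tens_lift0U m p : tens_lift0 << (m, p) >> = b m p.
Proof. by rewrite /tens_lift0 liftU. Qed.

Lemma tens_lift0_rel x : tensor_rel x -> tens_lift0 x = 0.
Proof.
elim=> {x} [|x y _ hx _ hy|m m' p|m p p'|m a p aA].
- by have := tens_lift0B 0 0; rewrite !subrr.
- by rewrite tens_lift0B hx hy subrr.
- by rewrite !tens_lift0B !tens_lift0U bDl addrAC addrK subrr.
- by rewrite !tens_lift0B !tens_lift0U bDr addrAC addrK subrr.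
- by rewrite !tens_lift0B !tens_lift0U bA // subrr.
Qed.
End Lift.

Definition tens_lift (G : zmodType) (b : M -> N -> G) (x : tensT) : G :=
  tens_lift0 b (tens_repr x).

Section LiftTheory.
Variables (G : zmodType) (b : M -> N -> G).
Hypothesis bDl : forall m m' p, b (m + m') p = b m p + b m' p.
Hypothesis bDr : forall m p p', b m (p + p') = b m p + b m p'.
Hypothesis bA : forall m a p, a \in A -> b (ract m a) p = b m (a *: p).

Lemma tens_liftE x : tens_lift b (tens_pi x) = tens_lift0 b x.
Proof.
apply/eqP; rewrite -subr_eq0 -tens_lift0B; apply/eqP.
by apply: tens_lift0_rel => //; apply/tens_piP; exact: tens_reprK.
Qed.

Lemma tens_lift_pure m p : tens_lift b (pure m p) = b m p.
Proof. by rewrite tens_liftE tens_lift0U. Qed.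

Lemma tens_liftB : zmod_morphism (tens_lift b).
Proof.
move=> x y.
rewrite -[x]tens_reprK -[y]tens_reprK.
by rewrite -raddfB !tens_liftE tens_lift0B.
Qed.
End LiftTheory.

Lemma tens_ext (G : zmodType) (f g : tensT -> G) :
  zmod_morphism f -> zmod_morphism g ->
  (forall m p, f (pure m p) = g (pure m p)) -> f =1 g.
Proof.
move=> fB gB fg; elim/tens_ind => [|x y fx fy|] //.
- by have := fB 0 0; have := gB 0 0; rewrite !subrr => -> ->.
- by rewrite fB gB fx fy.
Qed.

Lemma pure0l p : pure 0 p = 0.
Proof. by apply: (addrI (pure 0 p)); rewrite -pureDl !addr0. Qed.
Lemma pure0r m : pure m 0 = 0.
Proof. by apply: (addrI (pure m 0)); rewrite -pureDr !addr0. Qed.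
Lemma pure_suml (I : Type) (r : seq I) (F : I -> M) p :
  pure (\sum_(i <- r) F i) p = \sum_(i <- r) pure (F i) p.
Proof.
apply: (big_morph (fun m => pure m p)); [by move=> *; exact: pureDl|exact: pure0l].
Qed.
Lemma pure_sumr (I : Type) (r : seq I) (F : I -> N) m :
  pure m (\sum_(i <- r) F i) = \sum_(i <- r) pure m (F i).
Proof.
apply: (big_morph (pure m)); [by move=> *; exact: pureDr|exact: pure0r].
Qed.

Definition tens_scale (r : R) : tensT -> tensT :=
  tens_lift (fun m p => pure (r *: m) p).
Definition tens_ra (x : tensT) (r : R) : tensT :=
  tens_lift (fun m p => pure m (ract p r)) x.

Section ScaleBil.
Variable r : R.
Let bDl m m' p : pure (r *: (m + m')) p = pure (r *: m) p + pure (r *: m') p.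
Proof. by rewrite scalerDr pureDl. Qed.
Let bDr m p p' : pure (r *: m) (p + p') = pure (r *: m) p + pure (r *: m) p'.
Proof. exact: pureDr. Qed.
Let bA m a p : a \in A -> pure (r *: ract m a) p = pure (r *: m) (a *: p).
Proof. by move=> aA; rewrite lra pureA. Qed.
Lemma tens_scale_pure m p : tens_scale r (pure m p) = pure (r *: m) p.
Proof. exact: (tens_lift_pure bDl bDr bA). Qed.
Lemma tens_scaleB x y : tens_scale r (x - y) = tens_scale r x - tens_scale r y.
Proof. exact: (tens_liftB bDl bDr bA). Qed.
Lemma tens_scale0 : tens_scale r 0 = 0.
Proof. by have := tens_scaleB 0 0; rewrite !subrr. Qed.
HB.instance Definition _ :=
  GRing.isZmodMorphism.Build tensT tensT (tens_scale r) tens_scaleB.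
End ScaleBil.

Section RactBil.
Variable r : R.
Let bDl m m' p :
  pure (m + m') (ract p r) = pure m (ract p r) + pure m' (ract p r).
Proof. exact: pureDl. Qed.
Let bDr m p p' :
  pure m (ract (p + p') r) = pure m (ract p r) + pure m (ract p' r).
Proof. by rewrite raDl pureDr. Qed.
Let bA m a p : a \in A -> pure (ract m a) (ract p r) = pure m (ract (a *: p) r).
Proof. by move=> aA; rewrite pureA // lra. Qed.
Lemma tens_ra_pure m p : tens_ra (pure m p) r = pure m (ract p r).
Proof. exact: (tens_lift_pure bDl bDr bA). Qed.
Lemma tens_raB x y : tens_ra (x - y) r = tens_ra x r - tens_ra y r.
Proof. exact: (tens_liftB bDl bDr bA). Qed.
Lemma tens_ra0 : tens_ra 0 r = 0.
Proof. by have := tens_raB 0 0; rewrite !subrr. Qed.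
End RactBil.

Lemma tens_raD r x y : tens_ra (x + y) r = tens_ra x r + tens_ra y r.
Proof.
by rewrite -{1}[y]opprK tens_raB -[- y]sub0r tens_raB tens_ra0 sub0r opprK.
Qed.

Fact tens_scaleA a b x : tens_scale a (tens_scale b x) = tens_scale (a * b) x.
Proof.
elim/tens_ind: x => [|x y hx hy|m p]; first by rewrite !tens_scale0.
  by rewrite !tens_scaleB hx hy.
by rewrite !tens_scale_pure scalerA.
Qed.
Fact tens_scale1 : left_id 1 tens_scale.
Proof.
elim/tens_ind => [|x y hx hy|m p]; first by rewrite tens_scale0.
  by rewrite tens_scaleB hx hy.
by rewrite tens_scale_pure scale1r.
Qed.
Fact tens_scaleDr : right_distributive tens_scale +%R.
Proof. by move=> a x y; exact: (raddfD (tens_scale a)). Qed.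
Fact tens_scaleDl x : {morph tens_scale^~ x : a b / a + b}.
Proof.
move=> a b; elim/tens_ind: x => [|x y hx hy|m p]; first by rewrite !tens_scale0 addr0.
  by rewrite !tens_scaleB hx hy opprD addrACA.
by rewrite !tens_scale_pure scalerDl pureDl.
Qed.
HB.instance Definition _ := GRing.Zmodule_isLmodule.Build R tensT
  tens_scaleA tens_scale1 tens_scaleDr tens_scaleDl.

Lemma tens_scaleE r x : r *: x = tens_scale r x.
Proof. by []. Qed.

(* (m (x) p)_d = \sum_i m_i (x) p_(d - i) *)
Definition supp (m : M) : seq int := s2val (cid2 (pr_sum m)).

Lemma supp_uniq m : uniq (supp m).
Proof. exact: s2valP (cid2 (pr_sum m)). Qed.
Lemma supp_sum m : m = \sum_(i <- supp m) pr i m.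
Proof. exact: s2valP' (cid2 (pr_sum m)). Qed.

Definition pr_bil (d : int) (m : M) (p : N) : tensT :=
  \sum_(i <- supp m) pure (pr i m) (pr (d - i) p).
Definition tens_pr (d : int) : tensT -> tensT := tens_lift (pr_bil d).

Lemma pr_bilE d m p (s : seq int) : uniq s -> {subset supp m <= s} ->
  pr_bil d m p = \sum_(i <- s) pure (pr i m) (pr (d - i) p).
Proof.
move=> us ss; apply: sum_sup => //; first exact: supp_uniq.
move=> e es; rewrite (dec_out (@pr_zmod M) (@pr_pr M) (supp_uniq m) (supp_sum m) es).
exact: pure0l.
Qed.

Lemma pr_bilDl d m m' p : pr_bil d (m + m') p = pr_bil d m p + pr_bil d m' p.
Proof.
pose s := undup (supp (m + m') ++ supp m ++ supp m').
have us : uniq s by exact: undup_uniq.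
rewrite !(pr_bilE _ _ us); last first.
- by move=> i h; rewrite mem_undup !mem_cat h.
- by move=> i h; rewrite mem_undup !mem_cat h orbT.
- by move=> i h; rewrite mem_undup !mem_cat h !orbT.
by rewrite -big_split; apply: eq_bigr => i _; rewrite prD pureDl.
Qed.

Lemma pr_bilDr d m p p' : pr_bil d m (p + p') = pr_bil d m p + pr_bil d m p'.
Proof. by rewrite -big_split; apply: eq_bigr => i _; rewrite prD pureDr. Qed.

Lemma pr_bil0l d p : pr_bil d 0 p = 0.
Proof. by apply: (addrI (pr_bil d 0 p)); rewrite -pr_bilDl !addr0. Qed.
Lemma pr_bil0r d m : pr_bil d m 0 = 0.
Proof. by apply: (addrI (pr_bil d m 0)); rewrite -pr_bilDr !addr0. Qed.
Lemma pr_bil_suml (I : Type) (r : seq I) (F : I -> M) d p :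
  pr_bil d (\sum_(i <- r) F i) p = \sum_(i <- r) pr_bil d (F i) p.
Proof.
apply: (big_morph (fun m => pr_bil d m p)); [|exact: pr_bil0l].
by move=> *; exact: pr_bilDl.
Qed.
Lemma pr_bil_sumr (I : Type) (r : seq I) (F : I -> N) d m :
  pr_bil d m (\sum_(i <- r) F i) = \sum_(i <- r) pr_bil d m (F i).
Proof.
apply: (big_morph (pr_bil d m)); [|exact: pr_bil0r].
by move=> *; exact: pr_bilDr.
Qed.

Lemma pr_bil_hom d i j m p : pr i m = m -> pr j p = p ->
  pr_bil d m p = if d == i + j then pure m p else 0.
Proof.
move=> hm hp; pose s := undup (i :: supp m).
have us : uniq s by exact: undup_uniq.
rewrite (pr_bilE _ _ us); last by move=> e he; rewrite mem_undup inE he orbT.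
rewrite (bigD1_seq i) //=; last by rewrite mem_undup inE eqxx.
rewrite big1 ?addr0; last first.
  by move=> e ne; rewrite -hm pr_pr (negPf ne) pure0l.
rewrite hm -hp pr_pr subr_eq [j + i]addrC; case: eqP => // _.
exact: pure0r.
Qed.

Lemma pr_hom (L : grbimod) d (x : L) : pr d (pr d x) = pr d x.
Proof. by rewrite pr_pr eqxx. Qed.

Lemma ra_hom (L : grbimod) d j (f : R) (x : L) : f \is j.-homog -> pr d x = x ->
  pr (d + (2 * j)%:Z) (ract x f) = ract x f.
Proof. by move=> hf hx; rewrite (pr_r _ _ hf) hx. Qed.

Lemma l_hom (L : grbimod) d j (f : R) (x : L) : f \is j.-homog -> pr d x = x ->
  pr (d + (2 * j)%:Z) (f *: x) = f *: x.
Proof. by move=> hf hx; rewrite (pr_l _ _ hf) hx. Qed.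

Lemma pr_bilA d m a p : a \in A -> pr_bil d (ract m a) p = pr_bil d m (a *: p).
Proof.
move=> aA; rewrite [m]supp_sum ra_suml !pr_bil_suml; apply: eq_bigr => i _.
have [s us ->] := pr_sum p.
rewrite scaler_sumr !pr_bil_sumr; apply: eq_bigr => e _.
have E := pihomog_partitionE (leqnn (@mmeasure _ _ mdeg a)).
rewrite E ra_sumr scaler_suml pr_bil_suml pr_bil_sumr; apply: eq_bigr => j _.
set b := pihomog mdeg j a; have hb : b \is j.-homog by exact: pihomogP.
have bA : b \in A by exact: gs_homog.
rewrite (pr_bil_hom _ (ra_hom hb (pr_hom i m)) (pr_hom e p)).
rewrite (pr_bil_hom _ (pr_hom i m) (l_hom hb (pr_hom e p))).
by rewrite pureA // -[i + _ + e]addrA [(2 * j)%:Z + e]addrC addrA.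
Qed.

Lemma tens_pr_pure d m p : tens_pr d (pure m p) = pr_bil d m p.
Proof. exact: (tens_lift_pure (pr_bilDl d) (pr_bilDr d) (pr_bilA d)). Qed.
Lemma tens_prB d x y : tens_pr d (x - y) = tens_pr d x - tens_pr d y.
Proof. exact: (tens_liftB (pr_bilDl d) (pr_bilDr d) (pr_bilA d)). Qed.
Lemma tens_pr0 d : tens_pr d 0 = 0.
Proof. by have := tens_prB d 0 0; rewrite !subrr. Qed.

Lemma tens_hom_ind (P : tensT -> Prop) :
  P 0 -> (forall x y, P x -> P y -> P (x - y)) ->
  (forall i j m p, pr i m = m -> pr j p = p -> P (pure m p)) ->
  forall x, P x.
Proof.
move=> P0 PB Pp; elim/tens_ind => // m p.
have PD y z : P y -> P z -> P (y + z).
  by move=> Py Pz; rewrite -[z]opprK -[- z]add0r; apply: (PB) => //; apply: PB.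
have [s _ ->] := pr_sum m; have [t _ ->] := pr_sum p.
rewrite pure_suml; apply: (big_ind P P0 PD) => i _.
rewrite pure_sumr; apply: (big_ind P P0 PD) => j _.
exact: Pp (pr_hom i m) (pr_hom j p).
Qed.

Lemma tens_pr_hom d i j m p : pr i m = m -> pr j p = p ->
  tens_pr d (pure m p) = if d == i + j then pure m p else 0.
Proof. by move=> hm hp; rewrite tens_pr_pure (pr_bil_hom d hm hp). Qed.

Lemma tens_pr_pr d e x :
  tens_pr d (tens_pr e x) = if d == e then tens_pr e x else 0.
Proof.
elim/tens_hom_ind: x => [|x y hx hy|i j m p hm hp].
- by rewrite !tens_pr0 if_same.
- by rewrite !tens_prB hx hy; case: ifP => // _; rewrite subr0.
rewrite !(tens_pr_hom _ hm hp); case: (e =P i + j) => [->|ne].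
  by rewrite (tens_pr_hom _ hm hp).
by rewrite tens_pr0 if_same.
Qed.

Lemma tens_axioms : grbimod_axioms tens_ra tens_pr.
Proof.
split.
- by move=> x y a; exact: tens_raD.
- move=> x a b; elim/tens_ind: x => [|x y hx hy|m p].
  + by rewrite !tens_ra0 addr0.
  + by rewrite !tens_raB hx hy opprD addrACA.
  + by rewrite !tens_ra_pure raDr pureDr.
- elim/tens_ind => [|x y hx hy|m p]; first by rewrite tens_ra0.
    by rewrite tens_raB hx hy.
  by rewrite tens_ra_pure ra1.
- move=> x a b; elim/tens_ind: x => [|x y hx hy|m p].
  + by rewrite !tens_ra0.
  + by rewrite !tens_raB hx hy.
  + by rewrite !tens_ra_pure raM.
- move=> a x b; rewrite !tens_scaleE; elim/tens_ind: x => [|x y hx hy|m p].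
  + by rewrite tens_ra0 tens_scale0 tens_ra0.
  + by rewrite tens_raB !tens_scaleB tens_raB hx hy.
  + by rewrite tens_ra_pure !tens_scale_pure tens_ra_pure.
- move=> x c; rewrite tens_scaleE; elim/tens_ind: x => [|x y hx hy|m p].
  + by rewrite tens_ra0 tens_scale0.
  + by rewrite tens_raB tens_scaleB hx hy.
  + by rewrite tens_ra_pure tens_scale_pure raC -pureA ?gsC // raC.
- by move=> d x y; exact: tens_prB.
- exact: tens_pr_pr.
- move=> x; rewrite -/(decomposes tens_pr x).
  elim/tens_hom_ind: x => [|x y hx hy|i j m p hm hp].
  + exact: dec0.
  + exact: (dec_sub tens_prB tens_pr_pr).
  + by apply: (@dec_hom _ _ (i + j)); rewrite (tens_pr_hom _ hm hp) eqxx.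
- move=> d j f x hf; rewrite !tens_scaleE.
  elim/tens_hom_ind: x => [|x y hx hy|i e m p hm hp].
  + by rewrite !(tens_scale0, tens_pr0).
  + by rewrite !(tens_scaleB, tens_prB) hx hy.
  + rewrite tens_scale_pure (tens_pr_hom _ hm hp).
    rewrite (tens_pr_hom _ (l_hom hf hm) hp) [i + _ + e]addrAC (inj_eq (addIr _)).
    by case: ifP => _; rewrite ?tens_scale_pure ?tens_scale0.
- move=> d j f x hf; elim/tens_hom_ind: x => [|x y hx hy|i e m p hm hp].
  + by rewrite tens_ra0 !tens_pr0 tens_ra0.
  + by rewrite tens_raB !tens_prB tens_raB hx hy.
  + rewrite tens_ra_pure (tens_pr_hom _ hm hp).
    rewrite (tens_pr_hom _ hm (ra_hom hf hp)) addrA (inj_eq (addIr _)).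
    by case: ifP => _; rewrite ?tens_ra_pure ?tens_ra0.
Qed.

Definition tensor : grbimod := GrBimod tens_axioms.

End Tensor.

End GradedBimodules.

(* The two generators are indexed by bool.                                    *)
Definition gen_s : bool := true.
Definition gen_t : bool := false.

(* I_2(m) = < s, t | s^2 = t^2 = (st)^m = e >; the last two fields say that   *)
(* (dih_gen gen_s, dih_gen gen_t) is a generating pair satisfying the         *)
(* relations of the presentation.                                             *)
Record dihedral (m : nat) := MkDihedral {
  dih_gT :> finGroupType;
  dih_gen : bool -> dih_gT;
  dih_pres : ([set: dih_gT] \isog Grp (x : y : x ^+ 2, y ^+ 2, (x * y) ^+ m))%g;
  dih_rel : [/\ (dih_gen gen_s ^+ 2 = 1)%g, (dih_gen gen_t ^+ 2 = 1)%g
              & ((dih_gen gen_s * dih_gen gen_t) ^+ m = 1)%g];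
  dih_span : <<[set dih_gen gen_s; dih_gen gen_t]>>%g = [set: dih_gT]%g
}.

Section Length.
Variables (m : nat) (W : dihedral m).

Definition word (e : seq bool) : W := (\prod_(u <- e) dih_gen W u)%g.

Lemma word_cat e f : word (e ++ f) = (word e * word f)%g.
Proof. exact: big_cat. Qed.

Lemma exists_word (w : W) : exists l, [exists e : l.-tuple bool, word e == w].
Proof.
suff [e <-] : exists e, word e = w.
  by exists (size e); apply/existsP; exists (in_tuple e).
have : w \in <<[set dih_gen W gen_s; dih_gen W gen_t]>>%g by rewrite dih_span inE.
case/gen_prodgP => l [c hc ->]; elim: l c hc => [|l IH] c hc.
  by exists [::]; rewrite /word big_nil big_ord0.
have [e he] := IH (fun i => c (fintype.lift ord0 i)) (fun i => hc _).
have [u hu] : exists u, dih_gen W u = c ord0.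
  by have := hc ord0; rewrite !inE => /orP[/eqP ->|/eqP ->]; eexists.
by exists (u :: e); rewrite /word big_cons big_ord_recl hu -he.
Qed.

Definition ell (w : W) : nat := ex_minn (exists_word w).

Definition reduced_expr (e : seq bool) (w : W) : Prop :=
  word e = w /\ size e = ell w.

End Length.

Section Realizations.
Variables (k : comUnitRingType) (n : nat).
Local Notation R := {mpoly k[n]}.

(* [j]_q = q^(j-1) + q^(j-3) + ... + q^(1-j) *)
Definition qnum (q : k) (j : nat) : k :=
  \sum_(i < j) q ^ (j%:Z - 1 - (2 * i)%:Z).

Definition refl (a : 'cV[k]_n) (av v : 'rV[k]_n) : 'rV[k]_n :=
  v - pairing v a *: av.

(* Symmetric realizations of I_2(m) on V = k^n. *)
Record realization (m : nat) := Realization {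
  alpha : bool -> 'cV[k]_n;
  alphav : bool -> 'rV[k]_n;
  rq : k;
  rz_diag : forall u, pairing (alphav u) (alpha u) = 2;
  rz_sym : pairing (alphav gen_s) (alpha gen_t)
         = pairing (alphav gen_t) (alpha gen_s);
  rz_invol : forall u v, refl (alpha u) (alphav u) (refl (alpha u) (alphav u) v) = v;
  rz_braid : forall v,
    iter m (refl (alpha gen_s) (alphav gen_s) \o refl (alpha gen_t) (alphav gen_t)) v
    = v;
  rz_unit : rq \is a GRing.unit;
  rz_st : pairing (alphav gen_s) (alpha gen_t) = - (rq + rq^-1);
  rz_qm : qnum rq m = 0
}.

(* The contragredient action of a reflection on V^*, extended to R.           *)
Definition dual_refl (a : 'cV[k]_n) (av : 'rV[k]_n) (l : 'cV[k]_n) : 'cV[k]_n :=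
  l - pairing av l *: a.

Definition sym_refl (a : 'cV[k]_n) (av : 'rV[k]_n) (f : R) : R :=
  f \mPo [tuple linform (dual_refl a av (delta_mx i 0)) | i < n].

Lemma linform_subst_homog (lq : n.-tuple R) j (f : R) :
  (forall i, tnth lq i \is 1.-homog) -> f \is j.-homog -> f \mPo lq \is j.-homog.
Proof.
move=> hlq hf; rewrite comp_mpolyEX big_seq; apply: rpred_sum => m hm.
apply: dhomogZ; rewrite comp_mpolyX -(dhomog_mf hf hm) /= mdegE.
apply: (big_ind2 (fun (g : R) d => g \is d.-homog)).
- exact: dhomog1.
- by move=> *; exact: dhomogM.
- by move=> i _; rewrite -[X in X.-homog]mul1n; exact: dhomogMn.
Qed.

Lemma sym_refl_homog a av j (f : R) :
  f \is j.-homog -> sym_refl a av f \is j.-homog.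
Proof.
by apply: linform_subst_homog => i; rewrite tnth_mktuple; exact: linform_homog.
Qed.

Lemma sym_refl_pihomog a av j (f : R) :
  sym_refl a av (pihomog mdeg j f) = pihomog mdeg j (sym_refl a av f).
Proof.
have {2}-> : f = \sum_(d < @mmeasure _ _ mdeg f) pihomog mdeg d f.
  exact: pihomog_partitionE.
have -> : sym_refl a av (\sum_(d < @mmeasure _ _ mdeg f) pihomog mdeg d f)
    = \sum_(d < @mmeasure _ _ mdeg f) sym_refl a av (pihomog mdeg d f).
  exact: (raddf_sum (comp_mpoly _)).
rewrite [RHS]raddf_sum /=.
have E (d : nat) : pihomog mdeg j (sym_refl a av (pihomog mdeg d f))
    = if d == j then sym_refl a av (pihomog mdeg d f) else 0.
  have h := sym_refl_homog a av (pihomogP mdeg d f).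
  by case: eqP => [<-|/eqP ne]; [exact: pihomog_dE|exact: pihomog_ne0 ne h].
under eq_bigr do rewrite E.
have [lt|ge] := ltnP j (@mmeasure _ _ mdeg f).
  rewrite (bigD1 (Ordinal lt)) //= eqxx big1 ?addr0 // => d nd.
  by case: eqP => // dj; case/eqP: nd; exact: val_inj.
rewrite big1; last first.
  by move=> d _; case: eqP => // dj; move: (ltn_ord d); rewrite dj ltnNge ge.
suff -> : pihomog mdeg j f = 0 by exact: comp_mpoly0.
rewrite (pihomog_partitionE (leqnn (@mmeasure _ _ mdeg f))) raddf_sum big1 //=.
move=> d _; apply: (@pihomog_ne0 _ _ _ d); last exact: pihomogP.
by apply/negP => /eqP dj; move: (ltn_ord d); rewrite dj ltnNge ge.
Qed.

(* R^u, for u acting through the reflection with root a and coroot av.        *)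
Section Invariants.
Variables (a : 'cV[k]_n) (av : 'rV[k]_n).
Definition inv_pred : {pred R} := fun f => sym_refl a av f == f.

Lemma inv_predE f : (f \in inv_pred) = (sym_refl a av f == f).
Proof. by []. Qed.
Lemma inv_C c : c%:MP \in inv_pred.
Proof. by rewrite inv_predE /sym_refl comp_mpolyC. Qed.
Lemma inv_B f g : f \in inv_pred -> g \in inv_pred -> f - g \in inv_pred.
Proof.
by rewrite !inv_predE /sym_refl => /eqP hf /eqP hg; rewrite comp_mpolyB hf hg.
Qed.
Lemma inv_M f g : f \in inv_pred -> g \in inv_pred -> f * g \in inv_pred.
Proof.
by rewrite !inv_predE /sym_refl => /eqP hf /eqP hg; rewrite rmorphM /= hf hg.
Qed.
Lemma inv_homog j f : f \in inv_pred -> pihomog mdeg j f \in inv_pred.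
Proof. by rewrite !inv_predE sym_refl_pihomog => /eqP ->. Qed.

Definition gs_inv : grsubalg k n := GrSubalg inv_C inv_B inv_M inv_homog.
End Invariants.

Section Soergel.
Variables (m : nat) (h : realization m).
Local Notation RR := (Rbim k n).

(* B_u = R (x)_(R^u) R (1) *)
Definition Bgen (u : bool) : grbimod k n :=
  shift (tensor (gs_inv (alpha h u) (alphav h u)) RR RR) 1.

Definition tensorR (M N : grbimod k n) : grbimod k n := tensor (gs_full k n) M N.

Definition BS (e : seq bool) : grbimod k n := foldr tensorR RR [seq Bgen u | u <- e].

Definition bimod_zero (M : grbimod k n) : Prop := forall x : M, x = 0.

Definition is_summand (M N : grbimod k n) : Prop :=
  exists M' : grbimod k n, bimod_iso N (dsum M M').

Definition indecomposable (M : grbimod k n) : Prop :=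
  ~ bimod_zero M /\
  forall M1 M2 : grbimod k n,
    bimod_iso M (dsum M1 M2) -> bimod_zero M1 \/ bimod_zero M2.

Inductive SBim : grbimod k n -> Prop :=
| SBim_one : SBim RR
| SBim_gen u : SBim (Bgen u)
| SBim_tensor M N : SBim M -> SBim N -> SBim (tensorR M N)
| SBim_dsum M N : SBim M -> SBim N -> SBim (dsum M N)
| SBim_shift M a : SBim M -> SBim (shift M a)
| SBim_summand M N : SBim N -> is_summand M N -> SBim M.

(* M is, up to a shift, a direct summand of BS f for an expression f of       *)
(* length smaller than l.                                                     *)
Definition occurs_below (l : nat) (M : grbimod k n) : Prop :=
  exists f a, (size f < l)%N /\ is_summand (shift M a) (BS f).

(* B is "the" bimodule B_w: for some reduced expression e of w, BS e is a     *)
(* direct sum of indecomposable bimodules of which B is the only one that     *)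
(* does not occur up to shift for shorter expressions.                        *)
Definition is_Bw (W : dihedral m) (w : W) (B : grbimod k n) : Prop :=
  [/\ SBim B, indecomposable B, ~ occurs_below (ell w) B &
  exists e (Ns : seq (grbimod k n)),
    [/\ reduced_expr e w,
        bimod_iso (BS e) (foldr (@dsum k n) B Ns)
      & List.Forall (fun N => indecomposable N /\ occurs_below (ell w) N) Ns]].

End Soergel.

End Realizations.

(* Main.v *)
From HB Require Import structures.
From mathcomp Require Import all_boot all_order all_algebra all_fingroup.
From mathcomp Require Import ring_quotient cyclic extremal.
From mathcomp Require Import boolp.
From mathcomp Require Import ssrcomplements freeg mpoly.
From mathcomp Require Import ring zify.
Require Import Defs.

(** Write x_u for the action of rho_u on the right.  Modulo the linear forms
    invariant under W, R (x) R becomes T = R[x_s, x_t]; put Y_u = x_u - rho_u.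
    There is a W-invariant quadratic form, and the difference of its two copies
    is a conic q in T.  The W-orbit of (rho_s, rho_t) consists of points of this
    conic, and for w of length l >= 1 the 2l points x <= w are cut out on it by
    l lines: if w ends in v and p is the other generator, then {x <= w} is a
    union of cosets of <v>, and the coset of y lies on the line x_p = y(rho_p).
    With F_w the product of these l lines, the model of B_w is the cyclic
    bimodule T / (q, F_w), shifted by l.

    - This model is a direct summand of the Bott-Samelson bimodule of the
      reduced word.  The inclusion sends 1 to 1 (x) ... (x) 1.  The retraction
      is built one letter u at a time, as r (x) f |-> r d_u(g f) with d_u the
      Demazure operator on the left variables and g the equation of the line by
      which F_uw differs from F_w, divided by d_u of it; that value is the
      quantum number [l(w)], a unit because l(w) < m (BS_retract).

    - An endomorphism of degree 0 of the model is a scalar.  One that factors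
      through the bimodule of a shorter expression is killed by a product of
      elements 1 (x) f - x(f) (x) 1 over subwords x of that expression;
      evaluating at the point w shows that the scalar is 0 (through_lower).
      Therefore the model is a summand of B_w itself and, by indecomposability,
      isomorphic to it (Bw_iso).  Comparing scalars replaces the uniqueness of
      decompositions, which may fail over a ring k with idempotents.

    - The operator rho_s (x) 1 - 1 (x) rho_s acts on the model as -Y_s, and
      Y_s = 0 is the line through the points e and t, which are both <= w as
      soon as w contains t.  Hence F_w = Y_s G modulo q, with both factors
      regular modulo q, so that the cokernel of Y_s is T / (q, Y_s) and its
      kernel is the copy of T / (q, Y_s) generated by G, of degree 2 (l - 1)
      (pi_quotient).  Finally T / (q, Y_s) is the model of B_t.  For B_s the
      same computation is made modulo Y_t, where q = Y_s (Y_s + alpha_s).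

    Regularity of elements over the possibly non-reduced ring k always comes from
    McCoy's theorem: a polynomial is a zero divisor only if a nonzero scalar
    annihilates it. *)
Set Implicit Arguments.
Unset Strict Implicit.
Unset Printing Implicit Defensive.

Import GRing.Theory.
Local Open Scope ring_scope.

(** * Zero divisors and induction in polynomial rings *)
Section Polynomials.
Variable k : comUnitRingType.

(** McCoy's theorem.  Take g with f * g = 0 and as few terms as possible: then
    every coefficient of f annihilates g, since a coefficient that does not
    would produce a shorter nonzero g.  So each coefficient of g kills f. *)
Lemma mpoly_mccoy n (f : {mpoly k[n]}) :
  (forall c : k, c *: f = 0 -> c = 0) -> forall g, f * g = 0 -> g = 0.
Proof.
move=> reg g; have [N le] := ubnP (size (msupp g)).
elim: N g le => // N IH g; rewrite ltnS => le fg0.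
have [//|g0] := eqVneq g 0.
have claim (f' : {mpoly k[n]}) : f' * g = 0 -> forall m, f'@_m *: g = 0.
  elim/mleadrect: f' => f' IH' f'g m.
  have [->|f'0] := eqVneq f' 0; first by rewrite mcoeff0 scale0r.
  (* The leading term of g disappears, so this multiple of g is shorter. *)
  have a0 : f'@_(mlead f') *: g = 0.
    apply: IH; last by rewrite -scalerAr fg0 scaler0.
    apply: leq_trans le.
    have l0 : mlead g \notin msupp (f'@_(mlead f') *: g).
      by rewrite -mcoeff_eq0 mcoeffZ -mleadcM f'g mcoeff0.
    apply: (@uniq_leq_size _ (mlead g :: _)) => [|x].
      by rewrite /= l0 msupp_uniq.
    by rewrite inE => /predU1P[->|/msuppZ_le //]; exact: mlead_supp.
  pose f2 := f' - f'@_(mlead f') *: 'X_[mlead f'].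
  have f2g : f2 * g = 0.
    by rewrite mulrBl f'g -scalerAl scalerAr a0 mulr0 subr0.
  have f'E : f' = f2 + f'@_(mlead f') *: 'X_[mlead f'] by rewrite subrK.
  have [z|nz] := eqVneq f2 0.
    rewrite f'E z add0r mcoeffZ mcoeffX; case: eqP => _.
      by rewrite mulr1.
    by rewrite mulr0 scale0r.
  rewrite f'E mcoeffD scalerDl (IH' f2) ?add0r //; last first.
    exact: ltm_mleadD.
  rewrite mcoeffZ mcoeffX; case: eqP => _; first by rewrite mulr1.
  by rewrite mulr0 scale0r.
apply/eqP; rewrite -mleadc_eq0; apply/eqP/reg.
apply/mpolyP => m; rewrite mcoeffZ mcoeff0 mulrC -mcoeffZ.
by rewrite claim // mcoeff0.
Qed.

Lemma mpoly_alg_ind n (P : {mpoly k[n]} -> Prop) :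
  (forall c, P c%:MP) -> (forall i, P 'X_i) ->
  (forall f g, P f -> P g -> P (f + g)) ->
  (forall f g, P f -> P g -> P (f * g)) -> forall f, P f.
Proof.
move=> PC PX PD PM f; elim/mpolyind: f => [|c m f _ _ Pf].
  by rewrite -mpolyC0; exact: PC.
apply: (PD) => //; rewrite -mul_mpolyC; apply: (PM) => //.
rewrite mpolyXE_id; apply: (big_ind P) => //.
  by rewrite -mpolyC1.
move=> i _; elim: (m i) => [|j IH]; first by rewrite expr0 -mpolyC1.
by rewrite exprS; apply: PM.
Qed.

End Polynomials.

Lemma swap_summands (V : zmodType) (A B C D E : V) :
  A + B + C + (D - B) + (E - C) = A + D + E.
Proof.
rewrite [A + B + C]addrAC [A + C + B + _]addrACA subrr addr0.
by rewrite [A + C + D]addrAC addrACA subrr addr0.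
Qed.

(** * Polynomial maps induced by linear maps, reflections *)
Section LinearForms.
Variable k : comUnitRingType.

Lemma linform_is_linear n : linear (@linform k n).
Proof.
move=> a x y; rewrite /linform scaler_sumr -big_split; apply: eq_bigr => i _.
by rewrite !mxE scalerDl scalerA.
Qed.
HB.instance Definition _ n :=
  GRing.isLinear.Build k 'cV[k]_n {mpoly k[n]} _ (@linform k n)
    (@linform_is_linear n).

Lemma linformD n (x y : 'cV[k]_n) : linform (x + y) = linform x + linform y.
Proof. exact: raddfD. Qed.
Lemma linformN n (x : 'cV[k]_n) : linform (- x) = - linform x.
Proof. exact: raddfN. Qed.
Lemma linformZ n c (x : 'cV[k]_n) : linform (c *: x) = c%:MP * linform x.
Proof. by rewrite linearZ mul_mpolyC. Qed.

Lemma linform_delta n (i : 'I_n) : linform (delta_mx i 0 : 'cV[k]_n) = 'X_i.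
Proof.
rewrite /linform (bigD1 i) //= mxE !eqxx scale1r big1 ?addr0 // => j ji.
by rewrite mxE (negPf ji) scale0r.
Qed.

Lemma linform_eq0 n (l : 'cV[k]_n) : linform l = 0 -> l = 0.
Proof.
move=> l0; apply/matrixP => i j; rewrite ord1 mxE.
have := congr1 (mcoeff U_(i)) l0; rewrite mcoeff0 /linform raddf_sum /=.
rewrite (bigD1 i) //= mcoeffZ mcoeffXU eqxx mulr1 big1 ?addr0 // => e ei.
by rewrite mcoeffZ mcoeffXU (negPf ei) mulr0.
Qed.

Lemma pairingD n (v : 'rV[k]_n) x y :
  pairing v (x + y) = pairing v x + pairing v y.
Proof. by rewrite /pairing mulmxDr mxE. Qed.
Lemma pairingZ n (v : 'rV[k]_n) a x : pairing v (a *: x) = a * pairing v x.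
Proof. by rewrite /pairing -scalemxAr mxE. Qed.
Lemma pairingB n (v : 'rV[k]_n) x y :
  pairing v (x - y) = pairing v x - pairing v y.
Proof. by rewrite -scaleN1r pairingD pairingZ mulN1r. Qed.

Lemma meval_linform n (v : 'rV[k]_n) l : (linform l).@[v 0] = pairing v l.
Proof.
rewrite /linform raddf_sum /pairing mxE; apply: eq_bigr => i _ /=.
by rewrite mevalZ mevalXU mulrC.
Qed.

Lemma meval_reg n (v : 'rV[k]_n) (f : {mpoly k[n]}) (c : k) :
  f.@[v 0] \is a GRing.unit -> c *: f = 0 -> c = 0.
Proof.
move=> fu cf; apply: (mulIr fu).
by rewrite -mevalZ cf meval0 mul0r.
Qed.

Lemma mpoly_rmorph_ext n (S : nzRingType)
    (g1 g2 : {rmorphism {mpoly k[n]} -> S}) :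
  (forall c, g1 c%:MP = g2 c%:MP) ->
  (forall l, g1 (linform l) = g2 (linform l)) -> g1 =1 g2.
Proof.
move=> eC eL; elim/mpoly_alg_ind => // [i|f g ef eg|f g ef eg].
- by rewrite -linform_delta eL.
- by rewrite !rmorphD ef eg.
- by rewrite !rmorphM ef eg.
Qed.

Fact symmap_key : unit. Proof. exact: tt. Qed.
(** The functor Sym applied to a linear map. *)
Definition symmap p n (A : 'M[k]_(p, n)) : {mpoly k[n]} -> {mpoly k[p]} :=
  locked_with symmap_key (fun f => f \mPo [tuple linform (col i A) | i < n]).

Section SymMap.
Variables (p n : nat) (A : 'M[k]_(p, n)).
Lemma symmapE f : symmap A f = f \mPo [tuple linform (col i A) | i < n].
Proof. by rewrite /symmap unlock. Qed.
Lemma symmap_zmod : zmod_morphism (symmap A).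
Proof. by move=> f g; rewrite !symmapE rmorphB. Qed.
Lemma symmap_monoid : monoid_morphism (symmap A).
Proof. by split=> [|f g]; rewrite !symmapE ?rmorph1 ?rmorphM. Qed.
HB.instance Definition _ := GRing.isZmodMorphism.Build _ _ (symmap A) symmap_zmod.
HB.instance Definition _ := GRing.isMonoidMorphism.Build _ _ (symmap A) symmap_monoid.
End SymMap.

Lemma symmapC p n (A : 'M[k]_(p, n)) c : symmap A c%:MP = c%:MP.
Proof. by rewrite symmapE comp_mpolyC. Qed.

Lemma symmapZ p n (A : 'M[k]_(p, n)) c f : symmap A (c *: f) = c *: symmap A f.
Proof. by rewrite !symmapE comp_mpolyZ. Qed.

Lemma symmap_linform p n (A : 'M[k]_(p, n)) l :
  symmap A (linform l) = linform (A *m l).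
Proof.
rewrite {1}/linform raddf_sum.
have -> : A *m l = \sum_i l i 0 *: col i A.
  apply/matrixP => a b; rewrite ord1 !mxE summxE; apply: eq_bigr => i _.
  by rewrite !mxE mulrC.
rewrite raddf_sum; apply: eq_bigr => i _ /=; rewrite symmapZ linearZ /=.
by rewrite symmapE comp_mpolyXU nth_mktuple.
Qed.

Lemma symmap_homog p n (A : 'M[k]_(p, n)) j f :
  f \is j.-homog -> symmap A f \is j.-homog.
Proof.
move=> hf; rewrite symmapE comp_mpolyEX big_seq; apply: rpred_sum => m hm.
apply: dhomogZ; rewrite comp_mpolyX -(dhomog_mf hf hm) /= mdegE.
apply: (big_ind2 (fun (g : {mpoly k[p]}) d => g \is d.-homog)).
- exact: dhomog1.
- by move=> *; exact: dhomogM.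
- move=> i _; rewrite -[X in X.-homog]mul1n tnth_mktuple.
  by apply: dhomogMn; exact: linform_homog.
Qed.

Lemma symmap_pihomog p n (A : 'M[k]_(p, n)) j f :
  symmap A (pihomog mdeg j f) = pihomog mdeg j (symmap A f).
Proof.
have [d fE] : exists d, f = \sum_(i < d) pihomog mdeg i f.
  by exists (@mmeasure _ _ mdeg f); exact: pihomog_partitionE.
rewrite [in LHS]fE [in RHS]fE (raddf_sum (pihomog mdeg j)).
rewrite !(raddf_sum (symmap A)) (raddf_sum (pihomog mdeg j)).
apply: eq_bigr => i _ /=.
have hi := pihomogP mdeg i f; case: (eqVneq (i : nat) j) => [<-|ne].
  by rewrite (pihomog_dE hi) (pihomog_dE (symmap_homog A hi)).
by rewrite (pihomog_ne0 ne hi) (pihomog_ne0 ne (symmap_homog A hi)) rmorph0.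
Qed.

Section Reflections.
Variables (n : nat) (a : 'cV[k]_n) (av : 'rV[k]_n).

Lemma dual_reflE l : dual_refl a av l = (1%:M - a *m av) *m l.
Proof.
rewrite /dual_refl mulmxBl mul1mx -mulmxA [av *m l]mx11_scalar -/(pairing av l).
by rewrite mul_mx_scalar.
Qed.

Lemma dual_refl_is_linear : linear (dual_refl a av).
Proof. by move=> c x y; rewrite !dual_reflE linearP. Qed.
HB.instance Definition _ :=
  GRing.isLinear.Build k 'cV[k]_n 'cV[k]_n _ (dual_refl a av) dual_refl_is_linear.

Lemma sym_reflE f : sym_refl a av f = symmap (1%:M - a *m av) f.
Proof.
rewrite /sym_refl symmapE; congr (_ \mPo _); apply: eq_mktuple => i.
by rewrite dual_reflE colE.
Qed.

Lemma sym_refl_rmorph : zmod_morphism (sym_refl a av) * monoid_morphism (sym_refl a av).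
Proof.
split=> [f g|]; first by rewrite !sym_reflE rmorphB.
by split=> [|f g]; rewrite !sym_reflE ?rmorph1 ?rmorphM.
Qed.
HB.instance Definition _ := GRing.isZmodMorphism.Build _ _ (sym_refl a av)
  sym_refl_rmorph.1.
HB.instance Definition _ := GRing.isMonoidMorphism.Build _ _ (sym_refl a av)
  sym_refl_rmorph.2.

Lemma sym_reflC c : sym_refl a av c%:MP = c%:MP.
Proof. by rewrite sym_reflE symmapC. Qed.

Lemma sym_refl_linform l : sym_refl a av (linform l) = linform (dual_refl a av l).
Proof. by rewrite sym_reflE symmap_linform dual_reflE. Qed.

(** For a reflection this is the existence of the divided difference; for a
    projection along a, it says that f and its projection agree modulo the
    linear form of a. *)
Lemma sym_refl_sub f : exists g, f - sym_refl a av f = linform a * g.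
Proof.
elim/mpoly_alg_ind: f => [c|i|f g [x hx] [y hy]|f g [x hx] [y hy]].
- by exists 0; rewrite sym_reflC subrr mulr0.
- exists (pairing av (delta_mx i 0))%:MP.
  rewrite -linform_delta sym_refl_linform -raddfB /= /dual_refl opprB addrC subrK.
  by rewrite linearZ /= mulrC mul_mpolyC.
- by exists (x + y); rewrite rmorphD mulrDr -hx -hy opprD addrACA.
- exists (x * g + sym_refl a av f * y).
  rewrite rmorphM mulrDr mulrA -hx mulrCA -hy /=.
  ring.
Qed.

Hypothesis av_a : pairing av a = 2.

Lemma dual_refl_root : dual_refl a av a = - a.
Proof. by rewrite /dual_refl av_a scaler_nat mulr2n opprD addrA subrr add0r. Qed.

Lemma dual_reflK : involutive (dual_refl a av).
Proof.
move=> l; rewrite [dual_refl a av l in LHS]/dual_refl linearB linearZ /=.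
by rewrite dual_refl_root scalerN opprK /dual_refl subrK.
Qed.

Lemma sym_reflK : involutive (sym_refl a av).
Proof.
move=> f; rewrite -[LHS]/((sym_refl a av \o sym_refl a av) f).
apply: (@mpoly_rmorph_ext _ _ _ idfun) => [c|l] /=; first by rewrite !sym_reflC.
by rewrite !sym_refl_linform dual_reflK.
Qed.

End Reflections.

Section ProjectAlong.
Variables (n : nat) (a : 'cV[k]_n) (av : 'rV[k]_n).
Hypothesis av_a : pairing av a = 1.

Lemma linform_reg f : linform a * f = 0 -> f = 0.
Proof.
apply: mpoly_mccoy => c; apply: (@meval_reg _ av).
by rewrite meval_linform av_a unitr1.
Qed.

(** If q is regular modulo the linear form a, then a is regular modulo q: in
    a x = q y the factor y vanishes modulo a, and a can be cancelled. *)
Lemma regular_pair (q x y : {mpoly k[n]}) :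
  (forall f, sym_refl a av q * f = 0 -> f = 0) ->
  linform a * x = q * y -> exists z, x = q * z.
Proof.
move=> qreg e; have [z hz] := sym_refl_sub a av y.
have y0 : sym_refl a av y = 0.
  apply: qreg; rewrite -rmorphM -e rmorphM /= sym_refl_linform /dual_refl av_a.
  by rewrite scale1r subrr raddf0 mul0r.
exists z; apply/eqP; rewrite -subr_eq0; apply/eqP/linform_reg.
by rewrite mulrBr e mulrCA -hz y0 subr0 subrr.
Qed.

End ProjectAlong.
End LinearForms.

(** * Bimodule maps with a degree, kernels, cokernels and retracts *)
Section Homs.
Variables (k : comUnitRingType) (n : nat).
Local Notation R := {mpoly k[n]}.
Local Notation bimod := (grbimod k n).
Implicit Types (M N L : bimod) (a b : int).

(** Maps that raise degrees by a.  Keeping the degree outside of the bimodules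
    lets isomorphisms between shifts compose without rewriting shifts. *)
Record dhom a M N (f : M -> N) : Prop := Dhom {
  dhomB : zmod_morphism f;
  dhomZ : forall r x, f (r *: x) = r *: f x;
  dhomR : forall x r, f (ract x r) = ract (f x) r;
  dhom_pr : forall d x, f (pr d x) = pr (d + a) (f x)
}.

Section One.
Variables (a : int) (M N : bimod) (f : M -> N).
Hypothesis hf : dhom a f.
Lemma dhom0 : f 0 = 0.
Proof. by have := dhomB hf 0 0; rewrite !subrr. Qed.
Lemma dhomN x : f (- x) = - f x.
Proof. by rewrite -[- x]sub0r (dhomB hf) dhom0 sub0r. Qed.
Lemma dhomD x y : f (x + y) = f x + f y.
Proof. by rewrite -{1}[y]opprK (dhomB hf) dhomN opprK. Qed.
Lemma dhom_zact l x : f (zact l x) = zact l (f x).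
Proof. by rewrite /zact (dhomB hf) (dhomZ hf) (dhomR hf). Qed.
Lemma dhom_inj : (forall x, f x = 0 -> x = 0) -> injective f.
Proof.
move=> f0 x y e; apply/eqP; rewrite -subr_eq0; apply/eqP/f0.
by rewrite (dhomB hf) e subrr.
Qed.
End One.

Lemma dhom_id M : dhom 0 (@id M).
Proof. by split=> // d x; rewrite addr0. Qed.

Lemma dhom_comp a b M N L (f : M -> N) (g : N -> L) :
  dhom a f -> dhom b g -> dhom (a + b) (g \o f).
Proof.
move=> hf hg; split=> [x y|r x|x r|d x] /=.
- by rewrite (dhomB hf) (dhomB hg).
- by rewrite (dhomZ hf) (dhomZ hg).
- by rewrite (dhomR hf) (dhomR hg).
- by rewrite (dhom_pr hf) (dhom_pr hg) addrA.
Qed.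

Lemma dhom_inv a M N (f : M -> N) g :
  dhom a f -> cancel f g -> cancel g f -> dhom (- a) g.
Proof.
move=> hf fK gK; have fI := can_inj fK; split=> [x y|r x|x r|d x]; apply: fI.
- by rewrite (dhomB hf) !gK.
- by rewrite (dhomZ hf) !gK.
- by rewrite (dhomR hf) !gK.
- by rewrite (dhom_pr hf) !gK subrK.
Qed.

Lemma dhom_shift a M N (f : M -> N) :
  dhom a f -> dhom 0 (f : M -> shift N a).
Proof.
move=> hf; split; [exact: dhomB hf|exact: dhomZ hf|exact: dhomR hf|].
by move=> d x; rewrite addr0 (dhom_pr hf).
Qed.

Lemma dhom_unshift M a : dhom a (id : shift M a -> M).
Proof. by []. Qed.

Lemma bimod_isoP M N (f : M -> N) : dhom 0 f -> bijective f -> bimod_iso M N.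
Proof.
move=> hf bf.
have lf : linear f by move=> c x y; rewrite (dhomD hf) (dhomZ hf).
pose lin := GRing.isLinear.Build R M N _ f lf.
pose F : {linear M -> N} := HB.pack f lin.
exists F; split=> //; first exact: dhomR hf.
by move=> d x; rewrite /= (dhom_pr hf) addr0.
Qed.

Lemma bimod_iso_shift a M N (f : M -> N) :
  dhom a f -> bijective f -> bimod_iso M (shift N a).
Proof. by move=> /dhom_shift; exact: bimod_isoP. Qed.

Lemma bimod_iso_dhom M N : bimod_iso M N ->
  exists f : M -> N, exists g : N -> M,
    [/\ dhom 0 f, dhom 0 g, cancel f g & cancel g f].
Proof.
case=> F [[g FK gK] FR Fp]; exists F, g.
have hF : dhom 0 F.
  split=> //; first exact: raddfB.
    by move=> r x; rewrite linearZ.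
  by move=> d x; rewrite addr0.
by split=> //; rewrite -oppr0; apply: dhom_inv hF _ _.
Qed.

Lemma bimod_iso_unshift0 M N : bimod_iso M (shift N 0) -> bimod_iso M N.
Proof.
move=> /bimod_iso_dhom[f [g [hf _ fK gK]]].
by apply: (bimod_isoP (dhom_comp hf (dhom_unshift N 0))); exists g.
Qed.

Lemma pi_minus_iso a l M (K : bimod) (f : K -> M) : dhom a f -> injective f ->
  (forall x, zact l (f x) = 0) ->
  (forall y, zact l y = 0 -> exists x, y = f x) ->
  bimod_iso (pi_minus l M) (shift K (- a)).
Proof.
move=> hf fI fz fs.
have kz (y : pi_minus l M) : zact l (val y) = 0 by apply/eqP/(kvalP y).
pose g (y : pi_minus l M) : K := sval (cid (fs _ (kz y))).
have gP y : f (g y) = val y by rewrite /g; case: cid.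
apply: (@bimod_iso_shift _ _ _ g).
  split=> [x y|r x|x r|d x]; apply: fI.
  - by rewrite (dhomB hf) !gP.
  - by rewrite (dhomZ hf) !gP.
  - by rewrite (dhomR hf) !gP.
  - by rewrite (dhom_pr hf) !gP subrK.
have hP x : f x \in kerpred l (M := M) by apply/eqP/fz.
exists (fun x => @KerT _ _ l M _ (hP x)) => [y|x]; first by apply: val_inj; rewrite /= gP.
by apply: fI; rewrite gP.
Qed.

Lemma pi_plus_iso a l M (K : bimod) (g : M -> K) : dhom a g ->
  (forall y, exists x, g x = y) ->
  (forall x, g (zact l x) = 0) ->
  (forall x, g x = 0 -> exists y, x = zact l y) ->
  bimod_iso (pi_plus l M) (shift K a).
Proof.
move=> hg gs gz gk.
pose h (q : pi_plus l M) : K := g (cok_repr q).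
have hP x : h (cok_pi l x) = g x.
  have /cok_piP[z zE] := cok_reprK (cok_pi l x).
  by apply/eqP; rewrite -subr_eq0 -(dhomB hg) zE gz.
apply: (@bimod_iso_shift _ _ _ h).
  split=> [x y|r x|x r|d x].
  - elim/cok_ind: x => x; elim/cok_ind: y => y.
    by rewrite -raddfB !hP (dhomB hg).
  - by elim/cok_ind: x => x; rewrite -cok_piZ !hP (dhomZ hg).
  - by elim/cok_ind: x => x; rewrite [ract _ _]cok_raE !hP (dhomR hg).
  - by elim/cok_ind: x => x; rewrite [pr _ _]cok_prE !hP (dhom_pr hg).
pose s y := cok_pi l (sval (cid (gs y))).
have sK : cancel s h by move=> y; rewrite /s hP; case: cid.
have hI x y : h x = h y -> x = y.
  elim/cok_ind: x => x; elim/cok_ind: y => y; rewrite !hP => e.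
  by apply/cok_piP/gk; rewrite (dhomB hg) e subrr.
by exists s => // y; apply: hI; rewrite sK.
Qed.

Lemma dhom_inl M N : dhom 0 (fun x : M => (x, 0) : dsum M N).
Proof.
split=> [x y|r x|x r|d x]; congr pair => //=.
- by rewrite subr0.
- by rewrite scaler0.
- by rewrite ra0l.
- by rewrite addr0.
- by rewrite pr0.
Qed.

Lemma dhom_inr M N : dhom 0 (fun x : N => (0, x) : dsum M N).
Proof.
split=> [x y|r x|x r|d x]; congr pair => //=.
- by rewrite subr0.
- by rewrite scaler0.
- by rewrite ra0l.
- by rewrite pr0.
- by rewrite addr0.
Qed.

Lemma dhom_fst M N : dhom 0 (fst : dsum M N -> M).
Proof. by split=> // d x; rewrite addr0. Qed.

Lemma dhom_snd M N : dhom 0 (snd : dsum M N -> N).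
Proof. by split=> // d x; rewrite addr0. Qed.

(** The complement of a retract is the kernel of the retraction, which has to be
    a graded bimodule for indecomposability to apply. *)
Section Kernel.
Variables (a : int) (M N : bimod) (g : M -> N).
Hypothesis hg : dhom a g.

Definition dkerpred : {pred M} := fun x => g x == 0.
Lemma dkerpred_submod : submod_closed dkerpred.
Proof.
split; first by rewrite unfold_in (dhom0 hg).
move=> r x y; rewrite !unfold_in (dhomD hg) (dhomZ hg) => /eqP -> /eqP ->.
by rewrite scaler0 addr0.
Qed.

Record dker := Dker { dkval : M; dkvalP : dkval \in dkerpred }.
HB.instance Definition _ := [isSub for dkval].
HB.instance Definition _ := [Choice of dker by <:].
HB.instance Definition _ :=
  GRing.isSubmodClosed.Build R M dkerpred dkerpred_submod.
HB.instance Definition _ := [SubChoice_isSubLmodule of dker by <:].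

Lemma dker_raP (x : dker) r : ract (val x) r \in dkerpred.
Proof. by rewrite unfold_in (dhomR hg) (eqP (dkvalP x)) ra0l. Qed.
Lemma dker_prP d (x : dker) : pr d (val x) \in dkerpred.
Proof. by rewrite unfold_in (dhom_pr hg) (eqP (dkvalP x)) pr0. Qed.

Definition dker_ra (x : dker) r : dker := Dker (dker_raP x r).
Definition dker_pr d (x : dker) : dker := Dker (dker_prP d x).

Lemma dker_axioms : grbimod_axioms dker_ra dker_pr.
Proof.
split.
- by move=> x y r; apply: val_inj; rewrite /= raDl.
- by move=> x r s; apply: val_inj; rewrite /= raDr.
- by move=> x; apply: val_inj; rewrite /= ra1.
- by move=> x r s; apply: val_inj; rewrite /= raM.
- by move=> x r s; apply: val_inj; rewrite /= lra.
- by move=> x r; apply: val_inj; rewrite /= raC.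
- by move=> d x y; apply: val_inj; rewrite /= prB.
- by move=> d e x; apply: val_inj; rewrite /= pr_pr; case: ifP.
- move=> x; have [s us xs] := pr_sum (val x); exists s => //.
  by apply: val_inj; rewrite raddf_sum.
- by move=> d j f x hf; apply: val_inj; rewrite /= (pr_l _ _ hf).
- by move=> d j f x hf; apply: val_inj; rewrite /= (pr_r _ _ hf).
Qed.

Definition dker_bimod : bimod := GrBimod dker_axioms.
End Kernel.

Lemma indecomposable_retract a (S B : bimod) (f : S -> B) (g : B -> S) :
  dhom a f -> dhom (- a) g -> cancel f g -> ~ bimod_zero S ->
  indecomposable B -> bijective g.
Proof.
move=> hf hg fK S0 [_ indec].
have iP (x : B) : x - f (g x) \in dkerpred g.
  by rewrite unfold_in (dhomB hg) fK subrr.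
pose F (x : B) : dsum (shift S (- a)) (dker_bimod hg) := (g x, @Dker _ _ g _ (iP x)).
have hF : dhom 0 F.
  split=> [x y|r x|x r|d x]; congr pair; try apply: val_inj => /=.
  - by rewrite (dhomB hg).
  - by rewrite (dhomB hg) (dhomB hf) !opprD !opprK addrACA.
  - by rewrite (dhomZ hg).
  - by rewrite (dhomZ hg) (dhomZ hf) scalerBr.
  - by rewrite (dhomR hg).
  - by rewrite (dhomR hg) (dhomR hf) raB.
  - by rewrite (dhom_pr hg) addr0.
  - by rewrite (dhom_pr hg) (dhom_pr hf) subrK addr0 prB.
have bF : bijective F.
  exists (fun y => f y.1 + val y.2) => [x|[x y]] /=; first by rewrite addrC subrK.
  have yk : g (val y) = 0 by apply/eqP/(dkvalP y).
  have e : g (f x + val y) = x by rewrite (dhomD hg) fK yk addr0.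
  by congr pair; last apply: val_inj; rewrite /= e // addrAC subrr add0r.
case: (indec _ _ (bimod_isoP hF bF)) => [//|k0].
exists f => // x; apply/eqP; rewrite eq_sym -subr_eq0; apply/eqP.
by have /(congr1 val) := k0 (@Dker _ _ g _ (iP x)).
Qed.

End Homs.

(** * The action of R (x) R on a bimodule *)
Section Action.
Variables (k : comUnitRingType) (n : nat).
Local Notation R := {mpoly k[n]}.
Local Notation Re := {mpoly {mpoly k[n]}[n]}.

Fact act_key : unit. Proof. exact: tt. Qed.

Definition inr_Re : R -> Re := locked_with act_key (map_mpoly (@mpolyC n k)).
Lemma inr_ReE f : inr_Re f = map_mpoly (@mpolyC n k) f.
Proof. by rewrite /inr_Re unlock. Qed.
Lemma inr_Re_zmod : zmod_morphism inr_Re.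
Proof. by move=> f g; rewrite !inr_ReE rmorphB. Qed.
Lemma inr_Re_monoid : monoid_morphism inr_Re.
Proof. by split=> [|f g]; rewrite !inr_ReE ?rmorph1 ?rmorphM. Qed.
HB.instance Definition _ := GRing.isZmodMorphism.Build R Re inr_Re inr_Re_zmod.
HB.instance Definition _ := GRing.isMonoidMorphism.Build R Re inr_Re inr_Re_monoid.
Lemma inr_ReC c : inr_Re c%:MP = c%:MP%:MP.
Proof. by rewrite inr_ReE map_mpolyC. Qed.
Lemma inr_ReX i : inr_Re 'X_i = 'X_i.
Proof. by rewrite inr_ReE map_mpolyX. Qed.

Section Act.
Variable M : grbimod k n.

(** R (x) R is presented as polynomials over R: coefficients act from the left
    and monomials from the right. *)
Definition act : Re -> M -> M := locked_with act_key
  (fun f x => \sum_(mu <- msupp f) ract (f@_mu *: x) 'X_[mu]).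

Lemma actE f x : act f x = \sum_(mu <- msupp f) ract (f@_mu *: x) 'X_[mu].
Proof. by rewrite /act unlock. Qed.

Lemma act_wide (f : Re) (x : M) d : (msize f <= d)%N ->
  act f x = \sum_(mu : 'X_{1..n < d}) ract (f@_mu *: x) 'X_[mu].
Proof.
move=> le; set I : subFinType _ := 'X_{1..n < d}.
rewrite actE (big_mksub I) ?msupp_uniq //=; last first.
  by move=> m /msize_mdeg_lt /leq_trans; apply.
rewrite big_rmcond //= => j /memN_msupp_eq0 ->.
by rewrite scale0r ra0l.
Qed.

Lemma actDl f g x : act (f + g) x = act f x + act g x.
Proof.
pose d := maxn (msize (f + g)) (maxn (msize f) (msize g)).
rewrite !(@act_wide _ _ d) ?leq_max ?leqnn ?orbT // -big_split.
by apply: eq_bigr => mu _; rewrite mcoeffD scalerDl raDl.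
Qed.

Lemma act0l x : act 0 x = 0.
Proof. by apply: (addrI (act 0 x)); rewrite -actDl !addr0. Qed.

Lemma actDr f x y : act f (x + y) = act f x + act f y.
Proof.
rewrite !actE -big_split; apply: eq_bigr => mu _.
by rewrite scalerDr raDl.
Qed.

Lemma act0r f : act f 0 = 0.
Proof. by apply: (addrI (act f 0)); rewrite -actDr !addr0. Qed.

Lemma actNr f x : act f (- x) = - act f x.
Proof. by apply/eqP; rewrite -addr_eq0 -actDr addNr act0r. Qed.

Lemma act_suml (I : Type) (r : seq I) (F : I -> Re) x :
  act (\sum_(i <- r) F i) x = \sum_(i <- r) act (F i) x.
Proof. by apply: (big_morph (act^~ x)) => [f g|]; [exact: actDl|exact: act0l]. Qed.

Lemma act_sumr (I : Type) (r : seq I) (F : I -> M) f :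
  act f (\sum_(i <- r) F i) = \sum_(i <- r) act f (F i).
Proof. by apply: (big_morph (act f)) => [x y|]; [exact: actDr|exact: act0r]. Qed.

Lemma act_mon a mu x : act (a *: 'X_[mu]) x = ract (a *: x) 'X_[mu].
Proof.
have [->|a0] := eqVneq a 0; first by rewrite !scale0r act0l ra0l.
by rewrite actE msuppMCX // big_seq1 mcoeffZ mcoeffX eqxx mulr1.
Qed.

Lemma actM f g x : act (f * g) x = act f (act g x).
Proof.
rewrite [f]mpolyE [g]mpolyE mulr_suml !act_suml; apply: eq_bigr => mu _.
rewrite mulr_sumr act_suml act_sumr; apply: eq_bigr => nu _.
rewrite -scalerAl -scalerAr -mpolyXD scalerA !act_mon.
by rewrite lra -raM mpolyXD -scalerA mulrC.
Qed.

Lemma act_left a x : act a%:MP x = a *: x.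
Proof. by rewrite -[a%:MP]mulr1 mul_mpolyC -mpolyX0 act_mon mpolyX0 ra1. Qed.

Lemma act1 x : act 1 x = x.
Proof. by rewrite -mpolyC1 act_left scale1r. Qed.

Lemma act_inr b x : act (inr_Re b) x = ract x b.
Proof.
elim/mpoly_alg_ind: b x => [c|i|f g hf hg|f g hf hg] x.
- by rewrite inr_ReC act_left raC.
- by rewrite inr_ReX -[X in act X]scale1r act_mon scale1r.
- by rewrite rmorphD actDl hf hg raDr.
- by rewrite rmorphM actM hf hg -raM mulrC.
Qed.

Lemma actN f x : act (- f) x = - act f x.
Proof. by apply/eqP; rewrite -addr_eq0 -actDl addNr act0l. Qed.

End Act.

Lemma dhom_act a (M N : grbimod k n) (F : M -> N) :
  dhom a F -> forall f x, F (act f x) = act f (F x).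
Proof.
move=> hF f x; rewrite !actE (big_morph F (dhomD hF) (dhom0 hF)).
by apply: eq_bigr => mu _; rewrite (dhomR hF) (dhomZ hF).
Qed.

End Action.

(** * Cyclic bimodules: quotients of a polynomial ring by two homogeneous elements *)
Section Quotient.
Variables (k : comUnitRingType) (N : nat).
Local Notation T := {mpoly k[N]}.

Definition idl (g1 g2 : T) : {pred T} :=
  fun f => `[< exists a b, f = a * g1 + b * g2 >].

Section Q.
Variables g1 g2 : T.

Lemma idlP f : reflect (exists a b, f = a * g1 + b * g2) (f \in idl g1 g2).
Proof. exact: asboolP. Qed.

Lemma idl_zmod : zmod_closed (idl g1 g2).
Proof.
split; first by apply/idlP; exists 0, 0; rewrite !mul0r addr0.
move=> x y /idlP[a [b ->]] /idlP[c [d ->]]; apply/idlP; exists (a - c), (b - d).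
by rewrite !mulrBl opprD addrACA.
Qed.
HB.instance Definition _ := GRing.isZmodClosed.Build T (idl g1 g2) idl_zmod.

Lemma idlM f x : x \in idl g1 g2 -> f * x \in idl g1 g2.
Proof.
move=> /idlP[a [b ->]]; apply/idlP; exists (f * a), (f * b).
by rewrite mulrDr !mulrA.
Qed.

Lemma idl_eq x y : x \in idl g1 g2 -> x = y -> y \in idl g1 g2.
Proof. by move=> ? <-. Qed.

Lemma idl_gen1 f : f * g1 \in idl g1 g2.
Proof. by apply/idlP; exists f, 0; rewrite mul0r addr0. Qed.
Lemma idl_gen2 f : f * g2 \in idl g1 g2.
Proof. by apply/idlP; exists 0, f; rewrite mul0r add0r. Qed.

Definition quoT : Type := Quotient.quot (idl g1 g2).
HB.instance Definition _ := GRing.Zmodule.on quoT.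
Definition qpi (x : T) : quoT := \pi_(Quotient.quot (idl g1 g2))%qT x.

Lemma qpiB : zmod_morphism qpi.
Proof. exact: (@pi_is_zmod_morphism _ _ _ (Quotient.quot (idl g1 g2))). Qed.
HB.instance Definition _ := GRing.isZmodMorphism.Build T quoT qpi qpiB.

Lemma qpiP x y : qpi x = qpi y <-> x - y \in idl g1 g2.
Proof.
split=> [/eqP|]; first by rewrite -Quotient.idealrBE.
by rewrite Quotient.idealrBE => /eqP.
Qed.

Lemma qpi0 x : qpi x = 0 <-> x \in idl g1 g2.
Proof. by rewrite -(raddf0 qpi) qpiP subr0. Qed.

Definition qrepr (q : quoT) : T := generic_quotient.repr (q : Quotient.quot (idl g1 g2)).
Lemma qreprK q : qpi (qrepr q) = q.
Proof. exact: generic_quotient.reprK. Qed.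

Lemma quo_ind (P : quoT -> Prop) : (forall x, P (qpi x)) -> forall q, P q.
Proof. by move=> H q; rewrite -[q]qreprK. Qed.

Definition qmap (G : zmodType) (f : T -> G) (q : quoT) : G := f (qrepr q).

Lemma qmapE (G : zmodType) (f : T -> G) x : zmod_morphism f ->
  (forall y, y \in idl g1 g2 -> f y = 0) -> qmap f (qpi x) = f x.
Proof.
move=> fB f0; apply/eqP; rewrite -subr_eq0 -fB; apply/eqP/f0.
by apply/qpiP; rewrite qreprK.
Qed.
End Q.

(** A polynomial bundled with its degree, so that the ideal is graded. *)
Record homel := Homel { hel :> T; hdeg : nat; hel_homog : hel \is hdeg.-homog }.

Lemma idl_regpr (g1 g2 : homel) d f :
  f \in idl g1 g2 -> regpr d f \in idl g1 g2.
Proof.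
move=> /idlP[a [b ->]]; apply/idlP.
exists (regpr (d - (2 * hdeg g1)%:Z) a), (regpr (d - (2 * hdeg g2)%:Z) b).
rewrite [regpr d _](@prD k N (Rbim k N)) /=; congr (_ + _).
  by rewrite -{1}[d](subrK (2 * hdeg g1)%:Z) mulrC (regpr_mul _ _ (hel_homog g1)) mulrC.
by rewrite -{1}[d](subrK (2 * hdeg g2)%:Z) mulrC (regpr_mul _ _ (hel_homog g2)) mulrC.
Qed.

Lemma regprB d (f g : T) : regpr d (f - g) = regpr d f - regpr d g.
Proof. exact: (@prB k N (Rbim k N)). Qed.

Section Bimodule.
Variables (n : nat) (li ri : 'M[k]_(N, n)) (g1 g2 : homel).
Local Notation R := {mpoly k[n]}.
Local Notation q := (@qpi g1 g2).
Local Notation qT := (quoT g1 g2).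

Definition quo_scale (r : R) : qT -> qT := qmap (fun x => q (symmap li r * x)).
Definition quo_ra (x : qT) (r : R) : qT := qmap (fun x => q (symmap ri r * x)) x.
Definition quo_pr (d : int) : qT -> qT := qmap (fun x => q (regpr d x)).

Lemma quo_mulE (f x : T) : qmap (fun y => q (f * y)) (q x) = q (f * x).
Proof.
apply: qmapE => [y z|y hy]; first by rewrite mulrBr raddfB.
by apply/qpi0/idlM.
Qed.
Lemma quo_scaleE r x : quo_scale r (q x) = q (symmap li r * x).
Proof. exact: quo_mulE. Qed.
Lemma quo_raE x r : quo_ra (q x) r = q (symmap ri r * x).
Proof. exact: quo_mulE. Qed.
Lemma quo_prE d x : quo_pr d (q x) = q (regpr d x).
Proof.
apply: (qmapE (f := fun x => q (regpr d x))) => [y z|y hy].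
  by rewrite regprB raddfB.
by apply/qpi0/idl_regpr.
Qed.

Fact quo_scaleA a b x : quo_scale a (quo_scale b x) = quo_scale (a * b) x.
Proof. by elim/quo_ind: x => x; rewrite !quo_scaleE rmorphM mulrA. Qed.
Fact quo_scale1 : left_id 1 quo_scale.
Proof. by elim/quo_ind => x; rewrite quo_scaleE rmorph1 mul1r. Qed.
Fact quo_scaleDr : right_distributive quo_scale +%R.
Proof.
move=> a; elim/quo_ind => x; elim/quo_ind => y.
by rewrite -raddfD !quo_scaleE -raddfD mulrDr.
Qed.
Fact quo_scaleDl x : {morph quo_scale^~ x : a b / a + b}.
Proof. by elim/quo_ind: x => x a b; rewrite !quo_scaleE rmorphD mulrDl raddfD. Qed.

Definition quoM : Type := qT.
HB.instance Definition _ := GRing.Zmodule.on quoM.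
HB.instance Definition _ := GRing.Zmodule_isLmodule.Build R quoM
  quo_scaleA quo_scale1 quo_scaleDr quo_scaleDl.

Definition cls (x : T) : quoM := q x.

Lemma clsB : zmod_morphism cls.
Proof. exact: raddfB. Qed.
HB.instance Definition _ := GRing.isZmodMorphism.Build T quoM cls clsB.

Lemma cls_ind (P : quoM -> Prop) : (forall x, P (cls x)) -> forall q, P q.
Proof. exact: quo_ind. Qed.

Lemma quo_axioms : @grbimod_axioms k n quoM quo_ra quo_pr.
Proof.
split.
- move=> x y a; elim/quo_ind: x => x; elim/quo_ind: y => y.
  by rewrite -raddfD !quo_raE -raddfD mulrDr.
- by move=> x a b; elim/quo_ind: x => x; rewrite !quo_raE rmorphD mulrDl raddfD.
- by move=> x; elim/quo_ind: x => x; rewrite quo_raE rmorph1 mul1r.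
- by move=> x a b; elim/quo_ind: x => x; rewrite !quo_raE rmorphM mulrA (mulrC (symmap ri b)).
- move=> a x b; elim/quo_ind: x => x.
  rewrite -[LHS]/(quo_scale a (quo_ra (q x) b)).
  rewrite -[RHS]/(quo_ra (quo_scale a (q x)) b).
  by rewrite quo_raE !quo_scaleE quo_raE mulrCA.
- move=> x c; elim/quo_ind: x => x.
  rewrite -[RHS]/(quo_scale c%:MP (q x)).
  by rewrite quo_raE quo_scaleE !symmapC.
- move=> d x y; elim/quo_ind: x => x; elim/quo_ind: y => y.
  by rewrite -raddfB !quo_prE -raddfB regprB.
- move=> d e x; elim/quo_ind: x => x; rewrite !quo_prE.
  rewrite [regpr d _](@pr_pr k N (Rbim k N)) /=.
  by case: ifP => // _; rewrite raddf0.
- move=> x; elim/quo_ind: x => x.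
  have [s us xs] := @pr_sum k N (Rbim k N) x; exists s => //.
  rewrite {1}xs raddf_sum; apply: eq_bigr => d _; exact/esym/quo_prE.
- move=> d j f x hf; elim/quo_ind: x => x.
  rewrite -[LHS]/(quo_pr _ (quo_scale f (q x))).
  rewrite -[RHS]/(quo_scale f (quo_pr d (q x))).
  rewrite quo_prE !quo_scaleE quo_prE.
  by rewrite (regpr_mul _ _ (symmap_homog li hf)).
- move=> d j f x hf; elim/quo_ind: x => x.
  rewrite quo_raE !quo_prE quo_raE.
  by rewrite (regpr_mul _ _ (symmap_homog ri hf)).
Qed.

(** R acts from the left through li and from the right through ri, two linear
    maps from the linear forms of R to those of the big polynomial ring. *)
Definition quo : grbimod k n := GrBimod quo_axioms.

Lemma clsZ r x : r *: (cls x : quo) = cls (symmap li r * x).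
Proof. exact: quo_scaleE. Qed.
Lemma cls_ra r x : ract (cls x : quo) r = cls (symmap ri r * x).
Proof. exact: quo_raE. Qed.
Lemma cls_pr d x : pr d (cls x : quo) = cls (regpr d x).
Proof. exact: quo_prE. Qed.
Lemma clsP x y : cls x = cls y <-> x - y \in idl g1 g2.
Proof. exact: qpiP. Qed.
Lemma cls0 x : cls x = 0 <-> x \in idl g1 g2.
Proof. exact: qpi0. Qed.

Definition lift_quo (M : grbimod k n) (f : T -> M) : quo -> M := qmap f.

Section Lift.
Variables (M : grbimod k n) (f : T -> M).
Hypotheses (fB : zmod_morphism f)
  (f0 : forall y, y \in idl g1 g2 -> f y = 0).
Lemma lift_quoE x : lift_quo f (cls x) = f x.
Proof. exact: qmapE. Qed.

Lemma dhom_lift_quo a :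
  (forall r x, f (symmap li r * x) = r *: f x) ->
  (forall r x, f (symmap ri r * x) = ract (f x) r) ->
  (forall d x, f (regpr d x) = pr (d + a) (f x)) -> dhom a (lift_quo f).
Proof.
move=> fl fr fp; split=> [x y|r x|x r|d x].
- elim/cls_ind: x => x; elim/cls_ind: y => y.
  by rewrite -(raddfB cls) !lift_quoE fB.
- by elim/cls_ind: x => x; rewrite clsZ !lift_quoE fl.
- by elim/cls_ind: x => x; rewrite cls_ra !lift_quoE fr.
- by elim/cls_ind: x => x; rewrite cls_pr !lift_quoE fp.
Qed.
End Lift.

End Bimodule.
End Quotient.

(** * Quantum numbers, fundamental weights and the quadratic invariant *)
Section Coordinates.
Variables (k : comUnitRingType) (n m : nat) (h : realization k n m).
Variable rho : bool -> 'cV[k]_n.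
Hypothesis rho_weights :
  forall u v : bool, pairing (alphav h v) (rho u) = (u == v)%:R.
Local Notation R := {mpoly k[n]}.
Local Notation T := {mpoly k[n + 2]}.
Local Notation t := (rq h + (rq h)^-1).
Local Notation qn := (qnum (rq h)).

Lemma pairing_off u : pairing (alphav h u) (alpha h (~~ u)) = - t.
Proof. by case: u; rewrite -?(rz_st h) // -(rz_sym h). Qed.

Lemma qnum0 : qn 0 = 0.
Proof. by rewrite /qnum big_ord0. Qed.

Lemma qnum1 : qn 1 = 1.
Proof. by rewrite /qnum big_ord1 -[RHS](expr0z (rq h)). Qed.

Lemma qnumSS j : qn j.+2 = t * qn j.+1 - qn j.
Proof.
have qu := rz_unit h; set q := rq h in qu *.
have e1 : qnum q j.+2 = q * qnum q j.+1 + q ^ (- (j.+1)%:Z).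
  rewrite /qnum big_ord_recr mulr_sumr /=; congr (_ + _ ^ _).
    apply: eq_bigr => i _; rewrite -[X in X * _]expr1z -exprzDr //.
    by congr (_ ^ _); rewrite -!natz; lia.
  by rewrite mulSn; lia.
have e2 : q^-1 * qnum q j.+1 = qnum q j + q ^ (- (j.+1)%:Z).
  rewrite /qnum big_ord_recr mulrDr mulr_sumr /=; congr (_ + _).
    apply: eq_bigr => i _; rewrite -[X in X * _]exprN1 -exprzDr //.
    by congr (_ ^ _); lia.
  by rewrite -[X in X * _]exprN1 -exprzDr //; congr (_ ^ _); lia.
by rewrite mulrDl e2 e1; ring.
Qed.

(** Every linear form is, up to one invariant under W, a combination of the two
    fundamental weights. *)
Lemma weight_decomp l : exists2 z, (forall u, pairing (alphav h u) z = 0) &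
  l = z + pairing (alphav h true) l *: rho true
        + pairing (alphav h false) l *: rho false.
Proof.
pose c u := pairing (alphav h u) l; rewrite -/(c true) -/(c false).
exists (l - c true *: rho true - c false *: rho false) => [u|].
  rewrite !pairingB !pairingZ !rho_weights /c.
  by case: u; rewrite /= mulr1 mulr0 ?subr0 ?subrr // addrAC subrr sub0r oppr0.
by rewrite addrAC !subrK.
Qed.

(** The j-th letter from the right of the alternating word ending in ~~ p,
    counted from 0. *)
Definition letter (p : bool) (j : nat) : bool := if odd j then p else ~~ p.

Lemma letterSS p j : letter p j.+2 = letter p j.
Proof. by rewrite /letter /= negbK. Qed.

Lemma letterS p j : letter p j.+1 = ~~ letter p j.
Proof. by rewrite /letter /=; case: (odd j); rewrite ?negbK. Qed.

Local Notation srefl u := (dual_refl (alpha h u) (alphav h u)).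

(** The orbit of rho_p under the alternating words ending in p; the index is the
    length of the word. *)
Fixpoint omega (p : bool) (j : nat) : 'cV[k]_n :=
  if j is j'.+1 then srefl (letter p j) (omega p j') else rho p.

(** These pairings satisfy the recursion of quantum numbers because the
    off-diagonal entry of the Cartan matrix is - [2]. *)
Lemma pairing_omega p j :
  pairing (alphav h (letter p j.+1)) (omega p j) = qn j.+1 /\
  pairing (alphav h (letter p j)) (omega p j) = - qn j.
Proof.
elim: j => [|j [IH1 IH2]].
  by rewrite /= !rho_weights qnum0 qnum1 /letter /= eqxx oppr0; case: p.
have e1 : pairing (alphav h (letter p j.+1)) (omega p j.+1) = - qn j.+1.
  rewrite /= /dual_refl pairingB pairingZ IH1 rz_diag; ring.
split=> //; rewrite letterSS /= /dual_refl pairingB pairingZ IH1 IH2 letterS.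
by rewrite pairing_off qnumSS; ring.
Qed.

Lemma omegaS p j :
  omega p j.+1 = omega p j - qn j.+1 *: alpha h (letter p j.+1).
Proof. by rewrite /= /dual_refl (pairing_omega p j).1. Qed.

(** Specializations of [a + b] = [a] [b + 1] - [a - 1] [b]. *)
Lemma qnum_double i :
  qn (2 * i).+1 = qn i.+1 ^+ 2 - qn i ^+ 2 /\
  qn (2 * i).+2 = qn i.+1 * (qn i.+2 - qn i).
Proof.
elim: i => [|i [IH1 IH2]].
  by rewrite muln0 !qnumSS qnum0 qnum1; split; ring.
have e3 : qn (2 * i.+1).+1 = qn i.+2 ^+ 2 - qn i.+1 ^+ 2.
  by rewrite mulnS !add2n qnumSS IH2 IH1 !qnumSS; ring.
split=> //; rewrite qnumSS e3 mulnS add2n IH2 qnumSS [in RHS]qnumSS qnumSS; ring.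
Qed.

(** The coefficient of alpha_p is a square of a quantum number: this is the unit
    that separates the points of the orbit. *)
Lemma omega_explicit p i :
  omega p (2 * i) = rho p - qn i ^+ 2 *: alpha h p
                  - (qn i * qn i.+1) *: alpha h (~~ p) /\
  omega p (2 * i).+1 = rho p - qn i.+1 ^+ 2 *: alpha h p
                  - (qn i * qn i.+1) *: alpha h (~~ p).
Proof.
have ev j : letter p (2 * j).+1 = p by rewrite /letter /= oddM.
have od j : letter p (2 * j).+2 = ~~ p by rewrite /letter /= oddM.
elim: i => [|i [_ IH]].
  by rewrite muln0 omegaS /= qnum0 qnum1 expr0n expr1n mul0r !scale0r !subr0.
have e : omega p (2 * i.+1) = rho p - qn i.+1 ^+ 2 *: alpha h p
                  - (qn i.+1 * qn i.+2) *: alpha h (~~ p).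
  rewrite mulnS add2n omegaS IH (qnum_double i).2 od -addrA -opprD -scalerDl.
  by congr (_ - _ *: _); ring.
split=> //; rewrite omegaS e (qnum_double i.+1).1 ev [LHS]addrAC.
rewrite -(addrA (rho p)) -opprD -scalerDl.
by congr (_ - _ *: _ - _); ring.
Qed.

(** Modulo the W-invariant linear forms this is the form
    rho_s^2 + rho_t^2 - [2] rho_s rho_t of the Cartan matrix; the roots supply
    the terms in invariant linear forms that make it invariant under W. *)
Definition quad_inv : R :=
  linform (rho gen_t) * linform (alpha h gen_t)
  - linform (rho gen_t) * linform (rho gen_t)
  + linform (rho gen_s) * linform (alpha h gen_s)
  - linform (rho gen_s) * linform (rho gen_s)
  + t%:MP * (linform (rho gen_s) * linform (rho gen_t)).

Lemma srefl_rho u v : srefl u (rho v) = rho v - (v == u)%:R *: alpha h u.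
Proof. by rewrite /dual_refl rho_weights. Qed.

Lemma srefl_alpha u : srefl u (alpha h u) = - alpha h u.
Proof. exact: dual_refl_root (rz_diag h u). Qed.

Lemma srefl_off u : srefl u (alpha h (~~ u)) = alpha h (~~ u) + t *: alpha h u.
Proof. by rewrite /dual_refl pairing_off scaleNr opprK. Qed.

Lemma quad_inv_refl u : sym_refl (alpha h u) (alphav h u) quad_inv = quad_inv.
Proof.
rewrite /quad_inv; have off u' v : v = ~~ u' ->
    srefl u' (alpha h v) = alpha h v + t *: alpha h u'.
  by move=> ->; exact: srefl_off.
move: t off => c off.
rewrite !(rmorphD, rmorphN, rmorphM) /= sym_reflC.
rewrite !sym_refl_linform !srefl_rho; case: u.
  rewrite (srefl_alpha true) (off true false) //=.
  rewrite !(linformD, linformN, linformZ) mpolyC1 mpolyC0.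
  ring.
rewrite (srefl_alpha false) (off false true) //=.
rewrite !(linformD, linformN, linformZ) mpolyC1 mpolyC0.
ring.
Qed.

End Coordinates.

(** * The conic and the lines *)
Section Extended.
Variables (k : comUnitRingType) (n m : nat) (h : realization k n m).
Variable rho : bool -> 'cV[k]_n.
Hypothesis rho_weights :
  forall u v : bool, pairing (alphav h v) (rho u) = (u == v)%:R.
Local Notation R := {mpoly k[n]}.
Local Notation T := {mpoly k[n + 2]}.
Local Notation t := (rq h + (rq h)^-1).
Local Notation qn := (qnum (rq h)).
Local Notation srefl u := (dual_refl (alpha h u) (alphav h u)).

(** T is the polynomial ring on V^* and two more linear forms Y_s, Y_t: the
    column vectors of height n + 2 are the linear forms of T. *)
Definition ycol (u : bool) : 'cV[k]_2 := delta_mx (if u then ord0 else ord_max) 0.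
Definition lX (l : 'cV[k]_n) : 'cV[k]_(n + 2) := col_mx l 0.
Definition lY (u : bool) : 'cV[k]_(n + 2) := col_mx 0 (ycol u).
Definition X l : T := linform (lX l).
Definition Y u : T := linform (lY u).

Lemma lXD a b : lX (a + b) = lX a + lX b.
Proof. by rewrite /lX add_col_mx addr0. Qed.
Lemma lXZ c a : lX (c *: a) = c *: lX a.
Proof. by rewrite /lX scale_col_mx scaler0. Qed.
Lemma lXN a : lX (- a) = - lX a.
Proof. by rewrite -scaleN1r lXZ scaleN1r. Qed.
Lemma XD a b : X (a + b) = X a + X b.
Proof. by rewrite /X lXD linformD. Qed.
Lemma XN a : X (- a) = - X a.
Proof. by rewrite /X lXN linformN. Qed.
Lemma XZ c a : X (c *: a) = c%:MP * X a.
Proof. by rewrite /X lXZ linformZ. Qed.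

Lemma ycolP (y : 'cV[k]_2) : y = y ord0 0 *: ycol true + y ord_max 0 *: ycol false.
Proof.
apply/matrixP => i j; rewrite ord1 !mxE eqxx !andbT.
have /orP[/eqP->|/eqP->] : (i == ord0) || (i == ord_max) by case: i => [[|[|]]].
  by rewrite eqxx -val_eqE /= mulr1 mulr0 addr0.
by rewrite eqxx -val_eqE /= mulr1 mulr0 add0r.
Qed.

Lemma extP (c : 'cV[k]_(n + 2)) :
  exists l a b, c = lX l + a *: lY true + b *: lY false.
Proof.
exists (usubmx c), (dsubmx c ord0 0), (dsubmx c ord_max 0).
rewrite -{1}[c]vsubmxK {1}[dsubmx c]ycolP /lX /lY !scale_col_mx !add_col_mx.
by rewrite !scaler0 !addr0 !add0r.
Qed.

Definition yrow u : 'rV[k]_(n + 2) := row_mx 0 (ycol u)^T.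

Lemma ycol_ycol u v : (ycol u)^T *m ycol v = (u == v)%:R%:M.
Proof.
apply/matrixP => i j; rewrite !ord1 !mxE big_ord_recl big_ord1 !mxE.
by case: u; case: v; rewrite /= ?(mulr1, mulr0, addr0, add0r).
Qed.

Lemma yrow_X u l : pairing (yrow u) (lX l) = 0.
Proof. by rewrite /pairing mul_row_col mul0mx mulmx0 addr0 mxE. Qed.
Lemma yrow_Y u v : pairing (yrow u) (lY v) = (u == v)%:R.
Proof. by rewrite /pairing mul_row_col mul0mx add0r ycol_ycol !mxE eqxx mulr1n. Qed.

Definition mL : 'M[k]_(n + 2, n) := col_mx 1%:M 0.
(** l |-> l + sum of < alpha_u^vee, l > Y_u, so that rho_u goes to rho_u + Y_u
    and W-invariant forms to themselves. *)
Definition mR : 'M[k]_(n + 2, n) :=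
  mL + lY true *m alphav h true + lY false *m alphav h false.

Lemma mL_mul l : mL *m l = lX l.
Proof. by rewrite mul_col_mx mul1mx mul0mx. Qed.
Lemma mR_mul l : mR *m l = lX l + pairing (alphav h true) l *: lY true
                           + pairing (alphav h false) l *: lY false.
Proof.
have e u : lY u *m alphav h u *m l = pairing (alphav h u) l *: lY u.
  by rewrite -mulmxA [_ *m l]mx11_scalar mul_mx_scalar.
by rewrite !mulmxDl mL_mul !e.
Qed.

Lemma iL_linform l : symmap mL (linform l) = X l.
Proof. by rewrite symmap_linform mL_mul. Qed.
Lemma jR_linform l : symmap mR (linform l) =
  X l + (pairing (alphav h true) l)%:MP * Y true
  + (pairing (alphav h false) l)%:MP * Y false.
Proof. by rewrite symmap_linform mR_mul !linformD !linformZ. Qed.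

Lemma jR_rho u : symmap mR (linform (rho u)) = X (rho u) + Y u.
Proof.
rewrite jR_linform !rho_weights.
by case: u; rewrite /= mpolyC1 mpolyC0 mul1r mul0r addr0.
Qed.

Definition aT u : 'cV[k]_(n + 2) := lX (alpha h u).
(** The reflection u acts on the left copy of R and fixes the right one; as
    Y_u = x_u - rho_u, it must move Y_u to Y_u + alpha_u. *)
Definition avT u : 'rV[k]_(n + 2) := row_mx (alphav h u) (- (ycol u)^T).
Definition uT u : T -> T := sym_refl (aT u) (avT u).
HB.instance Definition _ u := GRing.RMorphism.copy (uT u) (sym_refl (aT u) (avT u)).

Lemma avT_X u l : pairing (avT u) (lX l) = pairing (alphav h u) l.
Proof. by rewrite /pairing mul_row_col mulmx0 addr0. Qed.
Lemma avT_Y u v : pairing (avT u) (lY v) = - (u == v)%:R.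
Proof.
by rewrite /pairing mul_row_col mulmx0 add0r mulNmx ycol_ycol !mxE eqxx mulr1n.
Qed.

Lemma uTC u c : uT u c%:MP = c%:MP.
Proof. exact: sym_reflC. Qed.
Lemma uT_X u l : uT u (X l) = X (srefl u l).
Proof.
by rewrite /uT sym_refl_linform /dual_refl avT_X -lXZ -lXN -lXD.
Qed.
Lemma uT_Y u v : uT u (Y v) = Y v + (u == v)%:R * X (alpha h u).
Proof.
rewrite /uT sym_refl_linform /dual_refl avT_Y scaleNr opprK linformD linformZ.
by case: (u == v); rewrite ?mpolyC1 ?mpolyC0.
Qed.

Lemma uT_L u f : uT u (symmap mL f) = symmap mL (sym_refl (alpha h u) (alphav h u) f).
Proof.
rewrite -[LHS]/((uT u \o symmap mL) f).
rewrite -[RHS]/((symmap mL \o sym_refl (alpha h u) (alphav h u)) f).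
apply: mpoly_rmorph_ext f => [c|l] /=; first by rewrite sym_reflC !symmapC uTC.
by rewrite sym_refl_linform !iL_linform uT_X.
Qed.

Lemma uT_R u f : uT u (symmap mR f) = symmap mR f.
Proof.
rewrite -[LHS]/((uT u \o symmap mR) f).
apply: mpoly_rmorph_ext f => [c|l] /=; first by rewrite !symmapC uTC.
rewrite jR_linform !rmorphD !rmorphM /= !uTC uT_X !uT_Y /dual_refl XD XN XZ.
by case: u; rewrite /=; ring.
Qed.

Definition quadric : T :=
  Y true * Y true + Y false * Y false - t%:MP * (Y true * Y false)
  + X (alpha h true) * Y true + X (alpha h false) * Y false.

Lemma quadricE : symmap mR (quad_inv h rho) - symmap mL (quad_inv h rho) = quadric.
Proof.
rewrite /quad_inv !(rmorphD, rmorphN, rmorphM) /= !symmapC !jR_rho !iL_linform.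
rewrite !jR_linform !rz_diag (pairing_off h true) (pairing_off h false).
rewrite /quadric mpolyCN mpolyCD /gen_s /gen_t.
have -> : 2%:MP = 2 :> T by rewrite mpolyCMn mpolyC1.
ring.
Qed.

Lemma uT_quadric u : uT u quadric = quadric.
Proof. by rewrite -quadricE rmorphB /= uT_R uT_L quad_inv_refl. Qed.

Lemma quadric_homog : quadric \is 2.-homog.
Proof.
have m2 (f g : T) : f \is 1.-homog -> g \is 1.-homog -> f * g \is 2.-homog.
  by move=> hf hg; exact: (@dhomogM _ _ _ 1 _ 1).
have hX l : X l \is 1.-homog by exact: linform_homog.
have hY u : Y u \is 1.-homog by exact: linform_homog.
rewrite /quadric mul_mpolyC.
by rewrite !rpredD ?rpredN ?dhomogZ ?m2.
Qed.

(** The line x_p = l. *)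
Definition lineT p (l : 'cV[k]_n) : T := X (rho p) + Y p - X l.
Lemma lineTE p l : lineT p l = linform (lX (rho p - l) + lY p).
Proof. by rewrite linformD -/(X _) XD XN /lineT addrAC. Qed.

Lemma lineT_rho p : lineT p (rho p) = Y p.
Proof. by rewrite /lineT addrAC subrr add0r. Qed.

Lemma lineT_homog p l : lineT p l \is 1.-homog.
Proof. by rewrite lineTE linform_homog. Qed.

Lemma uT_line u p l : uT u (lineT p l) = lineT p (srefl u l).
Proof. by rewrite /lineT -jR_rho rmorphB /= uT_R uT_X. Qed.

Definition regular_mod (q x : T) := forall f g, x * f = q * g -> exists z, f = q * z.

Lemma regular_modM q x y : regular_mod q x -> regular_mod q y -> regular_mod q (x * y).
Proof.
move=> hx hy f g; rewrite -mulrA => /hx[z /hy]; exact.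
Qed.

Lemma regular_modMl q x y : regular_mod q (x * y) -> regular_mod q y.
Proof. by move=> h1 f g e; apply: (h1 f (x * g)); rewrite -mulrA e mulrCA. Qed.
Lemma regular_modMr q x y : regular_mod q (x * y) -> regular_mod q x.
Proof. by rewrite mulrC; exact: regular_modMl. Qed.

(** Modulo the line, Y_p becomes an element of R and the conic a quadratic
    polynomial in the other Y with leading coefficient 1. *)
Lemma regular_line p l : regular_mod quadric (lineT p l).
Proof.
move=> f g; rewrite lineTE.
apply: (@regular_pair _ _ _ (yrow p)).
  by rewrite pairingD yrow_X yrow_Y eqxx add0r.
move=> x; apply: mpoly_mccoy => c; apply: (@meval_reg _ _ (yrow (~~ p))).
set a := lX _ + lY _.
have sE (l' : 'cV_(n + 2)) : (sym_refl a (yrow p) (linform l')).@[yrow (~~ p) 0] =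
    pairing (yrow (~~ p)) l' .
  rewrite sym_refl_linform meval_linform /dual_refl pairingB pairingZ pairingD.
  by rewrite yrow_X yrow_Y add0r; case: p {a}; rewrite /= mulr0 subr0.
rewrite /quadric !(rmorphD, rmorphN, rmorphM) /= !sE.
rewrite !yrow_X !yrow_Y.
by case: (p); rewrite /= !(mul0r, mulr0, mulr1, addr0, add0r, subr0) ?unitr1.
Qed.

Definition Fpoly p l : T := \prod_(j < l) lineT p (omega h rho p j).

Lemma FpolyS p l : Fpoly p l.+1 = Fpoly p l * lineT p (omega h rho p l).
Proof. by rewrite /Fpoly big_ord_recr. Qed.

Lemma Fpoly_homog p l : Fpoly p l \is l.-homog.
Proof.
elim: l => [|l IH]; first by rewrite /Fpoly big_ord0 dhomog1.
by rewrite FpolyS -[l.+1]addn1; apply: dhomogM => //; exact: lineT_homog.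
Qed.

Lemma regular_Fpoly p l : regular_mod quadric (Fpoly p l).
Proof.
elim: l => [|l IH]; last by rewrite FpolyS; apply: regular_modM => //; exact: regular_line.
by move=> f g; rewrite /Fpoly big_ord0 mul1r => ->; exists g.
Qed.

Lemma uT_omega_pair p j (u := letter p j.+1) :
  srefl u (omega h rho p j) = omega h rho p j.+1 /\
  srefl u (omega h rho p j.+1) = omega h rho p j.
Proof. by split=> //=; rewrite dual_reflK // rz_diag. Qed.

(** The reflection exchanges the lines of the orbit two by two, starting from the
    last two, and possibly fixes the first one. *)
Lemma uT_Fpoly p j : uT (letter p j) (Fpoly p j.+1) = Fpoly p j.+1.
Proof.
have [] : uT (letter p j) (Fpoly p j.+1) = Fpoly p j.+1 /\
          uT (letter p j.+1) (Fpoly p j.+2) = Fpoly p j.+2; last by [].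
elim: j => [|j [IH1 IH2]]; last split=> //.
  have e0 : uT (~~ p) (lineT p (rho p)) = lineT p (rho p).
    by rewrite uT_line srefl_rho //; case: p; rewrite /= scale0r subr0.
  rewrite !FpolyS /Fpoly big_ord0 mul1r.
  split; first exact: e0.
  by rewrite rmorphM /= !uT_line (uT_omega_pair p 0).1 (uT_omega_pair p 0).2 mulrC.
rewrite 2!FpolyS !rmorphM /= letterSS IH1 !uT_line -letterSS.
by rewrite (uT_omega_pair p j.+1).1 (uT_omega_pair p j.+1).2 mulrAC.
Qed.

End Extended.

(** * Maps out of cyclic bimodules *)
Section ActionT.
Variables (k : comUnitRingType) (n m : nat) (h : realization k n m).
Variable rho : bool -> 'cV[k]_n.
Hypothesis rho_weights :
  forall u v : bool, pairing (alphav h v) (rho u) = (u == v)%:R.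
Local Notation R := {mpoly k[n]}.
Local Notation Re := {mpoly {mpoly k[n]}[n]}.
Local Notation T := {mpoly k[n + 2]}.
Local Notation mL := (@mL k n).
Local Notation mR := (mR h).
Local Notation X := (@X k n).
Local Notation Y := (@Y k n).

Definition tauY (u : bool) : Re := inr_Re (linform (rho u)) - (linform (rho u))%:MP.
Definition tauX (i : 'I_(n + 2)) : Re :=
  match split i with
  | inl i => ('X_i)%:MP
  | inr j => tauY (j == ord0)
  end.
Definition constRe : k -> Re := @mpolyC n {mpoly k[n]} \o @mpolyC n k.
HB.instance Definition _ := GRing.RMorphism.on constRe.
(** A ring section of R (x) R -> T. *)
Definition tau : T -> Re := locked_with act_key (mmap constRe tauX).
Lemma tauE f : tau f = mmap constRe tauX f.
Proof. by rewrite /tau unlock. Qed.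
Lemma tau_zmod : zmod_morphism tau.
Proof. by move=> f g; rewrite !tauE raddfB. Qed.
Lemma tau_monoid : monoid_morphism tau.
Proof. by split=> [|f g]; rewrite !tauE ?rmorph1 ?rmorphM. Qed.
HB.instance Definition _ := GRing.isZmodMorphism.Build T Re tau tau_zmod.
HB.instance Definition _ := GRing.isMonoidMorphism.Build T Re tau tau_monoid.

Lemma tauC c : tau c%:MP = c%:MP%:MP.
Proof. by rewrite tauE mmapC. Qed.

Lemma tau_linform (c : 'cV[k]_(n + 2)) :
  tau (linform c) = \sum_i (c i 0)%:MP%:MP * tauX i.
Proof.
rewrite /linform raddf_sum; apply: eq_bigr => i _ /=.
by rewrite -mul_mpolyC rmorphM /= tauC tauE mmapX mmap1U.
Qed.

Lemma tau_X l : tau (X l) = (linform l)%:MP.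
Proof.
rewrite tau_linform big_split_ord /= [X in _ + X]big1 ?addr0; last first.
  by move=> i _; rewrite /lX col_mxEd mxE !raddf0 mul0r.
rewrite /linform raddf_sum; apply: eq_bigr => i _ /=.
rewrite /lX col_mxEu /tauX; case: split_ordP => j /eqP.
  by rewrite eq_shift => /eqP <-; rewrite -mul_mpolyC rmorphM.
by rewrite eq_shift.
Qed.

Lemma tau_Y u : tau (Y u) = tauY u.
Proof.
rewrite tau_linform big_split_ord /= [X in X + _]big1 ?add0r; last first.
  by move=> i _; rewrite /lY col_mxEu mxE !raddf0 mul0r.
rewrite big_ord_recl big_ord1 /lY !col_mxEd !mxE /tauX.
case: split_ordP => j /eqP; rewrite eq_shift // => /eqP <-.
case: split_ordP => j' /eqP; rewrite eq_shift // => /eqP <-.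
by case: u; rewrite /= !rmorph1 !rmorph0 mul1r mul0r ?addr0 ?add0r.
Qed.

(** The condition for the action of R (x) R on M to factor through T. *)
Definition central (M : grbimod k n) : Prop :=
  forall z, (forall u, pairing (alphav h u) z = 0) ->
  forall x : M, linform z *: x = ract x (linform z).

Section OnM.
Variable M : grbimod k n.
Definition actT (f : T) (x : M) : M := act (tau f) x.

Lemma actTDl f g x : actT (f + g) x = actT f x + actT g x.
Proof. by rewrite /actT rmorphD actDl. Qed.
Lemma actTM f g x : actT (f * g) x = actT f (actT g x).
Proof. by rewrite /actT rmorphM actM. Qed.
Lemma actTC c x : actT c%:MP x = c%:MP *: x.
Proof. by rewrite /actT tauC act_left. Qed.
Lemma actT_X l x : actT (X l) x = linform l *: x.
Proof. by rewrite /actT tau_X act_left. Qed.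
Lemma actT_Y u x : actT (Y u) x = ract x (linform (rho u)) - linform (rho u) *: x.
Proof. by rewrite /actT tau_Y /tauY actDl act_inr actN act_left. Qed.
Lemma actTN f x : actT (- f) x = - actT f x.
Proof. by rewrite /actT rmorphN actN. Qed.
Lemma actTB f g x : actT (f - g) x = actT f x - actT g x.
Proof. by rewrite actTDl actTN. Qed.
Lemma actT0r f : actT f 0 = 0.
Proof. exact: act0r. Qed.
Lemma actT0l x : actT 0 x = 0.
Proof. by rewrite /actT rmorph0 act0l. Qed.
Lemma actT1 x : actT 1 x = x.
Proof. by rewrite -mpolyC1 actTC mpolyC1 scale1r. Qed.

Lemma actT_L r x : actT (symmap mL r) x = r *: x.
Proof.
elim/mpoly_alg_ind: r x => [c|i|f g hf hg|f g hf hg] x.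
- by rewrite symmapC actTC.
- by rewrite -linform_delta iL_linform actT_X.
- by rewrite rmorphD actTDl hf hg scalerDl.
- by rewrite rmorphM actTM hg hf scalerA.
Qed.

Lemma actT_Rlin (cM : central M) l x : actT (symmap mR (linform l)) x = ract x (linform l).
Proof.
have [z zc lE] := weight_decomp rho_weights l.
pose c u := pairing (alphav h u) l; rewrite -/(c true) -/(c false) in lE.
rewrite jR_linform !actTDl !actTM !actTC !actT_X !actT_Y -/(c _) -/(c _).
have -> : linform l = linform z + linform (rho true) * (c true)%:MP
                      + linform (rho false) * (c false)%:MP.
  by rewrite {1}lE !linformD !linformZ ![_%:MP * _]mulrC.
rewrite !scalerDl !raDr.
rewrite !raM !raC (cM _ zc) !scalerBr !scalerA ![linform _ * _%:MP]mulrC.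
exact: swap_summands.
Qed.

Lemma actT_R (cM : central M) r x : actT (symmap mR r) x = ract x r.
Proof.
elim/mpoly_alg_ind: r x => [c|i|f g hf hg|f g hf hg] x.
- by rewrite symmapC actTC raC.
- by rewrite -linform_delta actT_Rlin.
- by rewrite rmorphD actTDl hf hg raDr.
- by rewrite rmorphM actTM hg hf -raM mulrC.
Qed.

Lemma pr_const d (c : k) (x : M) : pr d (c%:MP *: x) = c%:MP *: pr d x.
Proof.
have hc : c%:MP_[n] \is 0.-homog by rewrite -[c%:MP]mulr1 mul_mpolyC dhomogZ ?dhomog1.
by have := pr_l d x hc; rewrite muln0 addr0.
Qed.

Lemma actT_linform_pr d c x : pr (d + 2) (actT (linform c) x) = actT (linform c) (pr d x).
Proof.
have e l y : linform l *: pr d y = pr (d + 2) (linform l *: y).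
  by rewrite -(pr_l _ _ (linform_homog l)).
have e' l y : ract (pr d y) (linform l) = pr (d + 2) (ract y (linform l)).
  by rewrite -(pr_r _ _ (linform_homog l)).
have [l [a [b ->]]] := extP c; rewrite !linformD !linformZ -!/(Y _).
by rewrite !actTDl !actTM !actTC !actT_X !actT_Y !e !e' -!prB -!pr_const -!prD.
Qed.

(** Linear forms raise the degree by 2 by actT_linform_pr, hence so do products
    of them. *)
Lemma actT_pr d j (f : T) x : f \is j.-homog ->
  pr (d + (2 * j)%:Z) (actT f x) = actT f (pr d x).
Proof.
pose P (f : T) j := forall d x, pr (d + (2 * j)%:Z) (actT f x) = actT f (pr d x).
suff PX mu : P 'X_[mu] (mdeg mu).
  move=> hf; rewrite [f]mpolyE /actT !raddf_sum /= !act_suml pr_sumE.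
  rewrite !big_seq; apply: eq_bigr => mu hmu.
  have := PX mu d x; rewrite (dhomog_mf hf hmu) => e.
  rewrite -mul_mpolyC rmorphM /= !actM tauC !act_left.
  rewrite -/(actT 'X_[mu] x) -/(actT 'X_[mu] (pr d x)) -e.
  by rewrite pr_const.
rewrite mpolyXE_id mdegE.
apply: (big_ind2 P) => [e y|f1 j1 f2 j2 h1 h2 e y|i _].
- by rewrite muln0 addr0 !actT1.
- by rewrite !actTM -h2 -h1 mulnDr; congr pr; lia.
elim: (mu i) => [|e IH] d' y; first by rewrite expr0 muln0 addr0 !actT1.
rewrite exprS !actTM -IH -linform_delta -actT_linform_pr.
by congr pr; lia.
Qed.

Lemma actT_regpr a d (f : T) x : pr a x = x ->
  actT (regpr d f) x = pr (d + a) (actT f x).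
Proof.
move=> hx.
have hom (e : int) (g : T) : pr (e + a) (actT (regpr e g) x) = actT (regpr e g) x.
  case: e => [e|e]; last by rewrite /= actT0l pr0.
  rewrite /=; case: ifP => [_|oe]; first by rewrite actT0l pr0.
  rewrite -[in RHS]hx -(actT_pr _ _ (pihomogP mdeg e./2 g)).
  by congr pr; rewrite addrC; congr (_ + _); rewrite mul2n even_halfK // oe.
have [s us fE] := @pr_sum k (n + 2) (Rbim k (n + 2)) f.
have -> : actT f x = \sum_(e <- s) actT (regpr e f) x.
  by rewrite {1}fE /actT raddf_sum act_suml.
rewrite pr_sumE.
have ez e : pr (d + a) (actT (regpr e f) x) =
            if d == e then actT (regpr e f) x else 0.
  by rewrite -hom pr_pr (inj_eq (addIr a)).
rewrite (eq_bigr (fun e => if d == e then actT (regpr e f) x else 0)); last first.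
  by move=> e _; exact: ez.
have [ds|ds] := boolP (d \in s).
  rewrite (bigD1_seq d) //= eqxx big1 ?addr0 // => e; rewrite eq_sym.
  by move=> /negPf ->.
rewrite big_seq big1 => [|e es]; last first.
  by case: eqP => // de; move: ds; rewrite de es.
have -> : regpr d f = 0; last by rewrite actT0l.
exact: (@dec_out _ (@pr k (n + 2) (Rbim k (n + 2))) (@pr_zmod _ _ _)
  (@pr_pr _ _ _) s f us fE d ds).
Qed.

End OnM.

Lemma dhom_actT a (M M' : grbimod k n) (F : M -> M') :
  dhom a F -> forall f x, F (actT f x) = actT f (F x).
Proof. by move=> hF f x; exact: dhom_act hF _ _. Qed.

Local Notation homelT := (homel k (n + 2)).
Local Notation quo g1 g2 := (quo mL mR g1 g2).

Lemma actT_cls (g1 g2 : homelT) f x :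
  actT f (cls g1 g2 x : quo g1 g2) = cls g1 g2 (f * x).
Proof.
pose C y := cls g1 g2 y : quo g1 g2.
have CD a b : C (a + b) = C a + C b by exact: (raddfD (cls g1 g2)).
have CB a b : C (a - b) = C a - C b by exact: (raddfB (cls g1 g2)).
have lin c y : actT (linform c) (C y) = C (linform c * y).
  have [l [a [b ->]]] := extP c; rewrite !linformD !linformZ -!/(Y _).
  have hY u : actT (Y u) (C y) = C (Y u * y).
    rewrite actT_Y [ract _ _]cls_ra [_ *: _]clsZ -CB -mulrBl.
    by rewrite (jR_rho rho_weights) iL_linform addrAC subrr add0r.
  have hC c0 z : actT c0%:MP (C z) = C (c0%:MP * z).
    by rewrite actTC [_ *: _]clsZ symmapC.
  rewrite !actTDl !actTM !hY !hC -[linform (lX l)]iL_linform actT_L [_ *: _]clsZ.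
  by rewrite -!CD; congr C; rewrite !mulrDl !mulrA.
elim/mpoly_alg_ind: f x => [c|i|f g hf hg|f g hf hg] x.
- by rewrite actTC clsZ symmapC.
- by rewrite -linform_delta -/(C x) lin.
- by rewrite actTDl hf hg -CD mulrDl.
- by rewrite actTM hg hf mulrA.
Qed.

Lemma cyclic_quo (g1 g2 : homelT) (M : grbimod k n) a b (f g : quo g1 g2 -> M) :
  dhom a f -> dhom b g -> f (cls g1 g2 1) = g (cls g1 g2 1) -> f =1 g.
Proof.
move=> hf hg e; elim/cls_ind => x; rewrite -[x]mulr1 -actT_cls.
by rewrite (dhom_actT hf) (dhom_actT hg) e.
Qed.

(** The universal property of T / (g1, g2): a homogeneous element killed by g1
    and g2 is the image of 1. *)
Lemma quo_hom (g1 g2 : homelT) (M : grbimod k n) a (c : M) :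
  central M -> pr a c = c -> actT g1 c = 0 -> actT g2 c = 0 ->
  exists2 f : quo g1 g2 -> M, dhom a f & f (cls g1 g2 1) = c.
Proof.
move=> cM hc h1 h2.
have fB : zmod_morphism (fun f => actT f c) by move=> x y; rewrite actTB.
have f0 y : y \in idl g1 g2 -> actT y c = 0.
  by move=> /idlP[u [v ->]]; rewrite actTDl !actTM h1 h2 !actT0r addr0.
exists (lift_quo (fun f => actT f c)).
  apply: dhom_lift_quo => // [r x|r x|d x].
  - by rewrite actTM actT_L.
  - by rewrite actTM actT_R.
  - exact: actT_regpr.
by rewrite lift_quoE // actT1.
Qed.

End ActionT.

(** * Tensoring with a Soergel generator *)
Section Induction.
Variables (k : comUnitRingType) (n : nat) (a : 'cV[k]_n) (av : 'rV[k]_n).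
Local Notation R := {mpoly k[n]}.
Local Notation Re := {mpoly {mpoly k[n]}[n]}.
Local Notation RR := (Rbim k n).
Local Notation inv := (gs_inv a av).
Local Notation B := (shift (tensor inv RR RR) 1).
Local Notation ind M := (tensor (gs_full k n) B M).

(** B_u (x)_R M is R (x)_(R^u) M(1), and iota is m |-> 1 (x) m. *)
Definition iota (M : grbimod k n) : M -> ind M :=
  locked_with act_key
    (fun x => pure (gs_full k n) (pure inv (1 : RR) (1 : RR) : B) x).
Lemma iotaE (M : grbimod k n) (x : M) :
  iota x = pure (gs_full k n) (pure inv (1 : RR) (1 : RR) : B) x.
Proof. by rewrite /iota unlock. Qed.

Section M.
Variable M : grbimod k n.
Implicit Types (x y : M).

Lemma iotaD x y : iota (x + y) = iota x + iota y.
Proof. by rewrite !iotaE; exact: pureDr. Qed.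
Lemma iota0 : iota (0 : M) = 0.
Proof. by rewrite iotaE; exact: pure0r. Qed.
Lemma iotaN x : iota (- x) = - iota x.
Proof. by apply/eqP; rewrite -addr_eq0 -iotaD addNr iota0. Qed.

Lemma iota_ra x r : iota (ract x r) = ract (iota x) r.
Proof. by rewrite !iotaE [RHS]tens_ra_pure. Qed.

Lemma iota_left r s x : pure (gs_full k n) (pure inv (r : RR) (s : RR) : B) x
   = r *: iota (s *: x).
Proof.
rewrite iotaE tens_scaleE tens_scale_pure -pureA //.
congr (pure _ _ x); rewrite [r *: _]tens_scaleE tens_scale_pure.
rewrite -[ract _ _]/(tens_ra (pure inv (r *: (1 : RR)) (1 : RR)) s) tens_ra_pure.
by rewrite /GRing.scale /= mulr1 mul1r.
Qed.

Lemma iota_inv r x : sym_refl a av r = r -> iota (r *: x) = r *: iota x.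
Proof.
move=> hr; have ri : r \in inv by apply/eqP.
have e1 := iota_left 1 r x; have e2 := iota_left r 1 x.
rewrite scale1r in e1; rewrite scale1r in e2; rewrite -e1 -e2.
congr (pure _ _ x); have := pureA (1 : RR) (1 : RR) ri.
by rewrite /GRing.scale /= mulr1 mul1r => <-.
Qed.

Lemma iota_pr d x : iota (pr d x) = pr (d - 1) (iota x).
Proof.
have h0 : pr 0 (1 : RR) = 1 by rewrite /= pihomog_dE // dhomog1.
have h1 : pr (-1) (pure inv (1 : RR) (1 : RR) : B) = pure inv (1 : RR) (1 : RR).
  rewrite -[LHS]/(tens_pr (-1 + 1) (pure inv (1 : RR) (1 : RR))).
  by rewrite (tens_pr_hom _ _ h0 h0).
have hom e y : pr e y = y -> pr (d - 1) (iota y) = iota (pr d y).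
  move=> he; have -> : iota (pr d y) = if d == e then iota y else 0.
    by rewrite -{1}he pr_pr; case: eqP => _; rewrite ?he ?iota0.
  rewrite iotaE [LHS](tens_pr_hom _ _ h1 he).
  by rewrite addrC (inj_eq (addrI _)).
have [s _ xs] := pr_sum x; rewrite {2}xs.
have isum (F : int -> M) : iota (\sum_(i <- s) F i) = \sum_(i <- s) iota (F i).
  by apply: (big_morph (@iota M)) => [y z|]; [exact: iotaD|exact: iota0].
rewrite isum pr_sumE {1}xs pr_sumE isum; apply: eq_bigr => e _.
by rewrite (hom e) // pr_pr eqxx.
Qed.

Lemma ind_ind (P : ind M -> Prop) :
  P 0 -> (forall x y : ind M, P x -> P y -> P (x - y)) ->
  (forall r x, P (r *: iota x)) -> forall x : ind M, P x.
Proof.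
move=> P0 PB Pi; elim/tens_ind => // b x.
elim/tens_ind: b => [|b c hb hc|r s]; last by rewrite iota_left.
  by rewrite pure0l.
have -> : pure (gs_full k n) (b - c : B) x =
    pure (gs_full k n) (b : B) x - pure (gs_full k n) (c : B) x.
  by apply/eqP; rewrite eq_sym subr_eq -pureDl subrK.
exact: PB.
Qed.

Section Lift.
Variables (N : grbimod k n) (d : M -> N) (c : int).
Hypotheses (dB : zmod_morphism d)
  (dinv : forall r x, sym_refl a av r = r -> d (r *: x) = r *: d x)
  (dR : forall x r, d (ract x r) = ract (d x) r)
  (dpr : forall j x, d (pr j x) = pr (j + c) (d x)).

Let d0 : d 0 = 0. Proof. by have := dB 0 0; rewrite !subrr. Qed.
Let dD x y : d (x + y) = d x + d y.
Proof. by rewrite -{1}[y]opprK dB -[- y]sub0r dB d0 sub0r opprK. Qed.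

Definition ind_bil (b : B) (x : M) : N :=
  tens_lift (fun (r s : RR) => (r : R) *: d ((s : R) *: x)) b.

Lemma ind_bil_pure r s x :
  ind_bil (pure inv (r : RR) (s : RR)) x = r *: d (s *: x).
Proof.
apply: (tens_lift_pure (b := fun (r s : RR) => (r : R) *: d ((s : R) *: x))).
- by move=> *; rewrite scalerDl.
- by move=> *; rewrite scalerDl dD scalerDr.
- by move=> u v w /eqP hv; rewrite -scalerA -dinv // scalerA.
Qed.

Lemma ind_bilB b b' x : ind_bil (b - b') x = ind_bil b x - ind_bil b' x.
Proof.
apply: (tens_liftB (b := fun (r s : RR) => (r : R) *: d ((s : R) *: x))).
- by move=> *; rewrite scalerDl.
- by move=> *; rewrite scalerDl dD scalerDr.
- by move=> u v w /eqP hv; rewrite -scalerA -dinv // scalerA.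
Qed.

Lemma ind_bil0 x : ind_bil 0 x = 0.
Proof. by have := ind_bilB 0 0 x; rewrite !subrr. Qed.
Lemma ind_bilD b b' x : ind_bil (b + b') x = ind_bil b x + ind_bil b' x.
Proof. by rewrite -{1}[b']opprK ind_bilB -[- b']sub0r ind_bilB ind_bil0 sub0r opprK. Qed.

Lemma ind_lift_zmod : exists2 F : ind M -> N,
  zmod_morphism F & forall r x, F (r *: iota x) = r *: d x.
Proof.
have bDr b x y : ind_bil b (x + y) = ind_bil b x + ind_bil b y.
  elim/tens_ind: b => [|b b' hb hb'|r s]; first by rewrite !ind_bil0 addr0.
    by rewrite !ind_bilB hb hb' opprD addrACA.
  by rewrite !ind_bil_pure scalerDr dD scalerDr.
have bA b r x : r \in gs_full k n -> ind_bil (ract b r) x = ind_bil b (r *: x).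
  move=> _; elim/tens_ind: b => [|b b' hb hb'|u v].
  - by rewrite ra0l !ind_bil0.
  - by rewrite raB !ind_bilB hb hb'.
  - rewrite -[ract _ _]/(tens_ra (pure inv (u : RR) (v : RR)) r) tens_ra_pure.
    by rewrite !ind_bil_pure scalerA.
exists (tens_lift ind_bil); first exact: (tens_liftB ind_bilD bDr bA).
move=> r x; rewrite -{1}[x]scale1r -iota_left.
by rewrite (tens_lift_pure ind_bilD bDr bA) ind_bil_pure scale1r.
Qed.

(** The universal property of R (x)_(R^u) M; the degree grows by 1 since 1 (x) 1
    has degree - 1 in B_u. *)
Lemma ind_lift : exists2 F : ind M -> N, dhom (c + 1) F & forall x, F (iota x) = d x.
Proof.
have [F FB Fi] := ind_lift_zmod.
have F0 : F 0 = 0 by have := FB 0 0; rewrite !subrr.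
exists F; last by move=> x; rewrite -[iota x]scale1r Fi scale1r.
split=> // [s|x r|j].
- elim/ind_ind => [|x y hx hy|r x]; first by rewrite scaler0 F0 scaler0.
    by rewrite scalerBr !FB hx hy scalerBr.
  rewrite scalerA; apply: (etrans (Fi (s * r) x)).
  by rewrite -scalerA -Fi.
- elim/ind_ind: x => [|x y hx hy|s x]; first by rewrite ra0l F0 ra0l.
    by rewrite raB !FB hx hy raB.
  rewrite -lra -iota_ra; apply: (etrans (Fi s _)).
  by rewrite dR lra -Fi.
elim/ind_ind => [|x y hx hy|s x]; first by rewrite pr0 F0 pr0.
  by rewrite prB !FB hx hy prB.
have FD u v : F (u + v) = F u + F v.
  by rewrite -{1}[v]opprK FB -[- v]sub0r FB F0 sub0r opprK.
rewrite {1 2}(pihomog_partitionE (leqnn (@mmeasure _ _ mdeg s))).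
rewrite scaler_suml pr_sumE !(big_morph F FD F0) pr_sumE; apply: eq_bigr => e _.
have hs := pihomogP mdeg e s; move: (pihomog _ _ _) hs => r hr.
rewrite -[j](subrK (2 * e)%:Z) (pr_l _ _ hr) Fi.
have -> : j - (2 * e)%:Z = j - (2 * e)%:Z + 1 - 1 by rewrite addrK.
rewrite -iota_pr Fi dpr -(pr_l _ _ hr).
by congr pr; lia.
Qed.
End Lift.
End M.
End Induction.

(** * Bott-Samelson bimodules and their cyclic summand *)
Section Slide.
Variables (k : comUnitRingType) (n : nat) (a : 'cV[k]_n) (av : 'rV[k]_n).
Local Notation R := {mpoly k[n]}.
Local Notation Re := {mpoly {mpoly k[n]}[n]}.

(** Elements of R^u (x) R act on R (x)_(R^u) M through M.  The predicate speaks
    of all M at once to make it closed under products. *)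
Definition slides (f : Re) : Prop := forall (M : grbimod k n) (x : M),
  act f (iota a av x) = iota a av (act f x).

Lemma slidesD f g : slides f -> slides g -> slides (f + g).
Proof. by move=> hf hg M x; rewrite !actDl hf hg iotaD. Qed.
Lemma slidesN f : slides f -> slides (- f).
Proof. by move=> hf M x; rewrite !actN hf iotaN. Qed.
Lemma slidesM f g : slides f -> slides g -> slides (f * g).
Proof. by move=> hf hg M x; rewrite !actM hg hf. Qed.
Lemma slides1 : slides 1.
Proof. by move=> M x; rewrite !act1. Qed.
Lemma slides_inr l : slides (inr_Re l).
Proof. by move=> M x; rewrite !act_inr iota_ra. Qed.
Lemma slides_inv r : sym_refl a av r = r -> slides r%:MP.
Proof. by move=> hr M x; rewrite !act_left iota_inv. Qed.

Definition theta (l r : R) : Re := inr_Re l - r%:MP.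

Lemma slides_theta l r : sym_refl a av r = r -> slides (theta l r).
Proof.
by move=> hr; apply: slidesD; [exact: slides_inr|apply/slidesN/slides_inv].
Qed.

(** Expanded in powers of l, the coefficients are symmetric in r and its mirror
    image s, hence invariant under the reflection. *)
Lemma slides_theta2 l r s : sym_refl a av r = s -> sym_refl a av s = r ->
  slides (theta l r * theta l s).
Proof.
move=> hr hs.
have -> : theta l r * theta l s =
    inr_Re l * inr_Re l - (r + s)%:MP * inr_Re l + (r * s)%:MP.
  by rewrite /theta mpolyCD mpolyCM; ring.
apply: slidesD; last by apply: slides_inv; rewrite rmorphM /= hr hs mulrC.
apply: slidesD; first by apply: slidesM; exact: slides_inr.
apply: slidesN; apply: slidesM; last exact: slides_inr.
by apply: slides_inv; rewrite rmorphD /= hr hs addrC.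
Qed.

End Slide.

Section BottSamelson.
Variables (k : comUnitRingType) (n m : nat) (h : realization k n m).
Variable rho : bool -> 'cV[k]_n.
Hypothesis rho_weights :
  forall u v : bool, pairing (alphav h v) (rho u) = (u == v)%:R.
Hypothesis alpha_free : forall a b : k,
  a *: alpha h gen_s + b *: alpha h gen_t = 0 -> a = 0 /\ b = 0.
Hypothesis qnum_unit :
  forall j : nat, (1 <= j < m)%N -> qnum (rq h) j \is a GRing.unit.
Local Notation R := {mpoly k[n]}.
Local Notation T := {mpoly k[n + 2]}.
Local Notation RR := (Rbim k n).
Local Notation qn := (qnum (rq h)).
Local Notation mL := (@mL k n).
Local Notation mR := (mR h).
Local Notation X := (@X k n).
Local Notation Y := (@Y k n).
Local Notation sref u := (sym_refl (alpha h u) (alphav h u)).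
Local Notation iota u := (iota (alpha h u) (alphav h u)).

Lemma alpha_reg u (c : k) : c *: alpha h u = 0 -> c = 0.
Proof.
move=> e; case: u e => e.
  by have [] := @alpha_free c 0; rewrite ?e ?scale0r ?addr0.
by have [] := @alpha_free 0 c; rewrite ?e ?scale0r ?addr0.
Qed.

Lemma X_alpha_reg u f : X (alpha h u) * f = 0 -> f = 0.
Proof.
apply: mpoly_mccoy => c; rewrite -mul_mpolyC -XZ => /linform_eq0 e.
apply: (alpha_reg (u := u)); have := congr1 usubmx e.
by rewrite /lX col_mxKu => ->; apply/matrixP => i j; rewrite !mxE.
Qed.

Definition demazure u (f : T) : T := sval (cid (sym_refl_sub (aT h u) (avT h u) f)).

Lemma demazureP u f : f - uT h u f = X (alpha h u) * demazure u f.
Proof. by rewrite /demazure; case: cid. Qed.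

Lemma demazure_unique u f g : f - uT h u f = X (alpha h u) * g -> demazure u f = g.
Proof.
move=> e; apply/eqP; rewrite -subr_eq0; apply/eqP/(@X_alpha_reg u).
by rewrite mulrBr -demazureP e subrr.
Qed.

Lemma demazureB u f g : demazure u (f - g) = demazure u f - demazure u g.
Proof.
apply: demazure_unique; rewrite mulrBr -!demazureP rmorphB /=.
by rewrite !opprD opprK addrACA.
Qed.

Lemma demazureM u f g : uT h u f = f -> demazure u (f * g) = f * demazure u g.
Proof.
move=> hf; apply: demazure_unique.
by rewrite rmorphM /= hf -mulrBr demazureP mulrCA.
Qed.

Lemma uT_regpr u d f : uT h u (regpr d f) = regpr d (uT h u f).
Proof.
case: d => [d|d] /=; last by rewrite rmorph0.
by case: ifP => _; rewrite ?rmorph0 // /uT sym_refl_pihomog.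
Qed.

Lemma demazure_regpr u d f : demazure u (regpr (d + 2) f) = regpr d (demazure u f).
Proof.
apply: demazure_unique; rewrite uT_regpr -regprB demazureP.
have hX : X (alpha h u) \is 1.-homog by exact: linform_homog.
exact: (@regpr_mul _ _ d 1 _ _ hX).
Qed.

Definition quadric_homel : homel k (n + 2) := Homel (quadric_homog h).
Definition F_homel p l : homel k (n + 2) := Homel (Fpoly_homog h rho p l).
Definition modelB p l : grbimod k n := quo mL mR quadric_homel (F_homel p l).
Definition modelB_cls p l (f : T) : modelB p l := cls quadric_homel (F_homel p l) f.

Lemma modelB_ind p l (P : modelB p l -> Prop) :
  (forall f, P (modelB_cls p l f)) -> forall x, P x.
Proof. exact: cls_ind. Qed.
Lemma modelB_clsB p l f g : modelB_cls p l (f - g) = modelB_cls p l f - modelB_cls p l g.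
Proof. exact: (raddfB (cls quadric_homel (F_homel p l))). Qed.
Lemma modelB_cls0 p l f : f \in idl (quadric h) (Fpoly h rho p l) -> modelB_cls p l f = 0.
Proof. by move=> hf; apply/cls0. Qed.

(** Invariant polynomials pass through every tensor sign. *)
Lemma BS_invariant e f : (forall u, sref u f = f) -> forall x : BS h e, f *: x = ract x f.
Proof.
move=> hf; elim: e => [|u e IH] x; first by rewrite /= mulrC.
elim/ind_ind: x => [|x y hx hy|r x]; first by rewrite scaler0 ra0l.
  by rewrite scalerBr raB hx hy.
have e1 : f *: iota u x = ract (iota u x) f by rewrite -iota_inv // IH iota_ra.
by rewrite scalerA mulrC -scalerA e1 lra.
Qed.

Lemma BS_central e : central h (BS h e).
Proof.
move=> z hz; apply: BS_invariant => u.
by rewrite sym_refl_linform /dual_refl hz scale0r subr0.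
Qed.

Lemma quadric_BS e (x : BS h e) : actT rho (quadric h) x = 0.
Proof.
rewrite -(quadricE rho_weights) actTB (actT_R rho_weights (@BS_central e)) actT_L.
by rewrite (BS_invariant (quad_inv_refl rho_weights)) subrr.
Qed.

Fixpoint BS_gen (e : seq bool) : BS h e :=
  if e is u :: e' then iota u (BS_gen e') else (1 : RR).

Lemma BS_gen_pr e : pr (- (size e)%:Z) (BS_gen e) = BS_gen e.
Proof.
elim: e => [|u e IH]; first by rewrite /= pihomog_dE // dhomog1.
have e1 : pr (- (size e)%:Z - 1) (iota u (BS_gen e)) = iota u (BS_gen e).
  by rewrite -iota_pr IH.
have -> : - (size (u :: e))%:Z = - (size e)%:Z - 1 by rewrite /=; lia.
exact: e1.
Qed.

Fixpoint alt_word (p : bool) (l : nat) : seq bool :=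
  if l is l'.+1 then letter p l' :: alt_word p l' else [::].

Lemma size_alt_word p l : size (alt_word p l) = l.
Proof. by elim: l => //= l ->. Qed.

Lemma tau_line p l : tau rho (lineT rho p l) = theta (linform (rho p)) (linform l).
Proof. by rewrite /lineT rmorphB rmorphD /= !tau_X tau_Y /tauY [X in X - _]addrC subrK. Qed.

(** As in uT_Fpoly, the factors pair up into mirror images. *)
Lemma slides_Fpoly p j :
  slides (alpha h (letter p j)) (alphav h (letter p j)) (tau rho (Fpoly h rho p j.+1)).
Proof.
set S := fun j f => slides (alpha h (letter p j)) (alphav h (letter p j)) (tau rho f).
have pair i : S i.+1 (lineT rho p (omega h rho p i) * lineT rho p (omega h rho p i.+1)).
  rewrite /S rmorphM /= !tau_line.
  by apply: slides_theta2; rewrite sym_refl_linform; congr linform;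
     have [] := uT_omega_pair h rho p i.
have [] : S j (Fpoly h rho p j.+1) /\ S j.+1 (Fpoly h rho p j.+2); last by [].
elim: j => [|j [IH1 IH2]]; last split=> //.
  rewrite !FpolyS /Fpoly big_ord0 mul1r; split; last exact: pair.
  rewrite /S tau_line; apply: slides_theta; rewrite sym_refl_linform srefl_rho //.
  by rewrite /letter /=; case: p {S pair}; rewrite /= scale0r subr0.
rewrite 2!FpolyS -mulrA /S rmorphM; apply: slidesM; last exact: pair.
by have := IH1; rewrite /S letterSS.
Qed.

(** All lines but the last kill the shorter generator, and the whole product
    passes through iota. *)
Lemma Fpoly_BS_gen p l : actT rho (Fpoly h rho p l.+1) (BS_gen (alt_word p l.+1)) = 0.
Proof.
elim: l => [|l IH].
  rewrite /= [LHS]slides_Fpoly -[RHS](iota0 _ _ RR); congr (iota _ _).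
  rewrite /Fpoly big_ord1 /= -[LHS]/(actT _ _ _) lineT_rho actT_Y /=.
  by rewrite [_ *: _]mulrC subrr.
rewrite -[BS_gen _]/(iota (letter p l.+1) (BS_gen (alt_word p l.+1))).
rewrite [LHS]slides_Fpoly -[act _ _]/(actT _ _ _) FpolyS mulrC actTM IH actT0r.
exact: iota0.
Qed.

Lemma phi_exists p l : exists2 phi : modelB p l.+1 -> BS h (alt_word p l.+1),
  dhom (- l.+1%:Z) phi & phi (modelB_cls p l.+1 1) = BS_gen (alt_word p l.+1).
Proof.
apply: (quo_hom rho_weights).
- exact: BS_central.
- by have := BS_gen_pr (alt_word p l.+1); rewrite size_alt_word.
- exact: quadric_BS.
- exact: Fpoly_BS_gen.
Qed.

(** Modulo Y_p the conic becomes Y_v (Y_v + alpha_v) with v = ~~ p, and both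
    sides of f(x) = f + Y_v d_v(f) are multiplicative in f modulo it. *)
Lemma left_right_mod p f : exists g, f - sref (~~ p) f = linform (alpha h (~~ p)) * g /\
  symmap mR f - symmap mL f - Y (~~ p) * symmap mL g \in idl (quadric h) (Y p).
Proof.
set v := ~~ p.
have qY : Y v * Y v + X (alpha h v) * Y v \in idl (quadric h) (Y p).
  have -> : Y v * Y v + X (alpha h v) * Y v = 1 * quadric h
     + (- Y p + (rq h + (rq h)^-1)%:MP * Y v - X (alpha h p)) * Y p.
    by rewrite /quadric /v; case: (p) => /=; ring.
  by rewrite rpredD ?idl_gen1 ?idl_gen2.
elim/mpoly_alg_ind: f => [c|i|f g [x [hx Hx]] [y [hy Hy]]|f g [x [hx Hx]] [y [hy Hy]]].
- exists 0; rewrite sym_reflC !symmapC rmorph0 !mulr0 !subrr; split=> //.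
  exact: rpred0.
- exists (pairing (alphav h v) (delta_mx i 0))%:MP; rewrite -linform_delta; split.
    rewrite sym_refl_linform /dual_refl linformD linformN linformZ opprD opprK.
    by rewrite addrA subrr add0r mulrC.
  rewrite jR_linform iL_linform symmapC.
  set a := (pairing (alphav h v) _)%:MP.
  have -> : X (delta_mx i 0) + (pairing (alphav h true) (delta_mx i 0))%:MP * Y true
     + (pairing (alphav h false) (delta_mx i 0))%:MP * Y false - X (delta_mx i 0)
     - Y v * a = (pairing (alphav h p) (delta_mx i 0))%:MP * Y p.
    by rewrite /a /v; case: (p) => /=; ring.
  exact: idl_gen2.
- exists (x + y); rewrite !rmorphD; split.
    by rewrite mulrDr -hx -hy opprD addrACA.
  apply: idl_eq (rpredD Hx Hy) _; ring.
- exists (x * g + f * y - linform (alpha h v) * x * y); split.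
    have -> : sref v (f * g) = (f - linform (alpha h v) * x) * (g - linform (alpha h v) * y).
      by rewrite rmorphM /= -hx -hy !opprB !(addrC f) !(addrC g) !subrK.
    ring.
  rewrite !(rmorphB, rmorphD, rmorphM) /= iL_linform.
  set A := symmap mR f in Hx *; set B := symmap mR g in Hy *.
  set C := symmap mL f in Hx *; set D := symmap mL g in Hy *.
  set E := symmap mL x in Hx *; set G := symmap mL y in Hy *.
  apply: idl_eq (rpredD (rpredD (idlM B Hx) (idlM (C + Y v * E) Hy))
                        (idlM (E * G) qY)) _.
  ring.
Qed.

Lemma left_right_inv p f : sref (~~ p) f = f ->
  symmap mR f - symmap mL f \in idl (quadric h) (Y p).
Proof.
move=> hf; have [g [hg]] := left_right_mod p f.
have -> : g = 0; last by rewrite rmorph0 mulr0 subr0.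
move: hg; rewrite hf subrr => /esym; apply: mpoly_mccoy => c.
by rewrite -linearZ => /linform_eq0; exact: alpha_reg.
Qed.

Lemma psi_base p : exists2 psi : BS h (alt_word p 1) -> modelB p 1,
  dhom 1 psi & psi (BS_gen (alt_word p 1)) = modelB_cls p 1 1.
Proof.
pose d (r : RR) : modelB p 1 := modelB_cls p 1 (symmap mR r).
have [F hF Fi] : exists2 F, dhom (0 + 1) F &
    forall x : RR, F (iota (~~ p) x) = d x.
  apply: ind_lift => [x y|r x hr|x r|j x].
  - by rewrite /d rmorphB modelB_clsB.
  - rewrite /d [_ *: modelB_cls _ _ _]clsZ; apply/clsP.
    rewrite rmorphM -mulrBl mulrC; apply: idlM.
    by rewrite /= /Fpoly big_ord1 /= lineT_rho; apply: left_right_inv.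
  - by rewrite /d [ract (modelB_cls _ _ _) _]cls_ra rmorphM mulrC.
  - rewrite /d addr0 [pr _ (modelB_cls _ _ _)]cls_pr; congr (cls _ _ _).
    case: j => [j|j] /=; last by rewrite rmorph0.
    by case: ifP => _; rewrite ?rmorph0 // symmap_pihomog.
by exists F => //=; rewrite Fi /d rmorph1.
Qed.

(** With g the equation of the new line divided by [l + 1], the map
    f |-> d_u (g f) sends the old ideal into the new one, because g times the old
    F is a multiple of the new F, which is u-invariant.  It sends 1 to
    d_u (g) = 1. *)
Lemma psi_step p l (M : grbimod k n) (psi : M -> modelB p l.+1) :
  (l.+1 < m)%N -> dhom l.+1%:Z psi ->
  exists2 psi' : tensorR (Bgen h (letter p l.+1)) M -> modelB p l.+2,
  dhom l.+2%:Z psi' &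
  forall x, psi x = modelB_cls p l.+1 1 -> psi' (iota (letter p l.+1) x) = modelB_cls p l.+2 1.
Proof.
set u := letter p l.+1 => lm hpsi.
pose c := (qn l.+1)^-1.
pose g : T := c%:MP * lineT rho p (omega h rho p l.+1).
have hu : uT h u (Fpoly h rho p l.+2) = Fpoly h rho p l.+2 by exact: uT_Fpoly.
have g1 : demazure u g = 1.
  rewrite /g demazureM ?uTC // (_ : demazure u _ = (qn l.+1)%:MP).
    by rewrite -mpolyCM mulVr ?mpolyC1 // qnum_unit.
  apply: demazure_unique; rewrite (uT_line rho_weights) /lineT /dual_refl.
  by rewrite (pairing_omega rho_weights p l.+1).2 scaleNr opprK XD XZ; ring.
have gh : g \is 1.-homog by rewrite /g mul_mpolyC dhomogZ // lineT_homog.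
pose D0 (f : T) : modelB p l.+2 := modelB_cls p l.+2 (demazure u (g * f)).
have D0B : zmod_morphism D0 by move=> a b; rewrite /D0 mulrBr demazureB modelB_clsB.
have D00 y : y \in idl (quadric h) (Fpoly h rho p l.+1) -> D0 y = 0.
  move=> /idlP[a [b ->]]; apply: modelB_cls0.
  have -> : g * (a * quadric h + b * Fpoly h rho p l.+1) =
      quadric h * (g * a) - Fpoly h rho p l.+2 * (- c%:MP * b).
    by rewrite [Fpoly h rho p l.+2]FpolyS /g; ring.
  rewrite demazureB (demazureM _ (uT_quadric rho_weights u)) (demazureM _ hu).
  apply: rpredB; rewrite mulrC.
    exact: idl_gen1.
  exact: idl_gen2.
pose D : modelB p l.+1 -> modelB p l.+2 := lift_quo D0.
have DE f : D (modelB_cls p l.+1 f) = D0 f by exact: lift_quoE.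
have [F hF Fi] : exists2 F, dhom (l.+1%:Z + 1) F &
    forall x : M, F (iota u x) = D (psi x).
  apply: ind_lift => [x y|r x hr|x r|j x].
  - rewrite (dhomB hpsi); elim/modelB_ind: (psi x) => a; elim/modelB_ind: (psi y) => b.
    by rewrite -modelB_clsB !DE D0B.
  - rewrite (dhomZ hpsi); elim/modelB_ind: (psi x) => a.
    rewrite [_ *: modelB_cls _ _ _]clsZ !DE /D0 [_ *: modelB_cls _ _ _]clsZ; congr (cls _ _ _).
    by rewrite mulrCA [LHS]demazureM // uT_L hr.
  - rewrite (dhomR hpsi); elim/modelB_ind: (psi x) => a.
    rewrite [ract (modelB_cls _ _ _) _]cls_ra !DE /D0 [ract (modelB_cls _ _ _) _]cls_ra.
    by congr (cls _ _ _); rewrite mulrCA [LHS]demazureM // uT_R.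
  - rewrite (dhom_pr hpsi); elim/modelB_ind: (psi x) => a.
    rewrite [pr _ (modelB_cls _ _ _)]cls_pr !DE /D0 [pr _ (modelB_cls _ _ _)]cls_pr.
    congr (cls _ _ _); rewrite -demazure_regpr; congr demazure.
    exact/esym/(@regpr_mul _ _ (j + l.+1%:Z) 1 _ _ gh).
exists F; first by have -> : l.+2%:Z = l.+1%:Z + 1 by lia.
by move=> x hx; rewrite Fi hx DE /D0 mulr1 g1.
Qed.

(** Passing from length l to length l + 1 requires [l] to be invertible. *)
Lemma psi_exists p l : (l < m)%N -> exists2 psi : BS h (alt_word p l.+1) -> modelB p l.+1,
  dhom l.+1%:Z psi & psi (BS_gen (alt_word p l.+1)) = modelB_cls p l.+1 1.
Proof.
elim: l => [|l IH] lm; first exact: psi_base.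
have [psi hpsi e] := IH (ltnW lm).
have [psi' h' e'] := psi_step lm hpsi.
by exists psi' => //; exact: e'.
Qed.

(** The composite fixes 1, which generates. *)
Lemma BS_retract p l : (l < m)%N ->
  exists phi : modelB p l.+1 -> BS h (alt_word p l.+1),
  exists psi : BS h (alt_word p l.+1) -> modelB p l.+1,
  [/\ dhom (- l.+1%:Z) phi, dhom l.+1%:Z psi & cancel phi psi].
Proof.
move=> lm; have [phi hphi e1] := phi_exists p l.
have [psi hpsi e2] := psi_exists p lm.
exists phi, psi; split=> //.
apply: (cyclic_quo rho_weights (dhom_comp hphi hpsi) (dhom_id _)).
by rewrite /= -[cls _ _ _]/(modelB_cls p l.+1 1) e1 e2.
Qed.

End BottSamelson.

(** * Evaluation at a point and what kills a Bott-Samelson bimodule *)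
Section Support.
Variables (k : comUnitRingType) (n m : nat) (h : realization k n m).
Variable rho : bool -> 'cV[k]_n.
Hypothesis rho_weights :
  forall u v : bool, pairing (alphav h v) (rho u) = (u == v)%:R.
Hypothesis alpha_free : forall a b : k,
  a *: alpha h gen_s + b *: alpha h gen_t = 0 -> a = 0 /\ b = 0.
Hypothesis qnum_unit :
  forall j : nat, (1 <= j < m)%N -> qnum (rq h) j \is a GRing.unit.
Hypothesis m_ge2 : (2 <= m)%N.
Local Notation R := {mpoly k[n]}.
Local Notation T := {mpoly k[n + 2]}.
Local Notation Re := {mpoly {mpoly k[n]}[n]}.
Local Notation qn := (qnum (rq h)).
Local Notation mL := (@mL k n).
Local Notation mR := (mR h).
Local Notation X := (@X k n).
Local Notation Y := (@Y k n).
Local Notation sref u := (sym_refl (alpha h u) (alphav h u)).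
Local Notation srefl u := (dual_refl (alpha h u) (alphav h u)).
Local Notation iota u := (iota (alpha h u) (alphav h u)).
Local Notation modelB := (modelB h rho).
Local Notation modelB_cls := (modelB_cls h rho).

Definition wact (e : seq bool) (l : 'cV[k]_n) : 'cV[k]_n :=
  foldr (fun u l => srefl u l) l e.
Definition wsym (e : seq bool) (f : R) : R := foldr (fun u f => sref u f) f e.

Lemma wact_linear e : linear (wact e).
Proof.
elim: e => [|u e IH] a x y //; rewrite -![wact (u :: e) _]/(srefl u (wact e _)).
by rewrite IH linearP.
Qed.
HB.instance Definition _ e :=
  GRing.isLinear.Build k 'cV[k]_n 'cV[k]_n _ (wact e) (wact_linear e).

Lemma wactD e x y : wact e (x + y) = wact e x + wact e y.
Proof. exact: raddfD. Qed.
Lemma wactZ e c x : wact e (c *: x) = c *: wact e x.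
Proof. by rewrite -[LHS]/((wact e : {linear _ -> _}) (c *: x)) linearZ. Qed.

Lemma wsym_rmorph e : zmod_morphism (wsym e) * monoid_morphism (wsym e).
Proof.
elim: e => [|u e [IHB [IH1 IHM]]] //.
have E f : wsym (u :: e) f = sref u (wsym e f) by [].
split=> [x y|]; first by rewrite !E IHB rmorphB.
by split=> [|x y]; rewrite !E ?IH1 ?IHM ?rmorph1 ?rmorphM.
Qed.
HB.instance Definition _ e := GRing.isZmodMorphism.Build R R (wsym e) (wsym_rmorph e).1.
HB.instance Definition _ e := GRing.isMonoidMorphism.Build R R (wsym e) (wsym_rmorph e).2.

Lemma wsymC e c : wsym e c%:MP = c%:MP.
Proof. by elim: e => //= u e ->; rewrite sym_reflC. Qed.
Lemma wsym_linform e l : wsym e (linform l) = linform (wact e l).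
Proof. by elim: e => //= u e ->; rewrite sym_refl_linform. Qed.
Lemma wsym_quad_inv e : wsym e (quad_inv h rho) = quad_inv h rho.
Proof. by elim: e => //= u e ->; rewrite quad_inv_refl. Qed.

Lemma quad_inv_regular f : quad_inv h rho * f = 0 -> f = 0.
Proof.
apply: mpoly_mccoy => c; apply: (@meval_reg _ _ (alphav h gen_s)).
rewrite /quad_inv !(mevalD, mevalN, mevalM) !meval_linform !rho_weights rz_diag /=.
rewrite (_ : _ + _ = 1) ?unitr1 //; ring.
Qed.

(** Two elements of W may agree on one fundamental weight but not on both; as
    the quadratic invariant puts the two weights in different degrees, a single
    polynomial separates all elements of W. *)
Definition separator : R := linform (rho gen_s) + quad_inv h rho * linform (rho gen_t).

Lemma wsym_separator e : wsym e separator =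
  linform (wact e (rho gen_s)) + quad_inv h rho * linform (wact e (rho gen_t)).
Proof. by rewrite /separator rmorphD rmorphM /= !wsym_linform wsym_quad_inv. Qed.

(** The images of the separator under all subwords, with multiplicities. *)
Fixpoint subword_orbit (e : seq bool) : seq R :=
  if e is u :: e'
  then subword_orbit e' ++ [seq sref u r | r <- subword_orbit e']
  else [:: separator].

Lemma subword_orbitP e r : r \in subword_orbit e ->
  exists2 x, (size x <= size e)%N & r = wsym x separator.
Proof.
elim: e r => [|u e IH] r /=; first by rewrite inE => /eqP ->; exists [::].
rewrite mem_cat => /orP[/IH[x le ->]|/mapP[r' /IH[x le ->] ->]].
  by exists x => //; exact: leqW.
by exists (u :: x).
Qed.

Definition annihilator (e : seq bool) : Re := \prod_(r <- subword_orbit e) theta separator r.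

(** Each r of the orbit for e occurs together with its mirror image in the orbit
    for u :: e, so the product passes through iota. *)
Lemma annihilator_BS e (x : BS h e) : act (annihilator e) x = 0.
Proof.
elim: e x => [|u e IH] x.
  rewrite /annihilator /= big_seq1 /theta actDl actN act_inr act_left /=.
  by rewrite [_ *: _]mulrC subrr.
have sl : slides (alpha h u) (alphav h u) (annihilator (u :: e)).
  rewrite /annihilator /= big_cat big_map /= -big_split /=.
  apply: (big_ind (@slides k n (alpha h u) (alphav h u))) => [|f g|r _].
  - exact: slides1.
  - exact: slidesM.
  - by apply: slides_theta2 => //; rewrite sym_reflK // rz_diag.
elim/ind_ind: x => [|x y hx hy|r x].
- exact: act0r.
- by rewrite actDr actNr hx hy oppr0 addr0.
rewrite -[r *: _]act_left -actM mulrC actM sl.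
rewrite /annihilator /= big_cat /= mulrC actM.
rewrite -[act _ x]/(act (annihilator e) x) IH act0r iota0.
by rewrite act_left scaler0.
Qed.

Lemma rho_alpha_coef p (c A B : k) :
  c *: (rho p - A *: alpha h p - B *: alpha h (~~ p)) = c *: rho p -> c * A = 0.
Proof.
move=> e; have e2 : (c * A) *: alpha h p + (c * B) *: alpha h (~~ p) = 0.
  rewrite -!scalerA -scalerDr -(subrr (c *: rho p)) -{2}e -scalerBr.
  by congr (c *: _); rewrite -addrA -opprD opprB [RHS]addrC subrK.
case: p e e2 => _ e2; first by have [] := alpha_free e2.
by rewrite addrC in e2; have [] := alpha_free e2.
Qed.

(** The coefficient of alpha_p in rho_p - omega p i is the square of the quantum
    number of index uphalf i. *)
Lemma omega_fixed p i (c : k) : (0 < i < 2 * m.-1.+1)%N ->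
  c *: omega h rho p i = c *: rho p -> (uphalf i < m)%N -> c = 0.
Proof.
move=> /andP[i0 _] e im.
have hu : qn (uphalf i) \is a GRing.unit.
  by rewrite qnum_unit // im andbT; case: (i) i0.
suff : c * qn (uphalf i) ^+ 2 = 0.
  by move=> e2; apply: (mulIr (unitrX 2 hu)); rewrite mul0r.
have [o1 o2] := omega_explicit rho_weights p i./2.
move: e; rewrite uphalf_half -{1}(odd_double_half i) -mul2n.
case: (odd i); rewrite ?add1n ?add0n ?o1 ?o2 => e; exact: rho_alpha_coef e.
Qed.

Lemma wact_alt_word p l : wact (alt_word p l.+1) (rho p) = omega h rho p l /\
                      wact (alt_word p l) (rho (~~ p)) = omega h rho (~~ p) l.
Proof.
elim: l => [|l [IH1 IH2]].
  split=> //=; rewrite srefl_rho // /letter /=.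
  by case: p; rewrite /= scale0r subr0.
split; first by rewrite -[LHS]/(srefl (letter p l.+1) (wact (alt_word p l.+1) (rho p))) IH1.
rewrite -[LHS]/(srefl (letter p l) (wact (alt_word p l) (rho (~~ p)))) IH2 /=.
by congr (dual_refl (alpha h _) (alphav h _) _);
  rewrite /letter /=; case: (odd l); rewrite ?negbK.
Qed.

(** Strip the letters of x one by one, moving each one to the other side where it
    cancels or lengthens the alternating word.  What remains is an alternating
    word of length between 1 and 2 m - 1, to be compared with the identity. *)
Lemma wact_separated p L x (c : k) : (size x < L)%N -> (L + size x < 2 * m)%N ->
  (forall u, c *: wact (alt_word p L) (rho u) = c *: wact x (rho u)) -> c = 0.
Proof.
elim: x L => [|u x IH] L /=; rewrite ?addn0 => lt le e.
  case: L lt le e => // L _ le e.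
  have := e (~~ p); rewrite (wact_alt_word p L.+1).2 /= => e1.
  (* Otherwise the word has length 2 m - 1 and equals the reflection that fixes
     rho_(~~ p), whence the switch to rho_p and the index L. *)
  have [lt|ge] := ltnP (uphalf L.+1) m.
    by apply: (omega_fixed (p := ~~ p) (i := L.+1)) => //; lia.
  have := e p; rewrite (wact_alt_word p L).1 /= => e2.
  by apply: (omega_fixed (p := p) (i := L)) => //; lia.
have invol : involutive (srefl u) by apply: dual_reflK; rewrite rz_diag.
have e' v : c *: srefl u (wact (alt_word p L) (rho v)) = c *: wact x (rho v).
  by have := congr1 (srefl u) (e v); rewrite !linearZ /= invol.
have [uL|uL] := eqVneq u (letter p L).
  by apply: (IH L.+1) => [||v]; [lia|lia|rewrite -e' uL].
case: L lt le e uL e' => // L lt le e uL e'.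
have {}uL : u = letter p L.
  by move: uL; rewrite letterS; case: (u); case: (letter p L).
apply: (IH L) => [||v]; [lia|lia|].
rewrite -e' -[alt_word p L.+1]/(letter p L :: alt_word p L) /= -uL.
by rewrite invol.
Qed.

Lemma separator_regular p l x f : (size x <= l)%N -> (l < m)%N ->
  (wsym (alt_word p l.+1) separator - wsym x separator) * f = 0 -> f = 0.
Proof.
move=> sx lm; apply: mpoly_mccoy => c e.
apply: (@wact_separated p l.+1 x) => [||u]; [lia|lia|].
set d := fun u => wact (alt_word p l.+1) (rho u) - wact x (rho u).
suff d0 : c *: linform (d gen_s) = 0 /\ c *: linform (d gen_t) = 0.
  apply/eqP; rewrite -subr_eq0 -scalerBr -/(d u); apply/eqP/linform_eq0.
  by rewrite linearZ; case: u; case: d0.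
have {}e : c *: linform (d gen_s) + quad_inv h rho * (c *: linform (d gen_t)) = 0.
  rewrite -[RHS]e !wsym_separator /d !linformD !linformN -!mul_mpolyC; ring.
have hs : c *: linform (d gen_s) \is 1.-homog by rewrite dhomogZ // linform_homog.
have ht : quad_inv h rho * (c *: linform (d gen_t)) \is 3.-homog.
  apply: (@dhomogM _ _ _ 2 _ 1); last by rewrite dhomogZ // linform_homog.
  have m2 (f1 f2 : R) : f1 \is 1.-homog -> f2 \is 1.-homog -> f1 * f2 \is 2.-homog.
    by move=> h1 h2; exact: (@dhomogM _ _ _ 1 _ 1).
  by rewrite /quad_inv mul_mpolyC !rpredD ?rpredN ?dhomogZ ?m2 ?linform_homog.
have e1 : c *: linform (d gen_s) = 0.
  have := congr1 (pihomog mdeg 1) e.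
  by rewrite raddfD raddf0 /= (pihomog_dE hs) (pihomog_ne0 _ ht) // addr0.
by split=> //; apply: quad_inv_regular; rewrite -[RHS]e e1 add0r.
Qed.

(** Evaluation at the point w of the conic: x_u becomes w(rho_u). *)
Section Eval.
Variables (p : bool) (l : nat).
Local Notation w := (alt_word p l.+1).
Definition ev_mx : 'M[k]_(n, n + 2) :=
  row_mx 1%:M ((wact w (rho true) - rho true) *m (ycol k true)^T
             + (wact w (rho false) - rho false) *m (ycol k false)^T).

Lemma ev_X l' : symmap ev_mx (X l') = linform l'.
Proof. by rewrite symmap_linform mul_row_col mul1mx mulmx0 addr0. Qed.

Lemma ev_Y u : symmap ev_mx (Y u) = linform (wact w (rho u)) - linform (rho u).
Proof.
rewrite symmap_linform mul_row_col mulmx0 add0r mulmxDl -!mulmxA !ycol_ycol.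
by rewrite !mul_mx_scalar -linformN -linformD; case: u;
   rewrite /= scale1r scale0r ?addr0 ?add0r.
Qed.

Lemma ev_mL f : symmap ev_mx (symmap mL f) = f.
Proof.
rewrite -[LHS]/((symmap ev_mx \o symmap mL) f).
apply: (@mpoly_rmorph_ext _ _ _ _ idfun) => [c|l'] /=; first by rewrite !symmapC.
by rewrite iL_linform ev_X.
Qed.

Lemma wact_inv e z : (forall u, pairing (alphav h u) z = 0) -> wact e z = z.
Proof.
by move=> hz; elim: e => //= u e ->; rewrite /dual_refl hz scale0r subr0.
Qed.

Lemma ev_mR f : symmap ev_mx (symmap mR f) = wsym w f.
Proof.
rewrite -[LHS]/((symmap ev_mx \o symmap mR) f).
apply: mpoly_rmorph_ext f => [c|l'].
  by rewrite -[LHS]/(symmap ev_mx (symmap mR c%:MP)) -[RHS]/(wsym w c%:MP) !symmapC wsymC.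
rewrite -[LHS]/(symmap ev_mx (symmap mR (linform l'))).
rewrite -[RHS]/(wsym w (linform l')) wsym_linform jR_linform.
rewrite !rmorphD !rmorphM /= !symmapC ev_X !ev_Y -!linformN -!linformD -!linformZ -!linformD.
rewrite -[RHS]/(linform (wact w l')).
congr linform.
have [z zc lE] := weight_decomp rho_weights l'.
set a := pairing (alphav h true) l' in lE *.
set b := pairing (alphav h false) l' in lE *.
have -> : wact w l' = z + a *: wact w (rho true) + b *: wact w (rho false).
  by rewrite {1}lE !wactD !wactZ (wact_inv _ zc).
rewrite {1}lE !scalerBr; exact: swap_summands.
Qed.

Lemma ev_idl f : f \in idl (quadric h) (Fpoly h rho p l.+1) -> symmap ev_mx f = 0.
Proof.
move=> /idlP[a [b ->]]; rewrite rmorphD !rmorphM /=.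
have -> : symmap ev_mx (quadric h) = 0.
  by rewrite -(quadricE rho_weights) rmorphB /= ev_mR ev_mL wsym_quad_inv subrr.
have -> : symmap ev_mx (Fpoly h rho p l.+1) = 0; last by rewrite !mulr0 addr0.
rewrite FpolyS rmorphM /= /lineT rmorphB rmorphD /= !ev_X ev_Y (wact_alt_word p l).1.
by rewrite [X in X - _]addrC subrK subrr mulr0.
Qed.

(** At the point w the annihilator becomes a product of differences
    w(f) - x(f), where x is shorter than w: all of them are regular. *)
Lemma annihilator_modelB f (c : k) : (size f <= l)%N -> (l < m)%N ->
  act (annihilator f) (modelB_cls p l.+1 c%:MP) = 0 -> c = 0.
Proof.
move=> sf lm.
have actE rs : act (\prod_(r <- rs) theta separator r) (modelB_cls p l.+1 c%:MP) =
   modelB_cls p l.+1 ((\prod_(r <- rs) (symmap mR separator - symmap mL r)) * c%:MP).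
  elim: rs => [|r rs IH]; first by rewrite !big_nil act1 mul1r.
  rewrite !big_cons actM IH /theta actDl actN act_inr act_left.
  rewrite [ract (modelB_cls _ _ _) _]cls_ra [_ *: modelB_cls _ _ _]clsZ.
  by rewrite -[LHS](modelB_clsB h rho p) -mulrBl mulrA.
rewrite /annihilator actE => /cls0 /ev_idl.
rewrite rmorphM /= symmapC rmorph_prod /=.
have reg rs g : {subset rs <= subword_orbit f} ->
  (\prod_(r <- rs) symmap ev_mx (symmap mR separator - symmap mL r)) * g = 0 -> g = 0.
  elim: rs => [|r rs IH] sub; first by rewrite big_nil mul1r.
  rewrite big_cons -mulrA rmorphB /= ev_mR ev_mL.
  have [x sx ->] := subword_orbitP (sub r (mem_head _ _)).
  move=> /(separator_regular (leq_trans sx sf) lm); apply: IH => r' hr'.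
  by apply: sub; rewrite inE hr' orbT.
move=> /(reg _ _ (fun _ hr => hr)) e.
by apply/eqP; rewrite -(mpolyC_eq0 n); apply/eqP.
Qed.

End Eval.
End Support.

(** * Identification of B_w *)
Section Summand.
Variables (k : comUnitRingType) (n m : nat) (h : realization k n m).
Variable rho : bool -> 'cV[k]_n.
Hypothesis rho_weights :
  forall u v : bool, pairing (alphav h v) (rho u) = (u == v)%:R.
Hypothesis alpha_free : forall a b : k,
  a *: alpha h gen_s + b *: alpha h gen_t = 0 -> a = 0 /\ b = 0.
Hypothesis qnum_unit :
  forall j : nat, (1 <= j < m)%N -> qnum (rq h) j \is a GRing.unit.
Hypothesis m_ge2 : (2 <= m)%N.
Variables (p : bool) (l : nat).
Hypothesis lm : (l < m)%N.
Local Notation modelB := (modelB h rho).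
Local Notation modelB_cls := (modelB_cls h rho).
Local Notation bimod := (grbimod k n).

Lemma modelB_degree0 (x : modelB p l.+1) : pr 0 x = x -> exists c, x = modelB_cls p l.+1 c%:MP.
Proof.
elim/modelB_ind: x => f; rewrite [pr _ (modelB_cls _ _ _)]cls_pr => <-.
have h0 : regpr 0 f \is 0.-homog by rewrite /= pihomogP.
exists (regpr 0 f)@_0; congr (cls _ _ _); apply/mpolyP => mu.
rewrite mcoeffC; case: eqP => [<-|ne]; first by rewrite mulr1.
rewrite mulr0; apply: (dhomog_nemf_coeff h0); rewrite mdeg_eq0.
by apply/eqP => e; apply: ne.
Qed.

Lemma pr_modelB_cls1 : pr 0 (modelB_cls p l.+1 1) = modelB_cls p l.+1 1.
Proof.
by rewrite [pr _ (modelB_cls _ _ _)]cls_pr /= pihomog_dE // dhomog1.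
Qed.

Lemma modelB_neq0 : ~ bimod_zero (modelB p l.+1).
Proof.
move=> z; have /eqP := oner_neq0 k; apply.
apply: (annihilator_modelB rho_weights alpha_free qnum_unit m_ge2
  (p := p) (f := [::]) (leq0n l) lm).
by rewrite (z (modelB_cls p l.+1 _)) act0r.
Qed.

(** The composite is a scalar c.  The annihilator of the shorter expression acts
    by 0 on N, hence kills c. *)
Lemma through_lower (N : bimod) a (f : modelB p l.+1 -> N) (g : N -> modelB p l.+1) :
  occurs_below h l.+1 N -> dhom a f -> dhom (- a) g -> g (f (modelB_cls p l.+1 1)) = 0.
Proof.
move=> [e [b [se [M' /bimod_iso_dhom[F [G [hF hG FK GK]]]]]]] hf hg.
have annN (x : N) : act (annihilator h rho e) x = 0.
  pose j : N -> BS h e := G \o (fun x : shift N b => (x, 0) : dsum (shift N b) M').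
  have hj : dhom (- b + (0 + 0)) j.
    apply: dhom_comp (dhom_comp (dhom_inl _ _) hG).
    by apply: dhom_inv (dhom_unshift N b) _ _.
  have jI x1 : j x1 = 0 -> x1 = 0.
    by move=> /(congr1 F); rewrite /j /= GK (dhom0 hF) => /(congr1 fst).
  by apply: jI; rewrite (dhom_act hj) annihilator_BS.
have [c ec] : exists c, g (f (modelB_cls p l.+1 1)) = modelB_cls p l.+1 c%:MP.
  apply: modelB_degree0; have := dhom_pr (dhom_comp hf hg) 0 (modelB_cls p l.+1 1).
  by rewrite pr_modelB_cls1 /= subrr addr0 => <-.
rewrite ec (_ : c = 0) ?mpolyC0 ?(modelB_cls0 (rpred0 _)) //.
apply: (annihilator_modelB rho_weights alpha_free qnum_unit m_ge2
  (p := p) (f := e) (l := l)) => //.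
by rewrite -ec -(dhom_act hg) annN (dhom0 hg).
Qed.

(** Drop the summands one at a time: the identity of the model is the sum of its
    parts through N and through the rest, and the first part is 0. *)
Lemma retract_of_sum (B : bimod) Ns a
    (f : modelB p l.+1 -> foldr (@dsum k n) B Ns)
    (g : foldr (@dsum k n) B Ns -> modelB p l.+1) :
  List.Forall (occurs_below h l.+1) Ns ->
  dhom a f -> dhom (- a) g -> cancel f g ->
  exists f' : modelB p l.+1 -> B, exists g' : B -> modelB p l.+1,
    [/\ dhom a f', dhom (- a) g' & cancel f' g'].
Proof.
elim: Ns f g => [|N Ns IH] f g /= hN hf hg fK; first by exists f, g.
have [hN1 hNs] : occurs_below h l.+1 N /\ List.Forall (occurs_below h l.+1) Ns.
  by inversion hN.
have D := dhomD hg.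
have h1 := dhom_comp hf (dhom_fst _ _); have h2 := dhom_comp hf (dhom_snd _ _).
have g1 := dhom_comp (dhom_inl N (foldr (@dsum k n) B Ns)) hg.
have g2 := dhom_comp (dhom_inr N (foldr (@dsum k n) B Ns)) hg.
rewrite addr0 in h1 h2; rewrite add0r in g1 g2.
apply: (IH _ _ hNs h2 g2).
have hgf := dhom_comp h2 g2; rewrite subrr in hgf.
apply: (cyclic_quo rho_weights hgf (dhom_id _)).
rewrite -[cls _ _ _]/(modelB_cls p l.+1 1) -[RHS]/(modelB_cls p l.+1 1).
rewrite -{2}[modelB_cls p l.+1 1]fK -[LHS]add0r -(through_lower hN1 h1 g1) /= -D.
congr g; rewrite [f _ in RHS]surjective_pairing.
by congr pair; rewrite /= ?addr0 ?add0r.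
Qed.

Lemma Bw_iso (W : dihedral m) (w : W) (B : bimod) e (Ns : seq bimod) :
  ell w = l.+1 -> indecomposable B -> e = alt_word p l.+1 ->
  bimod_iso (BS h e) (foldr (@dsum k n) B Ns) ->
  List.Forall (fun N => indecomposable N /\ occurs_below h (ell w) N) Ns ->
  exists g : B -> modelB p l.+1, dhom l.+1%:Z g /\ bijective g.
Proof.
move=> -> indB -> /bimod_iso_dhom[F [G [hF hG FK GK]]] hNs.
have [phi [psi [hphi hpsi phiK]]] := BS_retract rho_weights alpha_free qnum_unit p lm.
have hf := dhom_comp hphi hF; have hg := dhom_comp hG hpsi.
rewrite addr0 in hf; rewrite add0r -[l.+1%:Z]opprK in hg.
have hN : List.Forall (occurs_below h l.+1) Ns.
  by apply: List.Forall_impl hNs => N [].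
have [|f' [g' [hf' hg' fK']]] := retract_of_sum hN hf hg.
  by move=> x /=; rewrite FK phiK.
exists g'; split; first by rewrite -[l.+1%:Z]opprK.
exact: indecomposable_retract hf' hg' fK' modelB_neq0 indB.
Qed.

End Summand.

(** * Kernel and cokernel of rho_s (x) 1 - 1 (x) rho_s *)
Section KernelCokernel.
Variables (k : comUnitRingType) (n m : nat) (h : realization k n m).
Variable rho : bool -> 'cV[k]_n.
Hypothesis rho_weights :
  forall u v : bool, pairing (alphav h v) (rho u) = (u == v)%:R.
Hypothesis alpha_free : forall a b : k,
  a *: alpha h gen_s + b *: alpha h gen_t = 0 -> a = 0 /\ b = 0.
Hypothesis qnum_unit :
  forall j : nat, (1 <= j < m)%N -> qnum (rq h) j \is a GRing.unit.
Local Notation R := {mpoly k[n]}.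
Local Notation T := {mpoly k[n + 2]}.
Local Notation RR := (Rbim k n).
Local Notation mL := (@mL k n).
Local Notation mR := (mR h).
Local Notation X := (@X k n).
Local Notation Y := (@Y k n).
Local Notation modelB := (modelB h rho).
Local Notation modelB_cls := (modelB_cls h rho).
Local Notation bimod := (grbimod k n).
Local Notation homelT := (homel k (n + 2)).
Local Notation quo g1 g2 := (quo mL mR g1 g2).
Local Notation sref u := (sym_refl (alpha h u) (alphav h u)).

Lemma quoB (g1 g2 : homelT) f g :
  (cls g1 g2 (f - g) : quo g1 g2) = cls g1 g2 f - cls g1 g2 g.
Proof. exact: (raddfB (cls g1 g2)). Qed.

Lemma zact_cls u (g1 g2 : homelT) f :
  zact (rho u) (cls g1 g2 f : quo g1 g2) = cls g1 g2 (- Y u * f).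
Proof.
rewrite /zact clsZ cls_ra -quoB -mulrBl (jR_rho rho_weights) iL_linform.
by rewrite opprD addrA subrr add0r.
Qed.

Lemma quo_mul_hom (g1 g2 g1' g2' : homelT) (G : T) d : G \is d.-homog ->
  (forall f, f \in idl g1 g2 -> G * f \in idl g1' g2') ->
  exists2 F : quo g1 g2 -> quo g1' g2', dhom (2 * d)%:Z F &
    forall f, F (cls g1 g2 f) = cls g1' g2' (G * f).
Proof.
move=> hG hI; pose F0 (f : T) : quo g1' g2' := cls g1' g2' (G * f).
have F0B : zmod_morphism F0 by move=> x y; rewrite /F0 mulrBr quoB.
have F00 y : y \in idl g1 g2 -> F0 y = 0 by move=> /hI hy; apply/cls0.
exists (lift_quo F0); last by move=> f; exact: lift_quoE.
apply: dhom_lift_quo => // [r x|r x|e x].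
- by rewrite /F0 [_ *: _]clsZ mulrCA.
- by rewrite /F0 [ract _ _]cls_ra mulrCA.
- by rewrite /F0 [pr _ _]cls_pr (regpr_mul _ _ hG).
Qed.

(** If F = y G modulo q and F is regular modulo q, so are y and G.  On T / (q, F)
    the cokernel of y is T / (q, y), and y f in (q, F) means f in (q, G), so that
    multiplication by G identifies T / (q, y) with the kernel. *)
Lemma pi_quotient (q y F G : homelT) (c : T) (M K : bimod) a b
    (th : M -> quo q F) (ka : K -> quo q y) :
  y = Y gen_s :> T -> (F : T) = (y : T) * G + (q : T) * c ->
  regular_mod q F -> dhom a th -> bijective th -> dhom b ka -> bijective ka ->
  bimod_iso (pi_minus (rho gen_s) M) (shift K (a - b - (2 * hdeg G)%:Z)) /\
  bimod_iso (pi_plus (rho gen_s) M) (shift K (a - b)).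
Proof.
move=> yE FE Freg hth [th' thK th'K] hka [ka' kaK ka'K].
have hth' := dhom_inv hth thK th'K; have hka' := dhom_inv hka kaK ka'K.
have yG_reg : regular_mod q ((y : T) * G).
  move=> f g e; apply: (Freg f (g + c * f)).
  by rewrite FE mulrDl e mulrDr mulrA.
have y_reg := regular_modMr yG_reg; have G_reg := regular_modMl yG_reg.
have subF f : f \in idl q F -> f \in idl q y.
  move=> /idlP[u [v ->]]; apply/idlP; exists (u + v * c), (v * G).
  by rewrite FE; ring.
split.
  have [mu hmu muE] : exists2 mu : quo q y -> quo q F, dhom (2 * hdeg G)%:Z mu &
      forall f, mu (cls q y f) = cls q F (hel G * f).
    apply: quo_mul_hom (hel_homog G) _ => f /idlP[u [v ->]]; apply/idlP.
    by exists (hel G * u - v * c), v; rewrite FE; ring.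
  have hf := dhom_comp (dhom_comp hka hmu) hth'.
  have -> : a - b - (2 * hdeg G)%:Z = - (b + (2 * hdeg G)%:Z - a) by ring.
  apply: (pi_minus_iso hf).
  - apply: (dhom_inj hf) => x /= /(congr1 th); rewrite th'K (dhom0 hth).
    move: (ka x) (kaK x) => z <-; elim/cls_ind: z => f; rewrite muE.
    move=> /cls0/idlP[u [v e]]; rewrite (_ : cls q y f = 0) ?(dhom0 hka') //.
    apply/cls0; have [z zE] : exists z, f - v * y = (q : T) * z.
      apply: (G_reg _ (u + v * c)); rewrite mulrBr e FE; ring.
    by apply/idlP; exists z, v; rewrite -[f](subrK (v * y)) zE mulrC.
  - move=> x /=; apply: (can_inj thK); rewrite (dhom_zact hth) th'K (dhom0 hth).
    move: (ka x) => z; elim/cls_ind: z => f; rewrite muE zact_cls.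
    apply/cls0/idlP; exists (c * f), (- f); rewrite FE -yE; ring.
  - move=> x /(congr1 th); rewrite (dhom_zact hth) (dhom0 hth).
    have := thK x; move: (th x) => z <-; elim/cls_ind: z => f.
    rewrite zact_cls => /cls0/idlP[u [v e]].
    have [z zE] : exists z, f + v * G = (q : T) * z.
      apply: (y_reg _ (- u - v * c)).
      have {}e : (y : T) * f = - (u * q + v * F) by rewrite -e yE mulNr opprK.
      by rewrite mulrDr e FE; ring.
    exists (ka' (cls q y (- v))); rewrite /= ka'K muE; congr th'.
    by apply/clsP/idlP; exists z, 0; rewrite (mulrC z) -zE; ring.
have [pi hpi piE] : exists2 pi : quo q F -> quo q y, dhom (2 * 0)%:Z pi &
    forall f, pi (cls q F f) = cls q y (1 * f).
  by apply: quo_mul_hom; [exact: dhomog1|move=> f; rewrite mul1r; exact: subF].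
have hg := dhom_comp (dhom_comp hth hpi) hka'.
have -> : a - b = a + (2 * 0)%:Z - b by rewrite muln0 addr0.
apply: (pi_plus_iso hg).
- move=> x; have [f fE] : exists f, ka x = cls q y f.
    by move: (ka x); elim/cls_ind => f; exists f.
  by exists (th' (cls q F f)); rewrite /= th'K piE mul1r -fE kaK.
- move=> x /=; rewrite (dhom_zact hth); move: (th x) => z; elim/cls_ind: z => f.
  rewrite zact_cls piE (_ : cls q y _ = 0) ?(dhom0 hka') //.
  by apply/cls0/idlP; exists 0, (- f); rewrite -yE; ring.
- move=> x /= /(congr1 ka); rewrite ka'K (dhom0 hka).
  have := thK x; move: (th x) => z <-; elim/cls_ind: z => f.
  rewrite piE => /cls0/idlP[u [v e]]; exists (th' (cls q F (- v))).
  rewrite -(dhom_zact hth') zact_cls; congr th'; apply/clsP/idlP.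
  by exists u, 0; rewrite -[f]mul1r e -yE; ring.
Qed.

Lemma Bgen_central u : central h (Bgen h u).
Proof.
move=> z hz x; have zi : linform z \in gs_inv (alpha h u) (alphav h u).
  by apply/eqP; rewrite sym_refl_linform /dual_refl hz scale0r subr0.
elim/tens_ind: x => [|x y hx hy|a b]; first by rewrite scaler0 ra0l.
  by rewrite scalerBr raB hx hy.
rewrite [_ *: _]tens_scale_pure [RHS]tens_ra_pure.
have := pureA (a : RR) (b : RR) zi; rewrite /= [_ *: b]mulrC => <-.
by rewrite [_ *: a]mulrC.
Qed.

(** The model of length 1 is the Soergel generator itself, both being generated
    by an element whose annihilator contains the relations of the other. *)
Lemma Bgen_modelB p : exists2 th : Bgen h (~~ p) -> modelB p 1, dhom 1 th & bijective th.
Proof.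
pose c : Bgen h (~~ p) := pure (gs_inv _ _) (1 : RR) (1 : RR).
have [psi hpsi e1] := psi_base rho alpha_free p.
pose nu (b : Bgen h (~~ p)) : BS h (alt_word p 1) := pure (gs_full k n) b (1 : RR).
have hnu : dhom 0 nu.
  have nuD x y : nu (x + y) = nu x + nu y by exact: pureDl.
  have nu0 : nu 0 = 0 by exact: pure0l.
  have h0 : pr 0 (1 : RR) = 1 by rewrite /= pihomog_dE // dhomog1.
  split=> [x y|r x|x r|d x].
  - by apply/eqP; rewrite eq_sym subr_eq -nuD subrK.
  - by rewrite [RHS]tens_scale_pure.
  - rewrite [RHS]tens_ra_pure -[LHS]/(pure _ (ract x r) (1 : RR)) pureA //=.
    by rewrite /GRing.scale /= mulr1 mul1r.
  rewrite addr0; have [s _ xs] := pr_sum x.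
  rewrite {2}xs (big_morph nu nuD nu0) pr_sumE {1}xs pr_sumE (big_morph nu nuD nu0).
  apply: eq_bigr => e _.
  have he : pr e (pr e x) = pr e x by rewrite pr_pr eqxx.
  rewrite [RHS](tens_pr_hom _ _ he h0) addr0 pr_pr.
  by case: eqP => [_|_]; rewrite ?nu0.
have [phi hphi e2] : exists2 phi : modelB p 1 -> Bgen h (~~ p),
    dhom (- 1) phi & phi (modelB_cls p 1 1) = c.
  apply: (quo_hom rho_weights); first exact: Bgen_central.
  - have h0 : pr 0 (1 : RR) = 1 by rewrite /= pihomog_dE // dhomog1.
    rewrite -[LHS]/(tens_pr (-1 + 1) (pure _ (1 : RR) (1 : RR))).
    by rewrite (tens_pr_hom _ _ h0 h0).
  - rewrite -[actT _ _ _]/(actT rho (quadric h) c).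
    rewrite -(quadricE rho_weights) actTB (actT_R rho_weights (@Bgen_central _)) actT_L.
    have qi : quad_inv h rho \in gs_inv (alpha h (~~ p)) (alphav h (~~ p)).
      by apply/eqP; exact: quad_inv_refl.
    apply/eqP; rewrite subr_eq0; apply/eqP.
    rewrite [LHS]tens_ra_pure [RHS]tens_scale_pure.
    have := pureA (1 : RR) (1 : RR) qi.
    by rewrite /= /GRing.scale /= mulr1 !mul1r => <-.
  - rewrite -[actT _ _ _]/(actT rho (Fpoly h rho p 1) c) /Fpoly big_ord1 lineT_rho.
    rewrite actT_Y; apply/eqP; rewrite subr_eq0; apply/eqP.
    have ri : linform (rho p) \in gs_inv (alpha h (~~ p)) (alphav h (~~ p)).
      apply/eqP; rewrite sym_refl_linform srefl_rho //.
      by case: (p); rewrite /= scale0r subr0.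
    rewrite [LHS]tens_ra_pure [RHS]tens_scale_pure.
    have := pureA (1 : RR) (1 : RR) ri.
    by rewrite /= /GRing.scale /= mulr1 !mul1r => <-.
have hth := dhom_comp hnu hpsi; rewrite add0r in hth.
have thc : psi (nu c) = modelB_cls p 1 1 by rewrite -e1 /= iotaE.
exists (psi \o nu) => //; exists phi.
  have hpt := dhom_comp hth hphi.
  move=> x; rewrite -[LHS]/((phi \o (psi \o nu)) x).
  elim/tens_ind: x => [|x y hx hy|a b]; first exact: (dhom0 hpt).
    by rewrite (dhomB hpt) hx hy.
  have cE : pure (gs_inv _ _) (a : RR) (b : RR) = a *: ract c b :> Bgen h (~~ p).
    rewrite [ract c b]tens_ra_pure [RHS]tens_scale_pure.
    by rewrite /= /GRing.scale /= mulr1 mul1r.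
  by rewrite cE (dhomZ hpt) (dhomR hpt) /= thc e2.
move=> x; have htp := dhom_comp hphi hth.
apply: (cyclic_quo rho_weights htp (dhom_id _) _ x).
by rewrite /= -[cls _ _ _]/(modelB_cls p 1 1) e2 thc.
Qed.

(** If the lines are those of x_s, then Y_s = 0 is one of them.  Otherwise the
    first two are Y_t = 0, through e and s, and Y_t + alpha_t = 0, through t and
    ts; on the conic the same four points lie on Y_s = 0 and on a line through s
    and ts. *)
Lemma F_split p l : p || (0 < l)%N -> exists2 G : homelT, hdeg G = l &
  exists c, Fpoly h rho p l.+1 = Y gen_s * G + quadric h * c.
Proof.
move=> pl.
have rest a b : (\prod_(j < b) lineT rho p (omega h rho p (a + j))) \is b.-homog.
  elim: b => [|b IH]; first by rewrite big_ord0 dhomog1.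
  rewrite big_ord_recr /= -[b.+1]addn1; apply: dhomogM => //; exact: lineT_homog.
case: p pl rest => [_|/= l0] rest.
  exists (Homel (rest 1 l)) => //; exists 0; rewrite /= mulr0 addr0.
  by rewrite /Fpoly big_ord_recl /= lineT_rho; congr (_ * _); apply: eq_bigr.
case: l l0 => // l _.
(* The line through s and ts: it comes from
   q = Y_t (Y_t + alpha_t) + Y_s (Y_s + alpha_s - [2] Y_t). *)
pose H := - (Y true + X (alpha h true) - (rq h + (rq h)^-1)%:MP * Y false).
have hH : H \is 1.-homog.
  by rewrite /H mul_mpolyC rpredN rpredB ?rpredD ?dhomogZ ?linform_homog.
have hG : H * \prod_(j < l) lineT rho false (omega h rho false (2 + j)) \is l.+1.-homog.
  exact: (dhomogM hH (rest 2 l)).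
exists (Homel hG) => //; exists (\prod_(j < l) lineT rho false (omega h rho false (2 + j))).
rewrite /= /Fpoly !big_ord_recl /= lineT_rho.
set A := \prod_(i < l) _.
have -> : A = \prod_(j < l) lineT rho false (omega h rho false (2 + j)).
  by apply: eq_bigr.
rewrite srefl_rho // eqxx scale1r /lineT XD XN /H /quadric.
move: (\prod_(j < l) _) (_%:MP) => C t; rewrite /gen_s /letter /=; ring.
Qed.

Lemma Bw_pi p l (B : bimod) (th : B -> modelB p l.+1) : p || (0 < l)%N ->
  dhom l.+1%:Z th -> bijective th ->
  bimod_iso (pi_minus (rho gen_s) B) (shift (Bgen h gen_t) (- l.+1%:Z + 1)) /\
  bimod_iso (pi_plus (rho gen_s) B) (shift (Bgen h gen_t) (l.+1%:Z - 1)).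
Proof.
move=> pl hth bth; have [ka hka bka] := Bgen_modelB true.
have [G dG [c FE]] := F_split pl.
have yE : F_homel h rho true 1 = Y gen_s :> T by rewrite /= /Fpoly big_ord1 lineT_rho.
have FE' : (F_homel h rho p l.+1 : T) =
   (F_homel h rho true 1 : T) * G + (quadric_homel h : T) * c by rewrite yE.
have [Hm Hp] := pi_quotient yE FE' (@regular_Fpoly _ _ _ _ _ _ _) hth bth hka bka.
split=> //; rewrite (_ : - _ + 1 = l.+1%:Z - 1 - (2 * hdeg G)%:Z) //.
by rewrite dG; lia.
Qed.

Lemma symmap_regpr p' n' (A : 'M[k]_(p', n')) d f :
  symmap A (regpr d f) = regpr d (symmap A f).
Proof.
case: d => [d|d] /=; last by rewrite rmorph0.
by case: ifP => _; rewrite ?rmorph0 // symmap_pihomog.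
Qed.

Definition Y_homel u : homelT := Homel (linform_homog (lY k n u)).

Lemma Rbim_quo : exists2 ka : RR -> quo (Y_homel gen_t) (Y_homel gen_s),
  dhom 0 ka & bijective ka.
Proof.
pose g1 := Y_homel gen_t; pose g2 := Y_homel gen_s.
pose ev : 'M[k]_(n, n + 2) := row_mx 1%:M 0.
have evX l : symmap ev (X l) = linform l.
  by rewrite symmap_linform mul_row_col mul1mx mulmx0 addr0.
have evY u : symmap ev (Y u) = 0.
  by rewrite symmap_linform mul_row_col mulmx0 mul0mx addr0 raddf0.
have evL f : symmap ev (symmap mL f) = f.
  rewrite -[LHS]/((symmap ev \o symmap mL) f).
  apply: (@mpoly_rmorph_ext _ _ _ _ idfun) => [c|l] /=; first by rewrite !symmapC.
  by rewrite iL_linform evX.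
have evR f : symmap ev (symmap mR f) = f.
  rewrite -[LHS]/((symmap ev \o symmap mR) f).
  apply: (@mpoly_rmorph_ext _ _ _ _ idfun) => [c|l] /=; first by rewrite !symmapC.
  by rewrite jR_linform !rmorphD !rmorphM /= evX !evY !mulr0 !addr0.
have evI f : f - symmap mL (symmap ev f) \in idl g1 g2.
  elim/mpoly_alg_ind: f => [c|i|f g hf hg|f g hf hg].
  - by rewrite !symmapC subrr rpred0.
  - rewrite -linform_delta; have [l [a [b ->]]] := extP (delta_mx i 0 : 'cV[k]_(n + 2)).
    rewrite !linformD !linformZ -/(X l) -/(Y true) -/(Y false).
    rewrite !(rmorphD, rmorphM) /= evX !evY !rmorph0 !mulr0 !addr0 iL_linform.
    apply/idlP; exists b%:MP, a%:MP; rewrite /= /gen_s /gen_t -/(Y _) -/(Y _); ring.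
  - rewrite !rmorphD; have hfg := rpredD hf hg.
    by apply: idl_eq hfg _; ring.
  - have hfg := rpredD (idlM g hf) (idlM (symmap mL (symmap ev f)) hg).
    by rewrite !rmorphM; apply: idl_eq hfg _; ring.
exists (fun r : RR => cls g1 g2 (symmap mL r)).
  split=> [x y|r x|x r|d x].
  - by rewrite rmorphB quoB.
  - by rewrite clsZ -rmorphM.
  - rewrite cls_ra /= rmorphM mulrC; apply/clsP; rewrite -mulrBl -opprB mulNr rpredN.
    by rewrite mulrC; apply: idlM; have := evI (symmap mR r); rewrite evR.
  - by rewrite addr0 cls_pr /= symmap_regpr.
pose F0 (f : T) : RR := symmap ev f.
have F0B : zmod_morphism F0 by move=> x y; rewrite /F0 rmorphB.
have F00 y : y \in idl g1 g2 -> F0 y = 0.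
  by move=> /idlP[a [b ->]]; rewrite /F0 rmorphD !rmorphM /= !evY !mulr0 addr0.
exists (qmap F0) => [r|]; first by rewrite [LHS]qmapE // /F0 evL.
elim/cls_ind => f; rewrite [qmap F0 _]qmapE //.
by apply/clsP; rewrite -opprB rpredN.
Qed.

Lemma regular_mod_Y u x : (forall f, sym_refl (lY k n u) (yrow k n u) x * f = 0 -> f = 0) ->
  regular_mod (Y u) x.
Proof.
move=> xreg f g e; have [z hz] := sym_refl_sub (lY k n u) (yrow k n u) f.
exists z; rewrite -/(Y u) in hz; rewrite -hz (_ : sym_refl _ _ f = 0) ?subr0 //.
apply: xreg; rewrite -rmorphM e rmorphM /= sym_refl_linform /dual_refl yrow_Y eqxx.
by rewrite scale1r subrr raddf0 mul0r.
Qed.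

(** pi_quotient with the roles changed: the base is Y_t, modulo which the conic
    is Y_s (Y_s + alpha_s). *)
Lemma Bgen_s_pi :
  bimod_iso (pi_minus (rho gen_s) (Bgen h gen_s)) (shift RR (-1)) /\
  bimod_iso (pi_plus (rho gen_s) (Bgen h gen_s)) (shift RR 1).
Proof.
have [ka hka bka] := Rbim_quo.
have [th0 hth0 [th0' th0K th0'K]] := Bgen_modelB false.
have hG : Y true + X (alpha h true) \is 1.-homog by rewrite rpredD ?linform_homog.
pose G : homelT := Homel hG.
pose c := Y false + X (alpha h false) - (rq h + (rq h)^-1)%:MP * Y true.
have FE : quadric h = Y true * (Y true + X (alpha h true)) + Y false * c.
  by rewrite /quadric /c; ring.
have yE : Y_homel gen_s = Y gen_s :> T by [].
have F1 : F_homel h rho false 1 = Y false :> T by rewrite /= /Fpoly big_ord1 lineT_rho.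
have sub1 f : f \in idl (quadric_homel h) (F_homel h rho false 1) ->
    1 * f \in idl (Y_homel gen_t) (quadric_homel h).
  rewrite mul1r F1 => /idlP[a [b ->]]; rewrite addrC rpredD ?idl_gen1 ?idl_gen2 //.
have sub2 f : f \in idl (Y_homel gen_t) (quadric_homel h) ->
    1 * f \in idl (quadric_homel h) (F_homel h rho false 1).
  rewrite mul1r F1 => /idlP[a [b ->]]; rewrite addrC rpredD ?idl_gen1 ?idl_gen2 //.
have [sw hsw swE] := quo_mul_hom (@dhomog1 _ _ _) sub1.
have [sw' hsw' swE'] := quo_mul_hom (@dhomog1 _ _ _) sub2.
have bsw : bijective sw.
  by exists sw'; elim/cls_ind => f; rewrite ?swE ?swE' ?mul1r ?swE ?swE' ?mul1r.
have hth := dhom_comp hth0 hsw; rewrite muln0 addr0 in hth.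
have bth : bijective (sw \o th0) by apply: bij_comp => //; exists th0'.
have reg : regular_mod (Y gen_t) (quadric h).
  have yE' (l' : 'cV_(n + 2)) :
    (sym_refl (lY k n false) (yrow k n false) (linform l')).@[yrow k n true 0]
    = pairing (yrow k n true) l'.
    rewrite sym_refl_linform meval_linform /dual_refl pairingB pairingZ yrow_Y.
    by rewrite mulr0 subr0.
  apply: regular_mod_Y => f; apply: mpoly_mccoy => d; apply: (@meval_reg _ _ (yrow k n true)).
  rewrite /quadric !(rmorphD, rmorphN, rmorphM) /= !yE' !yrow_X !yrow_Y /=.
  by rewrite !(mul0r, mulr0, mulr1, addr0, add0r, subr0) unitr1.
have FE' : (quadric_homel h : T) =
    (Y_homel gen_s : T) * G + (Y_homel gen_t : T) * c by exact: FE.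
have [Hm Hp] := pi_quotient yE FE' reg hth bth hka bka.
split; last by rewrite subr0 in Hp.
by rewrite (_ : -1 = 1 - 0 - (2 * hdeg G)%:Z).
Qed.

End KernelCokernel.

(** * Reduced words in the dihedral group *)
Section Words.
Variables (m : nat) (W : dihedral m).
Local Open Scope group_scope.
Implicit Types (e f : seq bool) (w : W).

Lemma ell_le e : (ell (word W e) <= size e)%N.
Proof.
rewrite /ell; case: ex_minnP => l _; apply.
by apply/existsP; exists (in_tuple e).
Qed.

Lemma dih_gen_sq u : dih_gen W u * dih_gen W u = 1.
Proof. by rewrite -expg2; have [hs ht _] := dih_rel W; case: u. Qed.

Lemma word_cons u e : word W (u :: e) = dih_gen W u * word W e.
Proof. exact: big_cons. Qed.

Lemma word1 u : word W [:: u] = dih_gen W u.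
Proof. exact: big_seq1. Qed.

Lemma word_rev e : word W (rev e) = (word W e)^-1.
Proof.
elim: e => [|u e IH]; first by rewrite /word big_nil invg1.
rewrite rev_cons -cats1 word_cat IH word1 word_cons invMg; congr (_ * _).
by apply/eqP; rewrite eq_sym eq_invg_mul dih_gen_sq.
Qed.

Lemma reduced_norep a u b w : ~ reduced_expr (a ++ u :: u :: b) w.
Proof.
case=> <- sz; have := ell_le (a ++ b).
have -> : word W (a ++ b) = word W (a ++ u :: u :: b).
  by rewrite !word_cat; congr (_ * _); rewrite !word_cons mulgA dih_gen_sq mul1g.
by rewrite -sz !size_cat /= !addnS ltnNge leqnSn.
Qed.

Lemma norep_alt_word e : (forall a u b, e <> a ++ u :: u :: b) ->
  exists p, e = alt_word p (size e).
Proof.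
elim: e => [|u e IH] h; first by exists true.
have [|p eE] := IH; first by move=> a v b eE; apply: (h (u :: a) v b); rewrite eE.
case: e eE h {IH} => [|v e] eE h; first by exists (~~ u); rewrite /= /letter /= negbK.
exists p; case: eE => vE eE; rewrite /= letterS -vE -eE.
have uv : u <> v by move=> uE; apply: (h [::] u e); rewrite uE.
by congr (_ :: _); move: uv; case: (u); case: (v).
Qed.

Lemma alt_word_drop p a b : drop a (alt_word p (a + b)) = alt_word p b.
Proof. by elim: a => [|a IH] //=; rewrite drop0. Qed.

Lemma word_alt_word_double p j :
  word W (alt_word p (2 * j)) = (dih_gen W p * dih_gen W (~~ p)) ^+ j.
Proof.
elim: j => [|j IH]; first by rewrite /word big_nil.
by rewrite mulnS add2n expgS -IH /= /letter /= oddM /= !word_cons mulgA.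
Qed.

Lemma word_alt_word_2m p : word W (alt_word p (2 * m)) = 1.
Proof.
rewrite word_alt_word_double; have [hs ht hst] := dih_rel W.
case: p => //; rewrite -[RHS]invg1 -hst -expgVn invMg.
have inv u : (dih_gen W u)^-1 = dih_gen W u.
  by apply/eqP; rewrite eq_invg_mul dih_gen_sq.
by rewrite !inv.
Qed.

Hypothesis m_gt0 : (0 < m)%N.

(** A repeated letter cancels, and an alternating word of length m + 1 equals the
    reverse of the complementary word of length m - 1, by the braid relation. *)
Lemma reduced_alt_word e w : reduced_expr e w ->
  exists2 p, e = alt_word p (ell w) & (ell w <= m)%N.
Proof.
move=> he; have [p eE] : exists p, e = alt_word p (size e).
  by apply: norep_alt_word => a u b eE; apply: (@reduced_norep a u b w); rewrite -eE.
exists p; first by rewrite {1}eE he.2.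
rewrite leqNgt; apply/negP => lt.
pose A := take m.-1 (alt_word p (2 * m)).
have e1 : word W (alt_word p m.+1) = word W (rev A).
  rewrite word_rev; apply/eqP; rewrite eq_sym eq_invg_mul -word_cat.
  rewrite -[alt_word p m.+1](alt_word_drop p m.-1) (_ : (m.-1 + m.+1 = 2 * m)%N); last by lia.
  by rewrite cat_take_drop word_alt_word_2m.
have [b bE] : exists b, ell w = (b + m.+1)%N by exists (ell w - m.+1)%N; rewrite subnK.
pose B := take b e.
have eB : e = B ++ alt_word p m.+1.
  by rewrite -[LHS](cat_take_drop b) {2}eE he.2 bE alt_word_drop.
have := ell_le (B ++ rev A); rewrite word_cat -e1 -word_cat -eB he.1.
rewrite size_cat size_rev !size_takel ?size_alt_word ?he.2 ?bE; lia.
Qed.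

Hypothesis m_ge2 : (2 <= m)%N.

(** The relations do hold in a group of order 2 m, so W is not cyclic of order at
    most 2. *)
Lemma dih_gen_neq : dih_gen W gen_s <> dih_gen W gen_t.
Proof.
move=> e; have sp := dih_span W; rewrite -e setUid in sp.
have cW : (#|[set: W]| <= 2)%N.
  by rewrite -sp -/(cycle _) -/(order _) dvdn_leq // order_dvdn expg2 dih_gen_sq.
have hom : [set: 'D_(m.*2)] \homg [set: W].
  by rewrite (dih_pres W) -(Grp'_dihedral m_ge2) homg_refl.
have := leq_trans (dvdn_leq (cardG_gt0 _) (card_homg hom)) cW.
by rewrite card_dihedral // -muln2; lia.
Qed.

Lemma reduced_t e e' w : reduced_expr e w -> reduced_expr e' w -> gen_t \in e' ->
  exists p l, [/\ e = alt_word p l.+1, ell w = l.+1, (l < m)%N & p || (0 < l)%N].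
Proof.
move=> he he' te; have [p eE lm] := reduced_alt_word he.
case lE: (ell w) eE lm => [|l] eE lm.
  by move: te he'; case: e' => // x e' _ [_]; rewrite lE.
exists p, l; split=> //; case: p eE => //; case: l lE lm => // lE _ eE.
have := he'.2; rewrite lE; case: e' he' te => [|x [|y e']] // [w' _] + _.
rewrite inE => /eqP xE; case: dih_gen_neq.
by move: he.1 w'; rewrite eE -xE /= !word1 => -> ->.
Qed.

End Words.

Theorem theorem1p2 (k : comUnitRingType) (n m : nat) (W : dihedral m)
    (h : realization k n m) (rho : bool -> 'cV[k]_n)
    (k_char0 : forall j : nat, j.+1%:R != 0 :> k)
    (m_ge2 : (2 <= m)%N)
    (alpha_free : forall a b : k,
       a *: alpha h gen_s + b *: alpha h gen_t = 0 -> a = 0 /\ b = 0)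
    (rho_weights : forall u v : bool, pairing (alphav h v) (rho u) = (u == v)%:R)
    (qnum_unit : forall j : nat, (1 <= j < m)%N -> qnum (rq h) j \is a GRing.unit)
    (q_prim : (2 * m).-primitive_root (rq h)) :
  [/\ bimod_iso (pi_plus (rho gen_s) (Rbim k n)) (Rbim k n)
    & bimod_iso (pi_minus (rho gen_s) (Rbim k n)) (Rbim k n)] /\
  [/\ bimod_iso (pi_plus (rho gen_s) (Bgen h gen_s)) (shift (Rbim k n) 1)
    & bimod_iso (pi_minus (rho gen_s) (Bgen h gen_s)) (shift (Rbim k n) (-1))] /\
  (forall (w : W) (B : grbimod k n), is_Bw h w B ->
     (exists e : seq bool, reduced_expr e w /\ gen_t \in e) ->
     [/\ bimod_iso (pi_minus (rho gen_s) B)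
           (shift (Bgen h gen_t) (- (ell w)%:Z + 1))
       & bimod_iso (pi_plus (rho gen_s) B)
           (shift (Bgen h gen_t) ((ell w)%:Z - 1))]).
Proof.
have m_gt0 := ltnW m_ge2.
have zactR (x : Rbim k n) : zact (rho gen_s) x = 0 by rewrite /zact /= mulrC subrr.
split; last split.
- split.
    apply: bimod_iso_unshift0.
    by apply: (pi_plus_iso (dhom_id _)) => [x|x|x ->]; [exists x| |exists 0; rewrite zactR].
  apply: bimod_iso_unshift0; rewrite -oppr0.
  by apply: (pi_minus_iso (dhom_id _)) => [//|x|x _]; [exact: zactR|exists x].
- by have [] := Bgen_s_pi rho_weights alpha_free.
move=> w B [_ indB _ [e [Ns [he iso hN]]]] [e' [he' te']].
have [p [l [eE lE lm pl]]] := reduced_t m_gt0 m_ge2 he he' te'.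
have [g [hg bg]] := Bw_iso rho_weights alpha_free qnum_unit m_ge2 lm lE indB eE iso hN.
rewrite lE; have [Hm Hp] := Bw_pi rho_weights alpha_free pl hg bg.
by split.
Qed.
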